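(* Suppose $E[\sup_{x\in\mathcal X}|h(x,\xi)|^2]<\infty$ and, for some constant $\delta>0$, $E[\sup_{x\in\mathcal X}|h(x,\xi)-h(x,\xi')|^{2+\delta}]<\infty$, where $\xi,\xi'$ are i.i.d. from $F$. Let the resample size $k=k_n\in\{1,\dots,n\}$ satisfy $k=O(n^\gamma)$ for some constant $\gamma<\frac12$. Then there exist random variables $\mathcal Z_{n,k}$, each of mean $0$ and variance $1$, such that $$\sqrt n\,(V_{n,k}-W_k)=k\sqrt{Var(g_k(\xi))}\cdot\mathcal Z_{n,k}+o_p(1)\quad\text{as }n\to\infty,$$ and every subsequence of $\{\mathcal Z_{n,k}\}$ along which $k^2Var(g_k(\xi))\cdot n^{\frac{\delta}{2+\delta}}\to\infty$ converges in distribution to the standard normal.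
   Context: $F$ is a probability distribution on a measurable space $\Xi$, $\mathcal X$ is a decision space, $h:\mathcal X\times\Xi\to\mathbb R$ is a cost function (all functions and suprema involved are assumed measurable), and $\xi,\xi_1,\xi_2,\ldots$ are i.i.d. from $F$. For $k\ge1$, $H_k(\xi_1,\ldots,\xi_k)=\min_{x\in\mathcal X}\frac1k\sum_{i=1}^kh(x,\xi_i)$ is the sample average approximation (SAA) optimal value, $W_k=E[H_k(\xi_1,\ldots,\xi_k)]$ (with $\xi_1,\dots,\xi_k$ i.i.d.), and $g_k(z)=E[H_k(\xi_1,\ldots,\xi_k)\mid\xi_1=z]$. The $V$-statistic is $V_{n,k}=\frac1{n^k}\sum_{i_1,\ldots,i_k\in\{1,\ldots,n\}}H_k(\xi_{i_1},\ldots,\xi_{i_k})$, the sum being over all $n^k$ index tuples (repetitions allowed). The variables $\mathcal Z_{n,k}$ live on the probability space of the data, enlarged if necessary by auxiliary randomness. *)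

(* Defs.v *)
From mathcomp Require Import all_boot all_order all_algebra finmap.
From mathcomp Require Import all_classical all_reals all_analysis measurable_realfun.

Set Implicit Arguments.
Unset Strict Implicit.
Unset Printing Implicit Defensive.

Import Order.TTheory GRing.Theory Num.Theory.
Import numFieldNormedType.Exports.

Local Open Scope classical_set_scope.
Local Open Scope ring_scope.

Definition mutually_independent (R : realType)
    (d : measure_display) (Omega : measurableType d) (P : probability Omega R)
    (d' : measure_display) (T : measurableType d')
    (X : nat -> {RV P >-> T}) : Prop :=
  forall (J : {fset nat}) (A : nat -> set T),
    (forall i, measurable (A i)) ->
    P (\bigcap_(i in [set` J]) (X i @^-1` A i)) =
    (\prod_(i <- J) P (X i @^-1` A i))%E.

Definition iid_from (R : realType)
    (d : measure_display) (Omega : measurableType d) (P : probability Omega R)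
    (d' : measure_display) (T : measurableType d') (F : probability T R)
    (X : nat -> {RV P >-> T}) : Prop :=
  mutually_independent X /\
  forall i (A : set T), measurable A -> distribution P (X i) A = F A.

(* [g] is a version of the regression function z |-> E[Y | X = z], i.e. g(X)
   is a version of E[Y | sigma(X)]; it is unique up to a null set of the law
   of X. *)
Definition cond_expectation_given (R : realType)
    (d : measure_display) (Omega : measurableType d) (P : probability Omega R)
    (d' : measure_display) (T : measurableType d')
    (X : {RV P >-> T}) (Y : Omega -> R) (g : T -> R) : Prop :=
  [/\ measurable_fun [set: T] g,
      P.-integrable [set: Omega] (fun w => (g (X w))%:E) &
      forall A : set T, measurable A ->
        \int[P]_(w in X @^-1` A) (g (X w))%:E =
        \int[P]_(w in X @^-1` A) (Y w)%:E]%E.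

Definition cvg_in_probability0 (R : realType)
    (d : measure_display) (Omega : measurableType d) (P : probability Omega R)
    (Y : nat -> Omega -> R) : Prop :=
  forall eps : R, 0 < eps ->
    P [set w | eps < `|Y n w|] @[n --> \oo] --> (0 : \bar R).

Definition cvg_in_distribution (R : realType)
    (d : measure_display) (Omega : measurableType d) (P : probability Omega R)
    (X : nat -> {RV P >-> R})
    (mu : probability (measurableTypeR R) R) : Prop :=
  forall x : R, {for x, continuous (fun t : R => mu `]-oo, t]%classic)} ->
    cdf (X n) x @[n --> \oo] --> mu `]-oo, x]%classic.

Section saa.
Context (R : realType) (D Xi : Type) (h : D -> Xi -> R).

(* SAA optimal value H_k; the infimum is the minimum whenever the latter is
   attained. *)
Definition saa_value (k : nat) (z : k.-tuple Xi) : R :=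
  inf [set k%:R^-1 * \sum_(i < k) h x (tnth z i) | x in [set: D]].

Definition sup_abs_sqr (z : Xi) : \bar R :=
  ereal_sup [set (`|h x z| ^+ 2)%:E | x in [set: D]].

Definition sup_absdiff_pow (p : R) (zz : Xi * Xi) : \bar R :=
  ereal_sup [set (`|h x zz.1 - h x zz.2| `^ p)%:E | x in [set: D]].

(* The data xi_1, xi_2, ... are indexed from 0: xi i w stands for
   xi_(i+1)(w). *)
Context (Omega : Type) (xi : nat -> Omega -> Xi).

Definition saa_sample (k : nat) (w : Omega) : R :=
  saa_value [tuple xi i w | i < k].

Definition vstat (n k : nat) (w : Omega) : R :=
  (n%:R ^+ k)^-1 *
  \sum_(i : k.-tuple 'I_n) saa_value [tuple xi (tnth i j) w | j < k].

End saa.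

(* Main.v *)
Require Import Defs.
From HB Require Import structures.
From mathcomp Require Import all_boot all_order all_algebra finmap.
From mathcomp Require Import all_classical all_reals all_analysis measurable_realfun.
From mathcomp Require Import perm ring lra zify.
Set Implicit Arguments.
Unset Strict Implicit.
Unset Printing Implicit Defensive.
Import Order.TTheory GRing.Theory Num.Theory.
Import numFieldNormedType.Exports.
Local Open Scope classical_set_scope.
Local Open Scope ring_scope.

(* The V-statistic is compared with its Hajek projection
   W + (k/n) \sum_i G(xi_i), G = g_k - W, the square integrable remainder being
   O(k/n) in L1; multiplied by \sqrt n this vanishes as k = O(n^gamma) with
   gamma < 1/2.  What makes the remainder small is the stability of the SAA value:
   H_k moves by at most (1/k) \sum_j D(z_j, z'_j), where
   D(z, z') = sup_x |h(x, z) - h(x, z')|.  Hence the residual kernel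
   K = H_k - W - \sum_j G(z_j) is (1/k)-Lipschitz in each argument, and it is
   degenerate: the covariance of K over two tuples of distinct indices is zero
   unless they share two indices, and in general it is O(k^-2) times the number of
   shared pairs.  An index tuple with repetitions is first replaced by one with
   distinct indices, the repeated positions being sent to data not used elsewhere;
   this costs O(k/n) on average.

   The projection satisfies E|k G|^(2+delta) <= E D^(2+delta), again by stability
   together with Jensen's inequality, so the Lyapunov ratio of the normalized
   projection is at most a constant times
   (k^2 Var(g_k) n^(delta/(2+delta)))^(-(2+delta)/2).  The central limit theorem is
   proved by Lindeberg replacement, tested on logistic functions
   t |-> 1/(1 + e^(l(t - c))), which are smooth and approximate the indicators of
   half-lines. *)

(** * Integrable real functions *)

(** The kernel changes with n, so no limit theorem for a fixed kernel applies: every estimate is an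
    explicit inequality valid for each k and n, with constants free of both, and limits are taken
    only at the end. No decomposition of the kernel into all orders is needed. Two independent
    uniform index tuples match at most k^4/n^2 ordered pairs on average, and the k^-2 in the
    covariance bound turns this into a second moment of order (k/n)^2.

    Two obstacles shape the rest. The moment conditions bound the cost only almost surely, while
    [inf] of a set unbounded below is a default value; the data are therefore modified on a null
    set, so that all deterministic bounds hold everywhere. Moreover [g_k] is an arbitrary version,
    known only through its integrals over events of the first observation; bounds on it hold almost
    surely and are obtained by testing against indicators. *)

Notation L1 mu f := (integrable mu setT (EFin \o f)).

Section real_integrals.
Context d (T : measurableType d) (R : realType) (mu : {measure set T -> \bar R}).
Implicit Types f g : T -> R.

Lemma L1_measurable f : L1 mu f -> measurable_fun setT f.
Proof. by move=> /measurable_int/measurable_EFinP. Qed.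

Lemma L1_le f g : measurable_fun setT f -> (forall x, `|f x| <= g x) ->
  L1 mu g -> L1 mu f.
Proof.
move=> mf fg ig; apply: (le_integrable _ _ _ ig) => //.
  exact/measurable_EFinP.
by move=> x _ /=; rewrite lee_fin (le_trans (fg x))// ler_norm.
Qed.

Lemma L1_eq f g : f =1 g -> L1 mu f -> L1 mu g.
Proof. by move=> /funext->. Qed.

Lemma L1D f g : L1 mu f -> L1 mu g -> L1 mu (fun x => f x + g x).
Proof. by move=> If Ig; have := integrableD measurableT If Ig. Qed.

Lemma L1B f g : L1 mu f -> L1 mu g -> L1 mu (fun x => f x - g x).
Proof. by move=> If Ig; have := integrableB measurableT If Ig. Qed.

Lemma L1Z c f : L1 mu f -> L1 mu (fun x => c * f x).
Proof. by move=> If; have := integrableZl measurableT c If. Qed.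

Lemma L1_norm f : L1 mu f -> L1 mu (fun x => `|f x|).
Proof. by move=> If; exact: integrable_norm. Qed.

Lemma L1_sum (I : eqType) (s : seq I) (p : pred I) (F : I -> T -> R) :
  (forall i, i \in s -> p i -> L1 mu (F i)) ->
  L1 mu (fun x => \sum_(i <- s | p i) F i x).
Proof.
elim: s => [|i s IH] IF.
  apply: (@L1_eq (cst 0)); first by move=> x; rewrite big_nil.
  exact: integrable0.
have IHs : L1 mu (fun x => \sum_(i <- s | p i) F i x).
  by apply: IH => j js; apply: IF; rewrite inE js orbT.
have [pi|npi] := boolP (p i).
  apply: (@L1_eq (fun x => F i x + \sum_(i <- s | p i) F i x)).
    by move=> x; rewrite big_cons pi.
  by apply: L1D => //; apply: IF => //; rewrite mem_head.
by apply: L1_eq IHs => x; rewrite big_cons (negbTE npi).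
Qed.

Lemma Rintegral_sum (I : eqType) (s : seq I) (p : pred I) (F : I -> T -> R) :
  (forall i, i \in s -> p i -> L1 mu (F i)) ->
  \int[mu]_x (\sum_(i <- s | p i) F i x) = \sum_(i <- s | p i) \int[mu]_x F i x.
Proof.
elim: s => [|i s IH] IF.
  rewrite big_nil; under eq_Rintegral do rewrite big_nil.
  by rewrite /Rintegral integral0.
have IF' : forall j, j \in s -> p j -> L1 mu (F j).
  by move=> j js; apply: IF; rewrite inE js orbT.
rewrite big_cons -IH//; have [pi|npi] := boolP (p i).
  under eq_Rintegral do rewrite big_cons pi.
  by rewrite RintegralD//; [exact: IF (mem_head _ _) pi|exact: L1_sum].
by under eq_Rintegral do rewrite big_cons (negbTE npi).
Qed.

Lemma EFin_Rintegral f : L1 mu f -> (\int[mu]_x f x)%:E = (\int[mu]_x (f x)%:E)%E.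
Proof. by move=> If; rewrite /Rintegral fineK//; exact: integrable_fin_num. Qed.

Lemma le_RintegralT f g : L1 mu f -> L1 mu g -> (forall x, f x <= g x) ->
  \int[mu]_x f x <= \int[mu]_x g x.
Proof. by move=> If Ig fg; exact: le_Rintegral. Qed.

Lemma le_Rintegral_ae f g : L1 mu f -> L1 mu g ->
  {ae mu, forall x, f x <= g x} -> \int[mu]_x f x <= \int[mu]_x g x.
Proof.
move=> If Ig fg; rewrite -subr_ge0 -RintegralB//.
have Igf := L1B Ig If.
rewrite (_ : \int[mu]_x (g x - f x) = \int[mu]_x `|g x - f x|).
  by apply: Rintegral_ge0.
congr fine; apply: ae_eq_integral => //.
- exact: measurable_int Igf.
- by have := L1_norm Igf; exact: measurable_int.
by apply: filterS fg => x fgx _ /=; rewrite ger0_norm// subr_ge0.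
Qed.

Lemma L1_sqr_mul f g : measurable_fun setT f -> measurable_fun setT g ->
  L1 mu (fun x => f x ^+ 2) -> L1 mu (fun x => g x ^+ 2) ->
  L1 mu (fun x => f x * g x).
Proof.
move=> mf mg If Ig; apply: L1_le (L1D If Ig); first exact: measurable_funM.
move=> x; have := sqr_ge0 (f x - g x); have := sqr_ge0 (f x + g x).
by rewrite ler_norml => ? ?; apply/andP; split; nra.
Qed.

Lemma L1_sqrD f g : measurable_fun setT f -> measurable_fun setT g ->
  L1 mu (fun x => f x ^+ 2) -> L1 mu (fun x => g x ^+ 2) ->
  L1 mu (fun x => (f x + g x) ^+ 2).
Proof.
move=> mf mg If Ig; have I2 := L1Z 2 (L1D If Ig).
apply: L1_le I2; first by apply: measurable_funX; exact: measurable_funD.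
by move=> x; rewrite ger0_norm ?sqr_ge0//; have := sqr_ge0 (f x - g x); nra.
Qed.

Lemma integrable_ae_eq (u v : T -> \bar R) : mu.-integrable setT u ->
  measurable_fun setT v -> (\forall x \ae mu, u x = v x) ->
  mu.-integrable setT v.
Proof.
move=> /integrableP[mu' iu] mv uv; apply/integrableP; split => //.
suff <- : (\int[mu]_x `|u x| = \int[mu]_x `|v x|)%E by [].
apply: ae_eq_integral => //; [exact: measurableT_comp|exact: measurableT_comp|].
by apply: filterS uv => x ->.
Qed.

End real_integrals.

Section real_integrals_probability.
Context d (T : measurableType d) (R : realType) (P : probability T R).
Implicit Types f g : T -> R.

Lemma L1_cst c : L1 P (fun=> c).
Proof. exact: finite_measure_integrable_cst. Qed.

Lemma L1_bounded C f : measurable_fun setT f -> (forall x, `|f x| <= C) -> L1 P f.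
Proof. by move=> mf fC; apply: L1_le fC _ => //; exact: L1_cst. Qed.

Lemma L1_sqr f : measurable_fun setT f -> L1 P (fun x => f x ^+ 2) -> L1 P f.
Proof.
move=> mf If; apply: L1_le (L1D (L1_cst 1) If) => // x.
rewrite ler_norml; have := sqr_ge0 (f x - 1); have := sqr_ge0 (f x + 1).
by move=> ? ?; apply/andP; split; nra.
Qed.

Lemma Rintegral_pcst c : \int[P]_x c = c.
Proof. by have := Rintegral_cst P measurableT c; rewrite /= probability_setT mulr1. Qed.

End real_integrals_probability.

(** * Integrals under image laws and product laws *)

Section change_of_law.
Context d d' (T : measurableType d) (T' : measurableType d') (R : realType).
Context (P : probability T R) (X : {RV P >-> T'}) (f : T' -> R).

Lemma L1_distribution : measurable_fun setT f ->
  L1 P (fun x => f (X x)) -> L1 (distribution P X) f.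
Proof.
move=> mf If; apply: integrable_pushforward => //; exact/measurable_EFinP.
Qed.

Lemma distribution_L1 : L1 (distribution P X) f -> L1 P (fun x => f (X x)).
Proof.
move=> If; have mf := L1_measurable If; apply/integrableP; split.
  by apply/measurable_EFinP; exact: measurableT_comp.
move/integrableP : If => [_]; rewrite ge0_integral_distribution//.
by apply: measurableT_comp => //; exact/measurable_EFinP.
Qed.

Lemma Rintegral_distribution : measurable_fun setT f ->
  L1 P (fun x => f (X x)) ->
  \int[distribution P X]_y f y = \int[P]_x f (X x).
Proof.
by move=> mf If; rewrite /Rintegral integral_distribution//; exact/measurable_EFinP.
Qed.

End change_of_law.

Section fubini_real.
Context d1 d2 (T1 : measurableType d1) (T2 : measurableType d2) (R : realType).
Context (m1 : probability T1 R) (m2 : probability T2 R).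
Variable f : T1 * T2 -> R.

(** At points where the section is not integrable the inner real integral is only a default value.
    These points form a null set, so passing from the extended to the real iterated integral costs
    nothing. *)
Lemma Rintegral_fubini12 : L1 (m1 \x m2)%E f ->
  (\int[(m1 \x m2)%E]_z f z)%R = \int[m1]_x \int[m2]_y f (x, y).
Proof.
move=> If; rewrite {1}/Rintegral -(integral12_prod_meas1 If).
congr fine; apply: ae_eq_integral => //.
- exact: (measurable_fubini_F If).
- apply/measurable_EFinP => /=.
  by apply: measurableT_comp => //; exact: (measurable_fubini_F If).
apply: filterS (ae_integrable1 If) => y Iy _.
by rewrite /fubini_F /Rintegral fineK//; exact: integrable_fin_num.
Qed.

Lemma L1_fubini1 : L1 (m1 \x m2)%E f -> L1 m1 (fun x => \int[m2]_y f (x, y)).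
Proof.
move=> If; have I := integrable_fubini_F If.
apply: (integrable_ae_eq I).
  apply/measurable_EFinP => /=; apply: measurableT_comp => //.
  exact: (measurable_fubini_F If).
apply: filterS (ae_integrable1 If) => y Iy /=.
by rewrite /fubini_F /Rintegral fineK//; exact: integrable_fin_num.
Qed.

End fubini_real.

(** * Gaussian averages *)

Section gaussian_density.
Context (R : realType).
Local Notation mu := (@lebesgue_measure R).
Local Notation gamma := (normal_prob (0 : R) 1).

Lemma normal_pdf_pos (m s : R) : 0 < s -> normal_pdf m s =
  fun x => (s * Num.sqrt (pi *+ 2))^-1 * expR (- (x - m) ^+ 2 / (s ^+ 2 *+ 2)).
Proof.
move=> s0; rewrite normal_pdfE ?gt_eqF// /normal_peak /normal_fun.
apply/funext => x; congr (_^-1 * _).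
by rewrite -mulrnAr sqrtrM ?sqr_ge0// sqrtr_sqr gtr0_norm.
Qed.

Lemma ge0_integral_normal (m s : R) (f : R -> \bar R) :
  measurable_fun setT f -> (forall x, 0 <= f x)%E ->
  (\int[normal_prob m s]_x f x = \int[mu]_x (f x * (normal_pdf m s x)%:E))%E.
Proof.
move=> mf f0.
rewrite -(Radon_Nikodym_SigmaFinite.change_of_variables (normal_prob_dominates m s))//.
have IRN := Radon_Nikodym_SigmaFinite.f_integrable (normal_prob_dominates m s).
have mpdf : measurable_fun setT (fun x : R => (normal_pdf m s x)%:E).
  by apply/measurable_EFinP; exact: measurable_normal_pdf.
apply: ae_eq_integral => //.
- by apply: emeasurable_funM => //; exact: measurable_int IRN.
- exact: emeasurable_funM.
apply: ae_eqe_mul2l; apply: integral_ae_eq => // E _ mE.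
by rewrite -Radon_Nikodym_SigmaFinite.f_integral//; exact: normal_prob_dominates.
Qed.

(** The image of Lebesgue measure under the affine map, scaled by [s], gives half-open intervals
    their length, and this characterizes Lebesgue measure. *)
Lemma lebesgue_measure_affine (m s : R) (A : set R) : 0 < s -> measurable A ->
  mu A = (s%:E * mu ((fun y : R => (m + s * y)%R) @^-1` A))%E.
Proof.
move=> s0 mA.
have mphi : @measurable_fun _ _ (measurableTypeR R) (measurableTypeR R) setT
    (fun y : R => (m + s * y)%R).
  by apply: measurable_funD => //; exact: measurable_funM.
pose nu : {measure set (measurableTypeR R) -> \bar R} :=
  measure_function_pushforward__canonical__measure_function_Measure mu mphi.
have := @lebesgue_measure_unique R (mscale (NngNum (ltW s0)) nu).
apply => // _ [[a b]] _ <-.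
transitivity (s%:E * mu ((fun y : R => m + s * y)%R @^-1` `]a, b]))%E; last by [].
rewrite (_ : _ @^-1` _ = `](a - m) / s, (b - m) / s]%classic); last first.
  apply/seteqP; split => x /=; rewrite !in_itv/= ltr_pdivrMr// ler_pdivlMr//.
    by rewrite ltrBlDl lerBrDl mulrC.
  by rewrite ltrBlDl lerBrDl mulrC.
rewrite !lebesgue_measure_itv/= !lte_fin ltr_pM2r ?invr_gt0// ltrD2r.
case: ifPn => _; last by rewrite mule0.
by rewrite -EFinM/=; congr EFin; field; rewrite gt_eqF.
Qed.

Lemma ge0_integral_affine (m s : R) (f : R -> \bar R) : 0 < s ->
  measurable_fun setT f -> (forall x, 0 <= f x)%E ->
  (\int[mu]_x f x = s%:E * \int[mu]_y f (m + s * y)%R)%E.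
Proof.
move=> s0 mf f0.
have mphi : @measurable_fun _ _ (measurableTypeR R) (measurableTypeR R) setT
    (fun y : R => (m + s * y)%R).
  by apply: measurable_funD => //; exact: measurable_funM.
pose nu : {measure set (measurableTypeR R) -> \bar R} :=
  measure_function_pushforward__canonical__measure_function_Measure mu mphi.
transitivity (\int[mscale (NngNum (ltW s0)) nu]_x f x)%E.
  by apply: eq_measure_integral => A mA _; exact: lebesgue_measure_affine.
by rewrite ge0_integral_mscale//= ge0_integral_pushforward//.
Qed.

Lemma ge0_integral_gauss_affine (m s : R) (f : R -> \bar R) : 0 < s ->
  measurable_fun setT f -> (forall x, 0 <= f x)%E ->
  (\int[gamma]_y f (m + s * y)%R = \int[mu]_x (f x * (normal_pdf m s x)%:E))%E.
Proof.
move=> s0 mf f0.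
have mphi : @measurable_fun _ _ (measurableTypeR R) (measurableTypeR R) setT
    (fun y : R => (m + s * y)%R).
  by apply: measurable_funD => //; exact: measurable_funM.
have mpdf m' s' : measurable_fun setT (fun x : R => (normal_pdf m' s' x)%:E).
  by apply/measurable_EFinP; exact: measurable_normal_pdf.
rewrite (@ge0_integral_normal 0 1 (fun y => f (m + s * y)%R)); last 2 first.
- exact: (measurableT_comp mf mphi).
- by move=> y; exact: f0.
rewrite (@ge0_integral_affine m s (fun x => (f x * (normal_pdf m s x)%:E)%E))//; last 2 first.
- exact: emeasurable_funM.
- by move=> x; rewrite mule_ge0// lee_fin normal_pdf_ge0.
rewrite -ge0_integralZl//; last 3 first.
- by apply: emeasurable_funM; [exact: measurableT_comp|exact: (measurableT_comp (mpdf m s))].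
- by move=> x _; rewrite mule_ge0// lee_fin normal_pdf_ge0.
- by rewrite lee_fin ltW.
apply: eq_integral => y _; rewrite muleCA -EFinM; congr (_ * _%:E)%E.
have K0 : 0 < Num.sqrt (pi *+ 2) :> R by rewrite sqrtr_gt0 mulrn_wgt0// pi_gt0.
rewrite !normal_pdf_pos// mulrA.
have -> : s * (s * Num.sqrt (pi *+ 2))^-1 = (1 * Num.sqrt (pi *+ 2))^-1 :> R.
  by field; rewrite !gt_eqF.
by congr (_ * expR _); field; rewrite gt_eqF.
Qed.

(** Two factorizations of the joint density of z and u = x + t z + s y, obtained by completing the
    square. On the right, u has variance r^2, and z given u is normal with mean t (u - x) / r^2 and
    standard deviation s / r. *)
Lemma normal_pdf_mul (x s t r u z : R) : 0 < s -> 0 < r -> r ^+ 2 = s ^+ 2 + t ^+ 2 ->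
  normal_pdf (x + t * z) s u * normal_pdf 0 1 z =
  normal_pdf x r u * normal_pdf (t * (u - x) / r ^+ 2) (s / r) z.
Proof.
move=> s0 r0 rst; have K0 : 0 < Num.sqrt (pi *+ 2) :> R by rewrite sqrtr_gt0 mulrn_wgt0// pi_gt0.
rewrite !normal_pdf_pos//; last by rewrite divr_gt0.
rewrite mulrACA -expRD [RHS]mulrACA -expRD; congr (_ * expR _).
  by field; rewrite !gt_eqF.
have r20 : s ^+ 2 + t ^+ 2 != 0 by rewrite -rst expf_neq0// gt_eqF.
have -> : (s / r) ^+ 2 = s ^+ 2 / (s ^+ 2 + t ^+ 2) by rewrite expr_div_n rst.
by rewrite rst; field; rewrite ?gt_eqF //=; rewrite -rst exprn_gt0.
Qed.

(** With densities made explicit, Tonelli exchanges the integrals, and in the factorization of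
    [normal_pdf_mul] the conditional density of z integrates to 1. The case t = 0 is included; the
    first replacement step below needs it. *)
Lemma gauss_semigroup (x s t r : R) (f : R -> \bar R) : 0 < s -> 0 < r ->
  r ^+ 2 = s ^+ 2 + t ^+ 2 ->
  measurable_fun setT f -> (forall x, 0 <= f x)%E ->
  (\int[gamma]_z \int[gamma]_y f (x + t * z + s * y)%R
   = \int[gamma]_y f (x + r * y)%R)%E.
Proof.
move=> s0 r0 rst mf f0.
have mpdf m' s' : measurable_fun setT (fun x : R => (normal_pdf m' s' x)%:E).
  by apply/measurable_EFinP; exact: measurable_normal_pdf.
have pdf0 (m' s' y : R) : (0 <= (normal_pdf m' s' y)%:E)%E by rewrite lee_fin normal_pdf_ge0.
have mj : @measurable_fun _ _ (measurableTypeR R * measurableTypeR R)%type (measurableTypeR R) setT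
    (fun p : R * R => normal_pdf (x + t * p.1) s p.2).
  under eq_fun do rewrite normal_pdf_pos//; apply: measurable_funM => //.
  apply: measurableT_comp => //; apply: measurable_funM => //.
  apply: measurableT_comp => //; apply: measurable_funX.
  apply: measurable_funB => //; apply: measurable_funD => //.
  exact: measurable_funM.
pose F (z u : R) := (f u * (normal_pdf (x + t * z) s u)%:E)%E.
have F0 z u : (0 <= F z u)%E by rewrite /F mule_ge0.
have mF : measurable_fun setT (fun p : measurableTypeR R * measurableTypeR R => F p.1 p.2).
  apply: emeasurable_funM; first exact: measurableT_comp.
  exact/measurable_EFinP.
under eq_integral do rewrite ge0_integral_gauss_affine//.
rewrite [LHS]ge0_integral_normal//=; last 2 first.
- exact: (@measurable_fun_fubini_tonelli_F _ _ _ _ _ mu (fun p => F p.1 p.2)).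
- by move=> z; apply: integral_ge0 => u _; exact: F0.
transitivity (\int[mu]_z \int[mu]_u (F z u * (normal_pdf 0 1 z)%:E))%E.
  apply: eq_integral => z _; rewrite ge0_integralZr//.
  by apply: emeasurable_funM => //; exact: mpdf.
rewrite (@fubini_tonelli _ _ _ _ _ mu mu (fun p => F p.1 p.2 * (normal_pdf 0 1 p.1)%:E)%E)/=; last 2 first.
- by apply: emeasurable_funM => //; exact: (measurableT_comp (mpdf 0 1)).
- by move=> p; rewrite mule_ge0.
rewrite ge0_integral_gauss_affine//; apply: eq_integral => u _.
under eq_integral => z _.
  rewrite /F -muleA -EFinM (normal_pdf_mul _ _ _ s0 r0 rst) EFinM muleA.
  over.
rewrite ge0_integralZl//=; [by rewrite integral_normal_pdf mule1|exact: mpdf|by rewrite mule_ge0].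
Qed.

End gaussian_density.

(** * Moments of the standard normal law *)

Section gaussian_moments.
Context (R : realType).
Local Notation mu := (@lebesgue_measure R).
Local Notation gamma := (normal_prob (0 : R) 1).

Let c0 : R := (Num.sqrt (pi *+ 2))^-1.
Let phi (y : R) : R := c0 * expR (- (y ^+ 2 / 2)).

Let normal_phi : normal_pdf (0 : R) 1 = phi.
Proof.
apply/funext => y; rewrite normal_pdf_pos// mul1r; congr (_ * expR _).
by rewrite subr0 expr1n mulNr.
Qed.

Let c00 : 0 < c0.
Proof. by rewrite invr_gt0 sqrtr_gt0 mulrn_wgt0// pi_gt0. Qed.

Let isd_phi (y : R) : is_derive y 1 phi (- y * phi y).
Proof.
by rewrite /phi; apply: is_derive_eq; rewrite /GRing.scale/=; field.
Qed.

(** A primitive of [(y ^+ 2 - 1) * phi y]. It vanishes at 0 and at infinity, so the variance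
    integral over the half-line equals the mass there. *)
Let F (y : R) : R := - (y * phi y).

Let isd_F (y : R) : is_derive y 1 F ((y ^+ 2 - 1) * phi y).
Proof.
have := isd_phi y => H.
rewrite /F; apply: is_derive_eq; rewrite /GRing.scale/=; ring.
Qed.

Let continuous_phi : continuous phi.
Proof.
move=> y; apply: differentiable_continuous; apply/derivable1_diffP.
by have [] := isd_phi y.
Qed.

Let continuous_F : continuous F.
Proof.
move=> y; apply: differentiable_continuous; apply/derivable1_diffP.
by have [] := isd_F y.
Qed.

Let cvg_F : F y @[y --> +oo] --> 0.
Proof.
apply: (@squeeze_cvgr _ _ _ _ (fun y => - (c0 * expR 2 * expR (- y))) (fun=> 0)); last 2 first.
- rewrite (_ : (0 : R) = - (c0 * expR 2 * 0)); last by rewrite mulr0 oppr0.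
  apply: cvgN; apply: cvgM; [exact: cvg_cst|exact: cvgr_expR].
- exact: cvg_cst.
near=> y; have y0 : 0 <= y by near: y; exact: nbhs_pinfty_ge.
rewrite /F oppr_le0 lerN2 /phi; apply/andP; split; last first.
  by rewrite mulr_ge0// mulr_ge0 ?expR_ge0// ltW.
rewrite mulrCA -mulrA ler_pM2l// -expRD.
rewrite (@le_trans _ _ (expR y * expR (2 - 2 * y)))//; last first.
  by rewrite -expRD ler_expR; lra.
rewrite ler_pM ?expR_ge0//.
  by rewrite (le_trans _ (expR_ge1Dx y))//; lra.
by rewrite ler_expR; have := sqr_ge0 (y - 2); nra.
Unshelve. all: by end_near. Qed.

Let f (y : R) : R := (y ^+ 2 - 1) * phi y.

Let continuous_f : continuous f.
Proof.
move=> y; apply: cvgM; last exact: continuous_phi.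
by apply: cvgB; [exact: exprn_continuous|exact: cvg_cst].
Qed.

(** The half-line is cut at 1, where [f] changes sign, because the fundamental theorem on an
    unbounded interval is applied to a nonnegative integrand. *)
Let integral_f01 : (\int[mu]_(y in `[0%R, 1%R]) (f y)%:E = (F 1)%:E)%E.
Proof.
rewrite (@continuous_FTC2 _ f F)//.
- by rewrite [F 0]/F mul0r oppr0 sube0.
- exact: continuous_subspaceT.
- split.
  + by move=> x _; have [] := isd_F x.
  + by apply: cvg_at_right_filter; exact: continuous_F.
  + by apply: cvg_at_left_filter; exact: continuous_F.
- by move=> x _; rewrite derive1E; have [_ ->] := isd_F x.
Qed.

Let integral_f1y : (\int[mu]_(y in `[1%R, +oo[) (f y)%:E = - (F 1)%:E)%E.
Proof.
rewrite (@ge0_continuous_FTC2y _ f F 1 0)//.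
- by rewrite sub0e.
- move=> x x1; rewrite /f mulr_ge0// ?mulr_ge0 ?expR_ge0 ?(ltW c00)//.
  by rewrite subr_ge0 -(expr1n _ 2) ler_sqr ?nnegrE// (le_trans _ x1).
- exact: continuous_subspaceT.
- by apply: cvg_at_right_filter; exact: continuous_F.
- by move=> x _; rewrite derive1E; have [_ ->] := isd_F x.
Qed.

Let phi_ge0 y : 0 <= phi y. Proof. by rewrite /phi mulr_ge0 ?expR_ge0// ltW. Qed.

Let phiN y : phi (- y) = phi y. Proof. by rewrite /phi sqrrN. Qed.

Let measurable_phi : measurable_fun setT phi.
Proof. exact: continuous_measurable_fun. Qed.

(** Half of the exponent absorbs the power: [exp u >= 1 + u^2 / 2] at u = y^2 / 4 gives
    [y^4 exp (- y^2 / 4) <= 32]. What remains is, up to a constant, the normal density of variance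
    2. *)
Let L1_phi4 : L1 mu (fun y : R => y ^+ 4 * phi y).
Proof.
have I2 := L1Z (32 * Num.sqrt 2) (integrable_normal_pdf (0 : R) (Num.sqrt 2)).
apply: L1_le I2.
  by apply: measurable_funM => //; exact: measurable_funX.
move=> y; rewrite ger0_norm; last first.
  by apply: mulr_ge0; [exact: exprn_even_ge0|exact: phi_ge0].
rewrite normal_pdf_pos ?sqrtr_gt0// sqr_sqrtr// /phi.
rewrite mulrCA [leRHS]mulrA.
have -> : 32 * Num.sqrt 2 * (Num.sqrt 2 * Num.sqrt (pi *+ 2))^-1 = c0 * 32 :> R.
  have K0 : 0 < Num.sqrt (pi *+ 2) :> R by rewrite sqrtr_gt0 mulrn_wgt0// pi_gt0.
  have S0 : 0 < Num.sqrt 2 :> R by rewrite sqrtr_gt0.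
  by rewrite /c0; field; rewrite !gt_eqF.
rewrite -mulrA ler_pM2l//.
have -> : - (y ^+ 2 / 2) = - (y ^+ 2 / 4) + - (y ^+ 2 / 4) by field.
rewrite expRD mulrA subr0.
have -> : - y ^+ 2 / (2 *+ 2) = - (y ^+ 2 / 4) by rewrite -mulrnA; field.
rewrite ler_pM2r ?expR_gt0// expRN ler_pdivrMr ?expR_gt0//.
have := @expR_ge1Dxn R (y ^+ 2 / 4) 1.
rewrite divr_ge0 ?sqr_ge0// => /(_ isT).
rewrite (_ : 2`! = 2)%N//; lra.
Qed.

Lemma gauss_integrable_pow4 : L1 gamma (fun y => y ^+ 4).
Proof.
have m4 : measurable_fun setT (fun y : R => y ^+ 4) by exact: measurable_funX.
apply/integrableP; split; first exact/measurable_EFinP.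
rewrite ge0_integral_normal//; last by apply: measurableT_comp => //; exact/measurable_EFinP.
rewrite normal_phi.
under eq_integral do rewrite /= ger0_norm ?exprn_even_ge0// -EFinM.
exact: integrable_lty.
Qed.

Lemma gauss_integrable_sqr : L1 gamma (fun y => y ^+ 2).
Proof.
apply: L1_le (L1D (L1_cst gamma 1) gauss_integrable_pow4).
  exact: measurable_funX.
move=> y; rewrite ger0_norm ?sqr_ge0//.
have := sqr_ge0 (y ^+ 2 - 1); rewrite -[y ^+ 4]/(y ^+ (2 * 2)) exprM; nra.
Qed.

Lemma gauss_integrable_id : L1 gamma id.
Proof. by apply: L1_sqr => //; exact: gauss_integrable_sqr. Qed.

Lemma ge0_gauss_opp (u : R -> \bar R) : measurable_fun setT u ->
  (forall x, 0 <= u x)%E ->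
  (\int[gamma]_y u (- y)%R = \int[gamma]_y u y)%E.
Proof.
move=> mu' u0.
have mpdf : measurable_fun setT (fun x : R => (phi x)%:E) by exact/measurable_EFinP.
have mN : @measurable_fun _ _ (measurableTypeR R) (measurableTypeR R) setT -%R by [].
rewrite !ge0_integral_normal//; last exact: measurableT_comp.
rewrite normal_phi.
transitivity (\int[pushforward mu (-%R : _ -> measurableTypeR R)]_y (u y * (phi y)%:E))%E.
  rewrite (@ge0_integral_pushforward _ _ (measurableTypeR R) (measurableTypeR R) R _ mN
    mu setT (fun y => u y * (phi y)%:E)%E measurableT); last 2 first.
  - exact: emeasurable_funM.
  - by move=> y _; rewrite mule_ge0// lee_fin.
  by apply: eq_integral => y _; rewrite /= phiN.
by apply: eq_measure_integral => A mA _; exact: lebesgue_measureN.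
Qed.

Lemma gauss_mean : \int[gamma]_y y = 0.
Proof.
have I1 := gauss_integrable_id; have In := L1_norm I1.
(* Reflection invariance is available for nonnegative functions, so it is applied to [|y| + y]
   instead of y. *)
have : \int[gamma]_y (`|- y| + - y) = \int[gamma]_y (`|y| + y) :> R.
  congr fine; apply: (@ge0_gauss_opp (fun y => (`|y| + y)%:E)).
    by apply/measurable_EFinP; apply: measurable_funD => //; exact: measurableT_comp.
  by move=> y; rewrite lee_fin; have := ler_norm (- y); rewrite normrN; lra.
under eq_Rintegral do rewrite normrN -mulN1r.
rewrite !RintegralD// ?RintegralZl//; first by lra.
exact: L1Z.
Qed.

Lemma gauss_variance : \int[gamma]_y (y ^+ 2) = 1.
Proof.
have I2 : L1 mu (fun y => y ^+ 2 * phi y).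
  have := gauss_integrable_sqr.
  move/integrableP => [m2]; rewrite ge0_integral_normal//; last exact: measurableT_comp.
  rewrite normal_phi => H; apply/integrableP; split.
    by apply/measurable_EFinP; apply: measurable_funM => //; exact/measurable_EFinP.
  move: H; congr (_ < _)%E; apply: eq_integral => y _ /=.
  by rewrite -EFinM [in RHS]normrM (ger0_norm (phi_ge0 y)).
have Iphi : L1 mu phi by rewrite -normal_phi; exact: integrable_normal_pdf.
have If : L1 mu f.
  by apply: L1_eq (L1B I2 Iphi) => y; rewrite /f mulrBl mul1r.
have f0 : \int[mu]_(y in `[0, +oo[) f y = 0.
  have IS (A : set R) : measurable A -> mu.-integrable A (EFin \o f).
    by move=> mA; exact: integrableS If.
  have := @Rintegral_itvB R f (BLeft 0) +oo%O 1 (IS _ (measurable_itv _)).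
  rewrite bnd_simp ler01 => /(_ isT isT)/eqP.
  rewrite Rintegral_itv_obnd_cbnd; last exact: IS.
  by rewrite {2 3}/Rintegral integral_f01 integral_f1y/= subr_eq addNr => /eqP.
rewrite /Rintegral ge0_integral_normal//=; last 2 first.
- by apply/measurable_EFinP; exact: measurable_funX.
- by move=> y; rewrite lee_fin sqr_ge0.
under eq_integral do rewrite normal_phi -EFinM.
have E (u : R -> R) : (forall x, 0 <= u x) -> continuous u -> u =1 u \o -%R ->
    L1 mu u -> fine (\int[mu]_x (u x)%:E)%E = 2 * \int[mu]_(x in `[0, +oo[) u x.
  move=> u0 cu uN Iu; rewrite ge0_symfun_integralT//.
  rewrite (_ : [set x | 0 <= x] = `[0, +oo[%classic); last by rewrite set_itvE.
  by rewrite fineM//=; apply: integrable_fin_num => //; exact: integrableS Iu.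
rewrite E//; last 3 first.
- by move=> x; rewrite mulr_ge0// sqr_ge0.
- by move=> y; apply: cvgM; [exact: exprn_continuous|exact: continuous_phi].
- by move=> y /=; rewrite phiN sqrrN.
have : fine (\int[mu]_x (phi x)%:E)%E = 1.
  by have := integral_normal_pdf (0 : R) 1; rewrite normal_phi => ->.
rewrite E//; last by move=> y; rewrite /= phiN.
move: f0; under eq_Rintegral do rewrite /f mulrBl mul1r.
rewrite RintegralB//; [|exact: integrableS I2|exact: integrableS Iphi].
by move/eqP; rewrite subr_eq0 => /eqP->.
Qed.

End gaussian_moments.

(** * Lindeberg replacement for smooth test functions *)

Section smooth_test_functions.
Context (R : realType).
Local Notation gamma := (normal_prob (0 : R) 1).

(** The size of a second-order Taylor remainder when the second and third derivatives are bounded.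
    The minimum with the square keeps it integrable for a variable with only two moments. *)
Definition cubic_trunc (t : R) : R := Num.min (t ^+ 2) (`|t| ^+ 3).

Lemma cubic_trunc_ge0 t : 0 <= cubic_trunc t.
Proof. by rewrite /cubic_trunc le_min sqr_ge0 exprn_ge0. Qed.

Lemma cubic_trunc_le_sqr t : cubic_trunc t <= t ^+ 2.
Proof. by rewrite /cubic_trunc ge_min lexx. Qed.

Lemma measurable_cubic_trunc : measurable_fun setT cubic_trunc.
Proof.
apply: measurable_minr; first exact: measurable_funX.
by apply: (measurable_funX 3); exact: normr_measurable.
Qed.

(** Up to [eta] the cube is at most [eta t^2]; beyond [eta] the square is multiplied by
    [(|t| / eta)^q >= 1]. This is the truncation of Lindeberg's condition, expressed through a
    moment. *)
Lemma cubic_trunc_le (eta q t : R) : 0 < eta -> 0 <= q ->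
  cubic_trunc t <= eta * t ^+ 2 + eta `^ (- q) * `|t| `^ (2 + q).
Proof.
move=> eta0 q0; rewrite /cubic_trunc ge_min.
have [teta|etat] := leP `|t| eta.
  apply/orP; right; rewrite -[leLHS]addr0 lerD//; last by rewrite mulr_ge0 ?powR_ge0.
  by rewrite exprS -(real_normK (num_real t)) ler_wpM2r ?exprn_ge0.
apply/orP; left; rewrite -[leLHS]add0r lerD//; first by rewrite mulr_ge0 ?sqr_ge0 ?ltW.
have t0 : 0 < `|t| by exact: lt_trans etat.
rewrite powRD; last by apply/implyP => _; rewrite gt_eqF.
rewrite mulrCA -{1}(real_normK (num_real t)) -[_ ^+ 2]powR_mulrn//.
rewrite ler_peMr ?powR_ge0// powRN ler_pdivlMl ?powR_gt0// mulr1.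
by apply: ge0_ler_powR => //; rewrite ?nnegrE ltW.
Qed.

(* f1 and f2 play the part of f' and f''; this form of the Taylor remainder is
   preserved by Gaussian averaging, unlike a statement about derivatives. *)
Record taylor_class (C : R) (f f1 f2 : R -> R) : Prop := TaylorClass {
  taylor_m0 : measurable_fun setT f ;
  taylor_m1 : measurable_fun setT f1 ;
  taylor_m2 : measurable_fun setT f2 ;
  taylor_ge0 : forall x, 0 <= f x ;
  taylor_b0 : forall x, `|f x| <= C ;
  taylor_b1 : forall x, `|f1 x| <= C ;
  taylor_b2 : forall x, `|f2 x| <= C ;
  taylor_rem : forall x y,
    `|f (x + y) - f x - y * f1 x - y ^+ 2 / 2 * f2 x| <= C * cubic_trunc y }.

Definition gauss_avg (s : R) (f : R -> R) (x : R) : R := \int[gamma]_y f (x + s * y).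

Section bounded.
Variables (f : R -> R) (C : R).
Hypothesis mf : measurable_fun setT f.
Hypothesis fC : forall x, `|f x| <= C.

Lemma L1_bounded_affine d (S : measurableType d) (Q : probability S R)
  (Y : S -> R) (x a : R) : measurable_fun setT Y -> L1 Q (fun z => f (x + a * Y z)).
Proof.
move=> mY; apply: (@L1_bounded _ _ _ _ C) => //.
by apply: measurableT_comp => //; apply: measurable_funD => //; exact: measurable_funM.
Qed.

Lemma measurable_avg d (S : measurableType d) (Q : probability S R)
  (Y : S -> R) (a : R) : measurable_fun setT Y ->
  measurable_fun setT (fun x : R => \int[Q]_z f (x + a * Y z)).
Proof.
move=> mY; pose g (p : measurableTypeR R * S) := f (p.1 + a * Y p.2).
have mg : measurable_fun setT g.
  apply: measurableT_comp => //; apply: measurable_funD => //.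
  by apply: measurable_funM => //; exact: measurableT_comp.
(* The law put on the parameter x is arbitrary: [gamma] serves only to draw measurability in x from
   Fubini. *)
have I : L1 (gamma \x Q)%E g.
  by apply: (@L1_bounded _ _ _ _ C); [exact: mg|move=> p; exact: fC].
exact: L1_measurable (L1_fubini1 I).
Qed.

Lemma measurable_gauss_avg s : measurable_fun setT (gauss_avg s f).
Proof. exact: (measurable_avg gamma s (@measurable_id _ _ setT)). Qed.

Lemma gauss_avg_bounded s x : `|gauss_avg s f x| <= C.
Proof.
rewrite /gauss_avg; have I := L1_bounded_affine gamma x s (@measurable_id _ _ setT).
rewrite (le_trans (le_normr_Rintegral measurableT I))//.
rewrite -[leRHS](Rintegral_pcst gamma).
by apply: le_RintegralT => //; [exact: L1_norm|exact: L1_cst].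
Qed.

End bounded.

Lemma taylor_gauss_avg C f f1 f2 s : taylor_class C f f1 f2 ->
  taylor_class C (gauss_avg s f) (gauss_avg s f1) (gauss_avg s f2).
Proof.
move=> [m0 m1 m2 f0 b0 b1 b2 rem].
have I (g : R -> R) x : measurable_fun setT g -> (forall x, `|g x| <= C) ->
    L1 gamma (fun y => g (x + s * y)).
  by move=> mg gC; exact: (L1_bounded_affine mg gC gamma x s (@measurable_id _ _ setT)).
split; try by [exact: (@measurable_gauss_avg _ C)|exact: gauss_avg_bounded].
  by move=> x; exact: Rintegral_ge0.
move=> x y; rewrite /gauss_avg.
have I0 := I _ x m0 b0; have I0' := I _ (x + y) m0 b0.
have I1 := L1Z y (I _ x m1 b1); have I2 := L1Z (y ^+ 2 / 2) (I _ x m2 b2).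
rewrite -(@RintegralZl _ _ _ _ _ _ y measurableT (I _ x m1 b1)).
rewrite -(@RintegralZl _ _ _ _ _ _ (y ^+ 2 / 2) measurableT (I _ x m2 b2)).
rewrite -(RintegralB measurableT I0' I0) -(RintegralB measurableT (L1B I0' I0) I1).
rewrite -(RintegralB measurableT (L1B (L1B I0' I0) I1) I2).
have I3 := L1B (L1B (L1B I0' I0) I1) I2.
rewrite (le_trans (le_normr_Rintegral measurableT I3))//.
rewrite -[leRHS](Rintegral_pcst gamma).
apply: le_RintegralT => //; [exact: L1_norm|exact: L1_cst|].
by move=> z; rewrite (addrAC x y) rem.
Qed.

Lemma gauss_avgD C (f : R -> R) (s t r x : R) : 0 < s -> 0 < r ->
  r ^+ 2 = s ^+ 2 + t ^+ 2 ->
  measurable_fun setT f -> (forall x, 0 <= f x) -> (forall x, `|f x| <= C) ->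
  gauss_avg t (gauss_avg s f) x = gauss_avg r f x.
Proof.
move=> s0 r0 rst mf f0 fC; rewrite /gauss_avg /Rintegral.
have := @gauss_semigroup R x s t r (EFin \o f) s0 r0 rst.
rewrite /= => <-//; last by apply/measurable_EFinP.
congr fine; apply: eq_integral => z _; rewrite fineK//.
apply: integrable_fin_num => //.
exact: (L1_bounded_affine mf fC gamma _ s (@measurable_id _ _ setT)).
Qed.

Section one_step.
Context d (S : measurableType d) (Q : probability S R) (Y : S -> R).
Hypothesis mY : measurable_fun setT Y.
Hypothesis Y2 : L1 Q (fun z => Y z ^+ 2).
Hypothesis EY : \int[Q]_z Y z = 0.
Hypothesis EY2 : \int[Q]_z (Y z ^+ 2) = 1.

Lemma L1_cubic_trunc a : L1 Q (fun z => cubic_trunc (a * Y z)).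
Proof.
apply: L1_le (L1Z (a ^+ 2) Y2).
  apply: measurableT_comp; first exact: measurable_cubic_trunc.
  exact: measurable_funM.
move=> z; rewrite ger0_norm ?cubic_trunc_ge0// -exprMn; exact: cubic_trunc_le_sqr.
Qed.

(** Mean 0 cancels the first-order term and variance 1 fixes the second-order one. The expansion is
    therefore the same for every such law, in particular for the Gaussian, up to the remainder. *)
Lemma one_step_taylor C u u1 u2 x a : taylor_class C u u1 u2 ->
  `|\int[Q]_z u (x + a * Y z) - u x - a ^+ 2 / 2 * u2 x|
  <= C * \int[Q]_z cubic_trunc (a * Y z).
Proof.
move=> [m0 m1 m2 f0 b0 b1 b2 rem].
have I0 := L1_bounded_affine m0 b0 Q x a mY.
have I1 := L1Z (a * u1 x) (L1_sqr mY Y2).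
have I2 := L1Z (a ^+ 2 / 2 * u2 x) Y2.
have Ic := L1_cst Q (u x).
have I01 := L1B I0 Ic; have I012 := L1B I01 I1; have I3 := L1B I012 I2.
rewrite (_ : _ - _ - _ = \int[Q]_z (u (x + a * Y z) - u x - a * u1 x * Y z
   - a ^+ 2 / 2 * u2 x * Y z ^+ 2)); last first.
  rewrite !RintegralB// !RintegralZl//; last exact: L1_sqr.
  by rewrite EY EY2 Rintegral_pcst mulr0 subr0 mulr1.
rewrite (le_trans (le_normr_Rintegral measurableT I3))//.
rewrite -RintegralZl//; last exact: L1_cubic_trunc.
apply: le_RintegralT; [exact: L1_norm|exact: L1Z (L1_cubic_trunc a)|].
move=> z; apply: le_trans (rem x (a * Y z)).
by rewrite le_eqVlt; apply/orP; left; apply/eqP; congr `|_|; ring.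
Qed.

Lemma cubic_trunc_mean_le (eta q a : R) : 0 < eta -> 0 <= q -> 0 <= a ->
  L1 Q (fun z => `|Y z| `^ (2 + q)) ->
  \int[Q]_z cubic_trunc (a * Y z) <=
  eta * a ^+ 2 + eta `^ (- q) * a `^ (2 + q) * \int[Q]_z (`|Y z| `^ (2 + q)).
Proof.
move=> eta0 q0 a0 Iq.
have I1 := L1Z (eta * a ^+ 2) Y2.
have I2 := L1Z (eta `^ (- q) * a `^ (2 + q)) Iq.
have -> : eta * a ^+ 2 = eta * a ^+ 2 * \int[Q]_z (Y z ^+ 2) by rewrite EY2 mulr1.
rewrite -(@RintegralZl _ _ _ _ _ _ (eta * a ^+ 2) measurableT Y2).
rewrite -(@RintegralZl _ _ _ _ _ _ (eta `^ (- q) * a `^ (2 + q)) measurableT Iq).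
rewrite -(RintegralD measurableT I1 I2).
apply: le_RintegralT; [exact: L1_cubic_trunc|exact: L1D|].
move=> z; apply: le_trans (cubic_trunc_le (a * Y z) eta0 q0) _.
by rewrite exprMn normrM (ger0_norm a0) powRM// !mulrA.
Qed.

End one_step.

Lemma gauss_pow4E : \int[gamma]_y (`|y| `^ (2 + 2)) = \int[gamma]_y (y ^+ 4) /\
  L1 gamma (fun y => `|y| `^ (2 + 2)).
Proof.
have E (y : R) : `|y| `^ (2 + 2) = y ^+ 4.
  rewrite -natrD powR_mulrn// -[LHS]/(`|y| ^+ (2 + 2)) -[RHS]/(y ^+ (2 + 2)).
  by rewrite !exprD real_normK ?num_real.
split; first by apply: eq_Rintegral => y _.
by apply: L1_eq (gauss_integrable_pow4 R) => y.
Qed.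

End smooth_test_functions.

(** * Logistic test functions *)

Section taylor_logistic.
Context (R : realType).

Lemma mvt_bound (g g' : R -> R) (B y : R) : (forall t : R, is_derive t (1 : R) g (g' t)) ->
  (forall t, `|t| <= `|y| -> `|g' t| <= B) -> `|g y - g 0| <= B * `|y|.
Proof.
move=> dg g'B.
have cg : continuous g.
  move=> t; apply: differentiable_continuous; apply/derivable1_diffP.
  by have [] := dg t.
have [y0|y0|<-] := ltgtP 0 y; last by rewrite subrr !normr0 mulr0.
- have [c /[!in_itv]/= /andP[c0 cy] ->] :=
    MVT y0 (fun t _ => dg t) (continuous_subspaceT cg).
  rewrite normrM subr0 (gtr0_norm y0) ler_pM2r// g'B//.
  by rewrite !gtr0_norm// ltW.
- have [c /[!in_itv]/= /andP[c0 cy]] :=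
    MVT y0 (fun t _ => dg t) (continuous_subspaceT cg).
  rewrite distrC => ->; rewrite normrM sub0r normrN (ltr0_norm y0).
  by rewrite ler_pM2r ?oppr_gt0// g'B// (ltr0_norm cy) (ltr0_norm y0) lerN2 ltW.
Qed.

Lemma is_derive_shift (f f' : R -> R) (x t : R) :
  (forall t : R, is_derive t (1 : R) f (f' t)) ->
  is_derive t (1 : R) (fun t => f (x + t)) (f' (x + t)).
Proof.
move=> df; have H := df (x + t).
have : is_derive t (1 : R) (fun t => x + t) 1.
  by apply: is_derive_eq; rewrite add0r mulr1.
by move=> /(is_derive1_comp H); rewrite mulr1.
Qed.

(** The mean value theorem is iterated without dividing by factorials. The quadratic bound pays [B2]
    once for the first-order remainder and at most once for the second-order term, hence [2 * B2];
    three iterations give the cubic bound with [B3]. *)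
Lemma taylor_rem_bound (f f1 f2 f3 : R -> R) (B2 B3 : R) :
  (forall t : R, is_derive t (1 : R) f (f1 t)) -> (forall t : R, is_derive t (1 : R) f1 (f2 t)) ->
  (forall t : R, is_derive t (1 : R) f2 (f3 t)) ->
  (forall t, `|f2 t| <= B2) -> (forall t, `|f3 t| <= B3) ->
  forall x y, `|f (x + y) - f x - y * f1 x - y ^+ 2 / 2 * f2 x|
    <= Num.max (2 * B2) B3 * cubic_trunc y.
Proof.
move=> df df1 df2 b2 b3 x y.
have B20 : 0 <= B2 by exact: le_trans (b2 0).
have B30 : 0 <= B3 by exact: le_trans (b3 0).
have H1 t : `|f1 (x + t) - f1 x| <= B2 * `|t|.
  rewrite -{2}[x]addr0.
  by apply: (@mvt_bound (fun t => f1 (x + t)) (fun t => f2 (x + t))) => // ?; exact: is_derive_shift.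
have H2 t : `|f2 (x + t) - f2 x| <= B3 * `|t|.
  rewrite -{2}[x]addr0.
  by apply: (@mvt_bound (fun t => f2 (x + t)) (fun t => f3 (x + t))) => // ?; exact: is_derive_shift.
have H1' t : `|f1 (x + t) - f1 x - t * f2 x| <= B3 * `|t| * `|t|.
  pose q t := f1 (x + t) - t * f2 x.
  rewrite (_ : _ - _ - _ = q t - q 0); last by rewrite /q addr0; ring.
  apply: (@mvt_bound q (fun t => f2 (x + t) - f2 x)) => [s|s st].
    by have := is_derive_shift x s df1 => ?; rewrite /q;
      apply: is_derive_eq; rewrite /GRing.scale/=; ring.
  by apply: le_trans (H2 s) _; rewrite ler_wpM2l.
have bound2 : `|f (x + y) - f x - y * f1 x - y ^+ 2 / 2 * f2 x| <= 2 * B2 * y ^+ 2.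
  pose q t := f (x + t) - t * f1 x.
  have : `|q y - q 0| <= B2 * `|y| * `|y|.
    apply: (@mvt_bound q (fun t => f1 (x + t) - f1 x)) => [s|s st].
      by have := is_derive_shift x s df => ?; rewrite /q;
        apply: is_derive_eq; rewrite /GRing.scale/=; ring.
    by apply: le_trans (H1 s) _; rewrite ler_wpM2l.
  rewrite -mulrA -expr2 real_normK ?num_real// /q addr0 mul0r subr0 => H.
  rewrite (le_trans (ler_normB _ _))// mulrDl mul1r mulrDl lerD//.
    by apply: le_trans H; rewrite le_eqVlt; apply/orP; left; apply/eqP; congr `|_|; ring.
  have y20 : 0 <= y ^+ 2 / 2 by rewrite divr_ge0 ?sqr_ge0.
  rewrite normrM (ger0_norm y20) mulrC.
  by apply: ler_pM => //; have := sqr_ge0 y; lra.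
have bound3 : `|f (x + y) - f x - y * f1 x - y ^+ 2 / 2 * f2 x| <= B3 * `|y| ^+ 3.
  pose q t := f (x + t) - t * f1 x - t ^+ 2 / 2 * f2 x.
  rewrite (_ : _ - _ - _ - _ = q y - q 0); last by rewrite /q addr0; field.
  have -> : B3 * `|y| ^+ 3 = B3 * `|y| * `|y| * `|y| by ring.
  apply: (@mvt_bound q (fun t => f1 (x + t) - f1 x - t * f2 x)) => [s|s st].
    by have := is_derive_shift x s df => ?; rewrite /q;
      apply: is_derive_eq; rewrite /GRing.scale/=; field.
  apply: le_trans (H1' s) _; rewrite -!mulrA ler_wpM2l// ler_pM//.
have [yy|yy] := leP (y ^+ 2) (`|y| ^+ 3).
  rewrite /cubic_trunc min_l// (le_trans bound2)// ler_wpM2r ?sqr_ge0//.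
  by rewrite le_max lexx.
rewrite /cubic_trunc min_r ?(ltW yy)// (le_trans bound3)// ler_wpM2r ?exprn_ge0//.
by rewrite le_max lexx orbT.
Qed.

Definition logistic (l c t : R) : R := (1 + expR (l * (t - c)))^-1.

Let logistic_den (l c t : R) : 0 < 1 + expR (l * (t - c)).
Proof. by rewrite addr_gt0// expR_gt0. Qed.

Lemma logistic_gt0 (l c t : R) : 0 < logistic l c t.
Proof. by rewrite invr_gt0. Qed.

Lemma logistic_lt1 (l c t : R) : logistic l c t < 1.
Proof. by rewrite invf_lt1// ltrDl expR_gt0. Qed.

Lemma is_derive_logistic (l c t : R) :
  is_derive t (1 : R) (logistic l c) (l * (logistic l c t ^+ 2 - logistic l c t)).
Proof.
rewrite /logistic; have D := logistic_den l c t.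
have H : is_derive t (1 : R) (fun t => 1 + expR (l * (t - c))) (l * expR (l * (t - c))).
  by apply: is_derive_eq; rewrite /GRing.scale/=; ring.
apply: (is_derive_eq (@is_deriveV R (fun t => 1 + expR (l * (t - c))) t _ 1 (lt0r_neq0 D) H)).
by rewrite /GRing.scale/=; field; rewrite gt_eqF.
Qed.

(** The equation f' = l (f^2 - f) makes every derivative a polynomial in f, which is bounded because
    0 < f < 1. *)
Lemma taylor_logistic (l c : R) : 0 <= l -> exists C f1 f2, taylor_class C (logistic l c) f1 f2.
Proof.
move=> l0; pose f := logistic l c.
pose f1 t := l * (f t ^+ 2 - f t).
pose f2 t := l ^+ 2 * ((2 * f t - 1) * (f t ^+ 2 - f t)).
pose f3 t := l ^+ 3 * ((6 * f t ^+ 2 - 6 * f t + 1) * (f t ^+ 2 - f t)).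
have df t : is_derive t (1 : R) f (f1 t) by exact: is_derive_logistic.
have df1 t : is_derive t (1 : R) f1 (f2 t).
  by have := df t => ?; rewrite /f1; apply: is_derive_eq;
    rewrite /GRing.scale/= /f2 /f1; ring.
have df2 t : is_derive t (1 : R) f2 (f3 t).
  by have := df t => ?; rewrite /f2; apply: is_derive_eq;
    rewrite /GRing.scale/= /f3 /f1; ring.
have f01 t : 0 < f t < 1 by rewrite logistic_gt0 logistic_lt1.
have b0 t : `|f t| <= 1 by rewrite ler_norml; have := f01 t; lra.
have b1 t : `|f1 t| <= l.
  rewrite normrM (ger0_norm l0) ler_piMr// ler_norml.
  by have /andP[? ?] := f01 t; apply/andP; split; nra.
have b2 t : `|f2 t| <= l ^+ 2.
  rewrite normrM ger0_norm ?exprn_ge0// ler_piMr ?exprn_ge0// normrM.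
  rewrite mulr_ile1//; have /andP[? ?] := f01 t; rewrite ler_norml; apply/andP; split; nra.
have b3 t : `|f3 t| <= l ^+ 3.
  rewrite normrM ger0_norm ?exprn_ge0// ler_piMr ?exprn_ge0// normrM.
  by rewrite mulr_ile1//; have /andP[? ?] := f01 t; rewrite ler_norml; apply/andP; split; nra.
have m (u u' : R -> R) : (forall t : R, is_derive t (1 : R) u (u' t)) -> measurable_fun setT u.
  move=> du; apply: continuous_measurable_fun => t.
  by apply: differentiable_continuous; apply/derivable1_diffP; have [] := du t.
have rem := taylor_rem_bound df df1 df2 b2 b3.
pose M := Num.max (2 * l ^+ 2) (l ^+ 3).
exists (1 + l + M), f1, f2.
have M0 : 0 <= M by rewrite le_max mulr_ge0 ?sqr_ge0.
have lM : l ^+ 2 <= M by rewrite le_max; apply/orP; left; have := sqr_ge0 l; lra.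
split; rewrite ?/f //.
- exact: m df.
- exact: m df1.
- exact: m df2.
- by move=> x; rewrite ltW// logistic_gt0.
- by move=> x; apply: le_trans (b0 x) _; lra.
- by move=> x; apply: le_trans (b1 x) _; lra.
- by move=> x; apply: le_trans (b2 x) _; lra.
- move=> x y; apply: le_trans (rem x y) _; rewrite ler_wpM2r ?cubic_trunc_ge0//.
  by rewrite -/M; lra.
Qed.

(** Only [1 + exp u >= u] is used. The slow decay in [l * e] suffices because the steepness [l] is
    at our disposal once [e] is fixed. *)
Lemma logistic_right (l c e t : R) : 0 < l -> 0 < e -> c + e <= t ->
  logistic l c t <= (l * e)^-1.
Proof.
move=> l0 e0 cet; rewrite /logistic lef_pV2 ?posrE ?mulr_gt0//.
have := expR_ge1Dx (l * (t - c)).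
have : l * e <= l * (t - c) by rewrite ler_pM2l//; lra.
lra.
Qed.

Lemma logistic_left (l c e t : R) : 0 < l -> 0 < e -> t <= c - e ->
  1 - logistic l c t <= (l * e)^-1.
Proof.
move=> l0 e0 cet; have D := logistic_den l c t.
have -> : 1 - logistic l c t = (1 + expR (- (l * (t - c))))^-1.
  have E0 := expR_gt0 (l * (t - c)).
  by rewrite expRN /logistic; field; rewrite !gt_eqF// addr_gt0.
rewrite lef_pV2 ?posrE ?mulr_gt0 ?addr_gt0 ?expR_gt0//.
have := expR_ge1Dx (- (l * (t - c))).
have : l * e <= - (l * (t - c)) by rewrite -mulrN ler_pM2l//; lra.
lra.
Qed.

End taylor_logistic.

(** * Replacing the summands by Gaussian ones, with an explicit error *)

Section lindeberg.
Context (R : realType) d (Omega : measurableType d) (P : probability Omega R)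
  d' (Xi : measurableType d') (Q : probability Xi R).
Local Notation gamma := (normal_prob (0 : R) 1).
Variables (Y : Xi -> R) (S : nat -> Omega -> R).
Hypothesis mY : measurable_fun setT Y.
Hypothesis Y2 : L1 Q (fun z => Y z ^+ 2).
Hypothesis EY : \int[Q]_z Y z = 0.
Hypothesis EY2 : \int[Q]_z (Y z ^+ 2) = 1.
Hypothesis mS : forall m, measurable_fun setT (S m).
Hypothesis S0 : forall w, S 0%N w = 0.
Hypothesis S_step : forall (f : R -> R) (C : R), measurable_fun setT f ->
  (forall x, `|f x| <= C) -> forall m x a,
  \int[P]_w f (x + a * S m.+1 w) = \int[P]_w \int[Q]_z f (x + a * S m w + a * Y z).

Let replacement_error (a : R) := \int[Q]_z cubic_trunc (a * Y z) +
  \int[gamma]_y cubic_trunc (a * y).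

Lemma one_replacement C u u1 u2 (x a : R) : taylor_class C u u1 u2 ->
  `|\int[Q]_z u (x + a * Y z) - gauss_avg a u x| <= C * replacement_error a.
Proof.
move=> tu.
have H1 := one_step_taylor mY Y2 EY EY2 x a tu.
have H2 := @one_step_taylor R _ _ gamma id (@measurable_id _ _ setT)
  (gauss_integrable_sqr R) (gauss_mean R) (gauss_variance R) C u u1 u2 x a tu.
rewrite /replacement_error mulrDr; move: H1 H2; rewrite -/(gauss_avg a u x).
set A := \int[Q]_z _; set B := gauss_avg _ _ _ => H1 H2.
apply: le_trans (lerD H1 H2); apply: le_trans (ler_normB _ _).
by rewrite le_eqVlt; apply/orP; left; apply/eqP; congr `|_|; rewrite /B /gauss_avg; ring.
Qed.

(** The last increment, averaged out by [S_step], is traded for a Gaussian average of [f]. That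
    average belongs to the Taylor class with the same constant, so the induction hypothesis applies
    to it, and [gauss_avgD] merges the two Gaussian averages. This is why the induction runs over
    the whole class and not over one function. *)
Lemma lindeberg_replacement (a : R) : 0 < a ->
  forall m C f f1 f2 x, taylor_class C f f1 f2 ->
  `|\int[P]_w f (x + a * S m w) - gauss_avg (a * Num.sqrt m%:R) f x|
    <= m%:R * (C * replacement_error a).
Proof.
move=> a0; elim=> [|m IH] C f f1 f2 x tf.
  under eq_Rintegral do rewrite S0 mulr0 addr0.
  rewrite /gauss_avg sqrtr0 mulr0; under [X in _ - X]eq_Rintegral do rewrite mul0r addr0.
  by rewrite !Rintegral_pcst subrr normr0 mul0r.
have [m0 _ _ f0 b0 _ _ _] := tf.
have mT := measurable_avg m0 b0 Q a mY.
have mP := measurable_gauss_avg m0 b0 a.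
have I1 : L1 P (fun w => \int[Q]_z f (x + a * S m w + a * Y z)).
  apply: (@L1_bounded _ _ _ _ C).
    apply: (measurableT_comp mT); apply: measurable_funD => //; exact: measurable_funM.
  move=> w; rewrite (le_trans (le_normr_Rintegral measurableT _))//.
    exact: L1_bounded_affine.
  rewrite -[leRHS](Rintegral_pcst Q); apply: le_RintegralT => //.
    by apply: L1_norm; exact: L1_bounded_affine.
  exact: L1_cst.
have I2 : L1 P (fun w => gauss_avg a f (x + a * S m w)).
  exact: (L1_bounded_affine mP (gauss_avg_bounded m0 b0 a) P x a (mS m)).
have E1 : `|\int[P]_w f (x + a * S m.+1 w) - \int[P]_w gauss_avg a f (x + a * S m w)|
    <= C * replacement_error a.
  rewrite (S_step m0 b0) -RintegralB//.
  rewrite (le_trans (le_normr_Rintegral measurableT (L1B I1 I2)))//.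
  rewrite -[leRHS](Rintegral_pcst P); apply: le_RintegralT.
  - exact: L1_norm (L1B I1 I2).
  - exact: L1_cst.
  - by move=> w; exact: one_replacement tf.
have /= E2 := IH C _ _ _ x (taylor_gauss_avg a tf).
rewrite -(@gauss_avgD R C f a (a * Num.sqrt m%:R) (a * Num.sqrt m.+1%:R))//; last 2 first.
- by rewrite mulr_gt0// sqrtr_gt0 ltr0n.
- by rewrite !exprMn !sqr_sqrtr// -natr1; ring.
rewrite -[m.+1%:R]natr1 mulrDl mul1r [leRHS]addrC.
apply: le_trans (lerD E1 E2); apply: le_trans (ler_normD _ _).
by rewrite le_eqVlt; apply/orP; left; apply/eqP; congr `|_|; ring.
Qed.

(** With step size a = n^(-1/2), the n errors [eta * a^2] add up to [eta], once for the law of [Y]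
    and once for the Gaussian. *)
Lemma lindeberg_bound (n : nat) C f f1 f2 (eta q : R) : taylor_class C f f1 f2 ->
  (0 < n)%N -> 0 < eta -> 0 <= q -> L1 Q (fun z => `|Y z| `^ (2 + q)) ->
  `|\int[P]_w f ((Num.sqrt n%:R)^-1 * S n w) - \int[gamma]_y f y| <=
  C * (2 * eta + eta `^ (- q) * (n%:R * (Num.sqrt n%:R)^-1 `^ (2 + q)
                      * \int[Q]_z (`|Y z| `^ (2 + q)))
       + eta `^ (- 2) * n%:R^-1 * \int[gamma]_y (y ^+ 4)).
Proof.
move=> tf n0 eta0 q0 Iq; have nR0 : 0 < n%:R :> R by rewrite ltr0n.
set a := (Num.sqrt n%:R)^-1; have a0 : 0 < a by rewrite invr_gt0 sqrtr_gt0.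
have an : a * Num.sqrt n%:R = 1 by rewrite mulVf// gt_eqF// sqrtr_gt0.
have a2 : n%:R * a ^+ 2 = 1.
  by rewrite exprVn sqr_sqrtr ?(ltW nR0)// divff// gt_eqF.
have [G4 I4] := gauss_pow4E R.
have C0 : 0 <= C by exact: le_trans (normr_ge0 _) (taylor_b0 tf 0).
have := lindeberg_replacement a0 n 0 tf.
rewrite an /gauss_avg; under eq_Rintegral do rewrite add0r.
under [X in _ - X]eq_Rintegral do rewrite add0r mul1r.
move/le_trans; apply; rewrite mulrCA ler_wpM2l//.
have B1 := cubic_trunc_mean_le mY Y2 EY2 eta0 q0 (ltW a0) Iq.
(* On the Gaussian side the exponent q = 2 is chosen, so that only the fourth moment appears. *)
have B2 := @cubic_trunc_mean_le R _ _ gamma id (@measurable_id _ _ setT)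
  (gauss_integrable_sqr R) (gauss_variance R) eta 2 a eta0 (ler0n _ 2) (ltW a0) I4.
rewrite G4 in B2.
have a4 : a `^ (2 + 2) = a ^+ 2 * a ^+ 2.
  by rewrite -natrD powR_mulrn ?(ltW a0)// exprD.
rewrite a4 in B2.
apply: le_trans (ler_wpM2l (ltW nR0) (lerD B1 B2)) _.
have -> : n%:R^-1 = a ^+ 2 :> R by apply: (mulfI (lt0r_neq0 nR0)); rewrite a2 divff// gt_eqF.
rewrite le_eqVlt; apply/orP; left; apply/eqP.
set M := \int[Q]_z _; set K := \int[gamma]_y _.
transitivity (2 * eta * (n%:R * a ^+ 2) + eta `^ (- q) * (n%:R * a `^ (2 + q) * M)
  + (n%:R * a ^+ 2) * (eta `^ (- 2) * a ^+ 2 * K)).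
  by ring.
by rewrite a2; ring.
Qed.

End lindeberg.

(** * From logistic test functions to distribution functions *)

Section cdf_of_smooth.
Context (R : realType) d (Omega : measurableType d) (P : probability Omega R).
Local Notation gamma := (normal_prob (0 : R) 1).

Lemma Rintegral_indic d' (T : measurableType d') (Q : probability T R) (A : set T) :
  measurable A -> \int[Q]_x (\1_A x) = fine (Q A).
Proof. by move=> mA; rewrite /Rintegral integral_indic// setIT. Qed.

Lemma L1_indic d' (T : measurableType d') (Q : probability T R) (A : set T) :
  measurable A -> L1 Q (\1_A : T -> R).
Proof. by move=> mA; exact: integrable_indic. Qed.

Lemma cdf_le_logistic (l c e : R) d' (T : measurableType d') (Q : probability T R)
  (X : T -> R) : measurable_fun setT X -> 0 < l -> 0 < e ->
  fine (Q (X @^-1` `]-oo, c - e]%classic)) <= \int[Q]_w logistic l c (X w) + (l * e)^-1 /\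
  \int[Q]_w logistic l c (X w) <= fine (Q (X @^-1` `]-oo, c + e]%classic)) + (l * e)^-1.
Proof.
move=> mX l0 e0; have [C [f1 [f2 [m0 _ _ f0 b0 _ _ _]]]] := taylor_logistic c (ltW l0).
have Il : L1 Q (fun w => logistic l c (X w)).
  by apply: (@L1_bounded _ _ _ _ C) => //; exact: measurableT_comp.
have mA t : measurable (X @^-1` `]-oo, t]%classic) by rewrite -[X in measurable X]setTI; exact: mX.
have le0 : 0 <= (l * e)^-1 by rewrite invr_ge0 mulr_ge0// ltW.
have plus (u : T -> R) : L1 Q u -> \int[Q]_w u w + (l * e)^-1 = \int[Q]_w (u w + (l * e)^-1).
  by move=> Iu; rewrite RintegralD ?Rintegral_pcst//; exact: L1_cst.
split; rewrite -Rintegral_indic// plus//; try exact: L1_indic.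
- apply: le_RintegralT; [exact: L1_indic|by apply: L1D => //; exact: L1_cst|].
  move=> w; rewrite indicE /=; case: (boolP (_ \in _)) => [|_].
    by rewrite inE/= in_itv/= => /(logistic_left l0 e0); lra.
  by rewrite addr_ge0.
- apply: le_RintegralT => //; first by apply: L1D; [exact: L1_indic|exact: L1_cst].
  move=> w; rewrite indicE /=; case: (boolP (_ \in _)) => [_|].
    by have := ltW (logistic_lt1 l c (X w)); move: le0; rewrite /=; lra.
  rewrite notin_setE/= in_itv/= => /negP; rewrite -ltNge => /ltW.
  by move=> /(logistic_right l0 e0); rewrite /= add0r.
Qed.

Lemma cvg_cdf_of_logistic (X : nat -> Omega -> R) (x : R) :
  (forall n, measurable_fun setT (X n)) ->
  (forall l c, 0 < l ->
     \int[P]_w logistic l c (X n w) @[n --> \oo] --> \int[gamma]_y logistic l c y) ->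
  {for x, continuous (fun t : R => gamma `]-oo, t]%classic)} ->
  P (X n @^-1` `]-oo, x]%classic) @[n --> \oo] --> gamma `]-oo, x]%classic.
Proof.
move=> mX Xl Hc.
have fin (t : R) : gamma `]-oo, t]%classic \is a fin_num by exact: fin_num_measure.
have mA n t : measurable (X n @^-1` `]-oo, t]%classic).
  by rewrite -[X in measurable X]setTI; exact: mX.
pose Phi t := fine (gamma `]-oo, t]%classic).
have cPhi : {for x, continuous Phi}.
  have H : gamma `]-oo, t]%classic @[t --> x] --> (Phi x)%:E by rewrite /Phi fineK.
  exact: fine_cvg H.
suff : fine (P (X n @^-1` `]-oo, x]%classic)) @[n --> \oo] --> Phi x.
  move=> H; rewrite -(fineK (fin x)); apply/fine_cvgP; split => //.
  by apply: nearW => n; exact: fin_num_measure.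
apply/cvgrPdist_le => eps eps0.
(* The logistic functions are centred at distance [e] from x and compared with half-lines a further
   [e] away, so continuity is used over [2 * e]. *)
have [e e0 He] : exists2 e : R, 0 < e & forall t, `|x - t| <= 2 * e -> `|Phi x - Phi t| <= eps / 4.
  have /cvgrPdist_le/(_ (eps / 4)) := cPhi.
  rewrite divr_gt0// => /(_ isT)/nbhs_ballP[e /= e0 H].
  exists (e / 4); first by rewrite divr_gt0.
  by move=> t xt; apply: H => /=; rewrite /ball/=; lra.
have PU : `|Phi x - Phi (x + e + e)| <= eps / 4.
  apply: He; rewrite (_ : x - _ = - (2 * e)); last by ring.
  by rewrite normrN ger0_norm// mulr_ge0// ltW.
have PL : `|Phi x - Phi (x - e - e)| <= eps / 4.
  apply: He; rewrite (_ : x - _ = 2 * e); last by ring.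
  by rewrite ger0_norm// mulr_ge0// ltW.
have eps4 : 0 < eps / 4 by rewrite divr_gt0.
(* The steepness for which the logistic error [(l * e)^-1] equals [eps / 4]. *)
pose l := (e * (eps / 4))^-1.
have l0 : 0 < l by rewrite invr_gt0 mulr_gt0// divr_gt0.
have le : (l * e)^-1 = eps / 4 by rewrite /l; field; rewrite !gt_eqF.
have /cvgrPdist_le/(_ _ eps4) U := Xl l (x + e) l0.
have /cvgrPdist_le/(_ _ eps4) L := Xl l (x - e) l0.
have gU : \int[gamma]_y logistic l (x + e) y <= Phi (x + e + e) + eps / 4.
  have [_] := @cdf_le_logistic l (x + e) e _ _ gamma id (@measurable_id _ _ setT) l0 e0.
  by rewrite le preimage_id.
have gL : Phi (x - e - e) <= \int[gamma]_y logistic l (x - e) y + eps / 4.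
  have [+ _] := @cdf_le_logistic l (x - e) e _ _ gamma id (@measurable_id _ _ setT) l0 e0.
  by rewrite le preimage_id.
apply: filterS2 U L => n Un Ln.
have [pU _] := cdf_le_logistic (x + e) P (mX n) l0 e0.
have [_ pL] := cdf_le_logistic (x - e) P (mX n) l0 e0.
move: pU pL gU gL Un Ln PU PL; rewrite le addrK subrK !ler_norml.
move: (\int[gamma]_y logistic l (x + e) y) (\int[gamma]_y logistic l (x - e) y)
  (\int[P]_w logistic l (x + e) (X n w)) (\int[P]_w logistic l (x - e) (X n w))
  (Phi x) (Phi (x + e + e)) (Phi (x - e - e)) (fine _) => *; lra.
Qed.

End cdf_of_smooth.

(** * Independence of tuples of the data *)

Section boxes.
Context d (T : measurableType d) (m : nat).

Definition box (A : 'I_m -> set T) : set (m.-tuple T) := [set z | forall j, A j (tnth z j)].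

Definition boxes : set (set (m.-tuple T)) :=
  [set B | exists2 A, (forall j, measurable (A j)) & B = box A].

Lemma measurable_box A : (forall j, measurable (A j)) -> measurable (box A).
Proof.
move=> mA; rewrite (_ : box A = \bigcap_(j in setT) ((fun z => tnth z j) @^-1` A j)).
  apply: fin_bigcap_measurable => [|j _]; first exact: finite_finset.
  by rewrite -[X in measurable X]setTI; exact: measurable_tnth.
by apply/seteqP; split => z /= H j; [move=> _; exact: H|exact: H].
Qed.

Lemma setI_closed_boxes : setI_closed boxes.
Proof.
move=> _ _ [A mA ->] [B mB ->]; exists (fun j => A j `&` B j).
  by move=> j; exact: measurableI.
by apply/seteqP; split => z /=; [move=> [? ?] j; split|move=> H; split => j; have [] := H j].
Qed.

Lemma boxes_setT : boxes setT.
Proof. by exists (fun=> setT) => //; apply/seteqP; split. Qed.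

Lemma measurable_tuple_boxes : measurable = <<s boxes >>.
Proof.
apply/seteqP; split.
  apply: smallest_sub; first exact: smallest_sigma_algebra.
  apply: subset_trans (@sub_gen_smallest _ _ _).
  move=> B; rewrite -bigcup_seq => -[i _ [C mC <-]].
  exists (fun j => if j == i then C else setT).
    by move=> j; case: ifPn.
  rewrite setTI; apply/seteqP; split => z /=.
    by move=> Cz j; case: eqP => [->|].
  by move=> /(_ i); rewrite eqxx.
apply: smallest_sub; first exact: sigma_algebra_measurable.
by move=> _ [A mA ->]; exact: measurable_box.
Qed.

End boxes.

Section pi_lambda.
Context d (Omega : measurableType d) (R : realType) (P : probability Omega R)
  d' (T : measurableType d') (G : set (set T)).
Hypothesis mG : measurable = <<s G >>.
Hypothesis GI : setI_closed G.
Hypothesis GT : G setT.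

Lemma eq_law (X X' : {RV P >-> T}) :
  (forall B, G B -> P (X @^-1` B) = P (X' @^-1` B)) ->
  forall B, measurable B -> P (X @^-1` B) = P (X' @^-1` B).
Proof.
move=> H B mB; apply: (measure_unique G (fun=> setT) mG GI _ _
  (distribution P X) (distribution P X')) => //.
- by rewrite bigcup_const//; exists 0%N.
- by move=> _; rewrite -ge0_fin_numE// fin_num_measure.
Qed.

(** Both sides are finite measures in [B], the left one being the image under [X] of [P] restricted
    to [E]; they agree on a generating pi-system. *)
Lemma indep_event (X : {RV P >-> T}) (E : set Omega) : measurable E ->
  (forall B, G B -> P (X @^-1` B `&` E) = P (X @^-1` B) * P E)%E ->
  forall B, measurable B -> (P (X @^-1` B `&` E) = P (X @^-1` B) * P E)%E.
Proof.
move=> mE H B mB.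
have PE : (fine (P E))%:E = P E by rewrite fineK// fin_num_measure.
have PE0 : 0 <= fine (P E) by exact: fine_ge0.
have mX := @measurable_funPT _ _ _ _ X.
pose m1 : {measure set T -> \bar R} :=
  measure_function_pushforward__canonical__measure_function_Measure
    (mrestr P mE) mX.
pose m2 : {measure set T -> \bar R} := mscale (NngNum PE0) (distribution P X).
have m2E C : (m2 C = P (X @^-1` C) * P E)%E by rewrite muleC -PE.
rewrite -m2E; apply: (measure_unique G (fun=> setT) mG GI _ _ m1 m2) => //.
- by rewrite bigcup_const//; exists 0%N.
- by move=> C GC; rewrite m2E; exact: H.
- move=> _; rewrite (@le_lt_trans _ _ (P E))//.
    by apply: le_measure => //; rewrite ?inE//; rewrite preimage_setT setTI.
  by rewrite -ge0_fin_numE// fin_num_measure.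
Qed.

End pi_lambda.

(** * Joint laws of tuples of i.i.d. data *)

Section iid.
Context (R : realType) dXi (Xi : measurableType dXi) (F : probability Xi R)
  dO (Omega : measurableType dO) (P : probability Omega R)
  (xi : nat -> {RV P >-> Xi}) (xi_iid : iid_from F xi).

Lemma iid_box (N : nat) (A : nat -> set Xi) : (forall i, measurable (A i)) ->
  P [set w | forall i, (i < N)%N -> A i (xi i w)] = (\prod_(i < N) F (A i))%E.
Proof.
move=> mA; have [ind law] := xi_iid.
have := ind [fset i in iota 0 N]%fset A mA.
rewrite (_ : \bigcap_(_ in _) _ = [set w | forall i, (i < N)%N -> A i (xi i w)]); last first.
  apply/seteqP; split => w /= H i.
    by move=> iN; apply: (H i); rewrite /= inE /= mem_iota.
  by rewrite /= inE/= mem_iota add0n => iN; exact: H.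
move=> ->; rewrite (perm_big (iota 0 N)) /=; last first.
  apply: uniq_perm; [exact: fset_uniq|exact: iota_uniq|].
  by move=> i; rewrite inE.
rewrite -[in iota 0 N](subn0 N) -/(index_iota 0 N) big_mkord.
by apply: eq_bigr => i _; exact: law.
Qed.

Definition sample m (s : 'I_m -> nat) (w : Omega) : m.-tuple Xi :=
  [tuple xi (s j) w | j < m].

Lemma measurable_sample m (s : 'I_m -> nat) : measurable_fun setT (sample s).
Proof.
apply/measurable_fun_tnthP => j; rewrite (_ : _ \o _ = xi (s j))//.
by apply/funext => w; rewrite /= tnth_mktuple.
Qed.

HB.instance Definition _ m (s : 'I_m -> nat) :=
  isMeasurableFun.Build _ _ Omega (m.-tuple Xi) (sample s) (@measurable_sample m s).

(** The total constraint that a box puts on the datum [i]: an intersection over the positions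
    carrying that index, hence the whole space if there is none. This form copes with repeated
    indices. *)
Let slice m (s : 'I_m -> nat) (A : 'I_m -> set Xi) (i : nat) : set Xi :=
  \bigcap_(j in [set j | s j = i]) A j.

Let measurable_slice m (s : 'I_m -> nat) A i : (forall j, measurable (A j)) ->
  measurable (slice s A i).
Proof.
by move=> mA; apply: fin_bigcap_measurable => [|j _]; [exact: finite_finset|exact: mA].
Qed.

Let sliceT m (s : 'I_m -> nat) A i : (forall j, s j != i) -> slice s A i = setT.
Proof.
by move=> si; apply/seteqP; split => // x _ j /= /eqP; rewrite (negbTE (si j)).
Qed.

Let sample_box m (s : 'I_m -> nat) A N : (forall j, s j < N)%N ->
  sample s @^-1` box A = [set w | forall i, (i < N)%N -> slice s A i (xi i w)].
Proof.
move=> sN; apply/seteqP; split => w /= H.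
  by move=> i iN j /= <-; have := H j; rewrite tnth_mktuple.
by move=> j; rewrite tnth_mktuple; apply: (H (s j)).
Qed.

(** An injective index tuple constrains each datum at most once, so the probability of a box is a
    product over positions that does not depend on the indices. *)
Lemma exchangeable m (s s' : 'I_m -> nat) : injective s -> injective s' ->
  forall B, measurable B -> P (sample s @^-1` B) = P (sample s' @^-1` B).
Proof.
move=> sI s'I; apply: (eq_law (@measurable_tuple_boxes _ _ m)) => //.
- exact: setI_closed_boxes.
- exact: boxes_setT.
move=> _ [A mA ->].
suff H (t : 'I_m -> nat) : injective t -> P (sample t @^-1` box A) = (\prod_(j < m) F (A j))%E.
  by rewrite !H.
move=> tI; pose N := (\max_(j < m) t j).+1.
have tN j : (t j < N)%N by rewrite ltnS; exact: leq_bigmax.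
rewrite (sample_box A tN) iid_box//; last by move=> i; exact: measurable_slice.
transitivity (\prod_(i < N) \prod_(j < m | t j == i) F (A j))%E.
  apply: eq_bigr => i _; have [[j tj]|nex] := pselect (exists j, t j = i).
    rewrite (big_pred1 j); last by move=> j'; rewrite -tj (inj_eq tI).
    congr (F _); apply/seteqP; split => x; first by apply.
    by move=> Ax j' /=; rewrite -tj => /tI ->.
  rewrite big_pred0; last by move=> j; apply/negbTE/eqP => tj; apply: nex; exists j.
  rewrite sliceT ?probability_setT// => j.
  by apply/eqP => tj; apply: nex; exists j.
rewrite (exchange_big_dep xpredT)//=; apply: eq_bigr => j _.
by rewrite (big_pred1 (Ordinal (tN j)))// => i; rewrite eq_sym.
Qed.

(** On boxes, every datum is constrained by at most one of the two tuples and the product splits.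
    The extension to measurable sets is made in one factor, then in the other. *)
Lemma sample_indep a b (s : 'I_a -> nat) (t : 'I_b -> nat) :
  (forall i j, s i != t j) ->
  forall A B, measurable A -> measurable B ->
  (P (sample s @^-1` A `&` sample t @^-1` B) =
   P (sample s @^-1` A) * P (sample t @^-1` B))%E.
Proof.
move=> st.
have boxE A B : (forall j, measurable (A j)) -> (forall j, measurable (B j)) ->
    (P (sample s @^-1` box A `&` sample t @^-1` box B) =
     P (sample s @^-1` box A) * P (sample t @^-1` box B))%E.
  move=> mA mB; pose N := (maxn (\max_(j < a) s j) (\max_(j < b) t j)).+1.
  have sN j : (s j < N)%N by rewrite ltnS leq_max leq_bigmax.
  have tN j : (t j < N)%N by rewrite ltnS leq_max leq_bigmax orbT.
  rewrite (sample_box A sN) (sample_box B tN) !iid_box//;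
    [|by move=> i; exact: measurable_slice..].
  rewrite (_ : _ `&` _ = [set w | forall i, (i < N)%N ->
      (slice s A i `&` slice t B i) (xi i w)]); last first.
    apply/seteqP; split => w /=.
      by move=> [H1 H2] i iN; split; [exact: H1|exact: H2].
    by move=> H; split => i /H [].
  rewrite (@iid_box N (fun i => slice s A i `&` slice t B i)); last first.
    by move=> i; apply: measurableI; exact: measurable_slice.
  rewrite -big_split/=; apply: eq_bigr => i _.
  have [[j sj]|nex] := pselect (exists j, s j = i).
    rewrite (@sliceT _ t); first by rewrite setIT probability_setT mule1.
    by move=> j'; rewrite -sj eq_sym.
  rewrite (@sliceT _ s); first by rewrite setTI probability_setT mul1e.
  by move=> j; apply/eqP => sj; apply: nex; exists j.
have half A B : measurable A -> (forall j, measurable (B j)) ->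
    (P (sample s @^-1` A `&` sample t @^-1` box B) =
     P (sample s @^-1` A) * P (sample t @^-1` box B))%E.
  move=> mA mB; apply: (indep_event (@measurable_tuple_boxes _ _ a)) => //.
  - exact: setI_closed_boxes.
  - exact: boxes_setT.
  - by rewrite -[X in measurable X]setTI; apply: measurable_sample => //; exact: measurable_box.
  - by move=> _ [C mC ->]; exact: boxE.
move=> A B mA mB; rewrite setIC muleC.
apply: (indep_event (@measurable_tuple_boxes _ _ b)) => //.
- exact: setI_closed_boxes.
- exact: boxes_setT.
- by rewrite -[X in measurable X]setTI; exact: measurable_sample.
- by move=> _ [C mC ->]; rewrite setIC muleC; exact: half.
Qed.

End iid.

Lemma eq_measure_L1 d (T : measurableType d) (R : realType)
    (m1 m2 : {measure set T -> \bar R}) (f : T -> R) :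
  (forall A, measurable A -> m1 A = m2 A) -> L1 m1 f -> L1 m2 f.
Proof.
move=> m12 /integrableP[mf If]; apply/integrableP; split => //.
by move: If; rewrite (@eq_measure_integral _ _ _ setT m2)// => A mA _; exact: m12.
Qed.

Lemma eq_measure_Rintegral d (T : measurableType d) (R : realType)
    (m1 m2 : {measure set T -> \bar R}) (f : T -> R) :
  (forall A, measurable A -> m1 A = m2 A) -> \int[m1]_x f x = \int[m2]_x f x.
Proof.
by move=> m12; rewrite /Rintegral (@eq_measure_integral _ _ _ setT m2)// => A mA _; exact: m12.
Qed.

(** * Integrals of functions of independent variables *)

Section independent_pair.
Context (R : realType) d (Omega : measurableType d) (P : probability Omega R)
  d1 (T1 : measurableType d1) d2 (T2 : measurableType d2)
  (X : {RV P >-> T1}) (Y : {RV P >-> T2}).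

Definition independent_pair := forall A B, measurable A -> measurable B ->
  (P (X @^-1` A `&` Y @^-1` B) = P (X @^-1` A) * P (Y @^-1` B))%E.

Hypothesis XY : independent_pair.

Let pair_rv (w : Omega) : T1 * T2 := (X w, Y w).

Let measurable_pair_rv : measurable_fun setT pair_rv.
Proof. exact: measurable_fun_pair. Qed.

HB.instance Definition _ :=
  isMeasurableFun.Build _ _ Omega (T1 * T2)%type pair_rv measurable_pair_rv.

Lemma independent_law (C : set (T1 * T2)) : measurable C ->
  (distribution P X \x distribution P Y)%E C = distribution P pair_rv C.
Proof. by apply: product_measure_unique => A B mA mB /=; rewrite -XY. Qed.

Variable f : T1 * T2 -> R.
Hypothesis mf : measurable_fun setT f.

Lemma independent_L1 : L1 P (fun w => f (X w, Y w)) <->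
  L1 (distribution P X \x distribution P Y)%E f.
Proof.
split=> If.
  apply: (@eq_measure_L1 _ _ _ (distribution P pair_rv)).
    by move=> C mC; exact/esym/independent_law.
  exact: L1_distribution.
apply: (@distribution_L1 _ _ _ _ _ _ pair_rv f).
by apply: eq_measure_L1 If; exact: independent_law.
Qed.

Lemma independent_integral : L1 P (fun w => f (X w, Y w)) ->
  \int[P]_w f (X w, Y w) =
  \int[distribution P X]_x \int[distribution P Y]_y f (x, y).
Proof.
move=> If; rewrite -(Rintegral_fubini12 (independent_L1.1 If)).
rewrite -(@Rintegral_distribution _ _ _ _ _ _ pair_rv f)//.
by apply/esym/eq_measure_Rintegral; exact: independent_law.
Qed.

End independent_pair.
Arguments independent_pair {R d Omega} P {d1 T1 d2 T2} X Y.

Lemma independent_mul (R : realType) d (Omega : measurableType d) (P : probability Omega R)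
    d1 (T1 : measurableType d1) d2 (T2 : measurableType d2)
    (X : {RV P >-> T1}) (Y : {RV P >-> T2}) (u : T1 -> R) (v : T2 -> R) :
  independent_pair P X Y -> measurable_fun setT u -> measurable_fun setT v ->
  L1 P (fun w => u (X w)) -> L1 P (fun w => v (Y w)) ->
  L1 P (fun w => u (X w) * v (Y w)) /\
  \int[P]_w (u (X w) * v (Y w)) = (\int[P]_w u (X w)) * \int[P]_w v (Y w).
Proof.
move=> XY mu' mv Iu Iv; pose f (p : T1 * T2) := u p.1 * v p.2.
have mf : measurable_fun setT f by apply: measurable_funM; exact: measurableT_comp.
have Iu' := L1_distribution mu' Iu; have Iv' := L1_distribution mv Iv.
have If : L1 P (fun w => f (X w, Y w)).
  apply/(independent_L1 XY mf)/integrable12ltyP; first exact/measurable_EFinP.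
  rewrite (_ : (\int[_]_x _)%E = (\int[distribution P X]_x
     (`|u x|%:E * \int[distribution P Y]_y (`|v y|)%:E))%E); last first.
    apply: eq_integral => x _; rewrite -ge0_integralZl//.
    - by apply: eq_integral => y _; rewrite /= /f normrM.
    - by apply/measurable_EFinP; exact: measurableT_comp.
  rewrite ge0_integralZr//.
  - by apply: lte_mul_pinfty; [exact: integral_ge0|
      exact: integrable_fin_num (L1_norm Iu')|exact: integrable_lty (L1_norm Iv')].
  - by apply/measurable_EFinP; exact: measurableT_comp.
  - by apply: integral_ge0 => y _; rewrite lee_fin.
split; first exact: If.
rewrite (independent_integral XY mf If) /f/=.
under eq_Rintegral do rewrite RintegralZl//.
by rewrite RintegralZr// !Rintegral_distribution.
Qed.

Section iid_integrals.
Context (R : realType) dXi (Xi : measurableType dXi) (F : probability Xi R)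
  dO (Omega : measurableType dO) (P : probability Omega R)
  (xi : nat -> {RV P >-> Xi}) (xi_iid : iid_from F xi).

Lemma sample_independent a b (s : 'I_a -> nat) (t : 'I_b -> nat) :
  (forall i j, s i != t j) -> independent_pair P (sample xi s) (sample xi t).
Proof. by move=> st A B; exact: (sample_indep xi_iid). Qed.

Lemma one_sample_independent b (i : nat) (t : 'I_b -> nat) :
  (forall j, i != t j) -> independent_pair P (xi i) (sample xi t).
Proof.
move=> it A B mA mB.
have xiE : xi i @^-1` A = sample xi (fun _ : 'I_1 => i) @^-1` box (fun=> A).
  apply/seteqP; split => w /=; first by move=> ? j; rewrite tnth_mktuple.
  by move=> /(_ ord0); rewrite tnth_mktuple.
by rewrite xiE; apply: sample_independent => //; exact: measurable_box.
Qed.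

Lemma pair_independent (i j : nat) : i != j -> independent_pair P (xi i) (xi j).
Proof.
move=> ij A B mA mB.
have xiE : xi j @^-1` B = sample xi (fun _ : 'I_1 => j) @^-1` box (fun=> B).
  apply/seteqP; split => w /=; first by move=> ? l; rewrite tnth_mktuple.
  by move=> /(_ ord0); rewrite tnth_mktuple.
by rewrite xiE; apply: one_sample_independent => //; exact: measurable_box.
Qed.

Lemma iid_L1 (f : Xi -> R) i : measurable_fun setT f ->
  L1 F f <-> L1 P (fun w => f (xi i w)).
Proof.
move=> mf; have [_ law] := xi_iid; split=> If.
  apply: distribution_L1; apply: eq_measure_L1 If => A mA; exact/esym/law.
by apply: eq_measure_L1 (L1_distribution mf If) => A mA; exact: law.
Qed.

Lemma iid_integral (f : Xi -> R) i : L1 F f -> \int[P]_w f (xi i w) = \int[F]_z f z.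
Proof.
move=> If; have mf := L1_measurable If; have [_ law] := xi_iid.
rewrite -(Rintegral_distribution mf); last by rewrite -iid_L1.
by apply: eq_measure_Rintegral => A mA; exact: law.
Qed.

Lemma iid_pair_L1 (f : Xi * Xi -> R) i j : i != j -> L1 (F \x F)%E f ->
  L1 P (fun w => f (xi i w, xi j w)).
Proof.
move=> ij If; have mf := L1_measurable If; have [_ law] := xi_iid.
apply/(independent_L1 (pair_independent ij) mf); apply: eq_measure_L1 If => A mA.
apply: product_measure_unique => // B C mB mC.
by apply: etrans (product_measure1E _ _ mB mC) _; congr (_ * _)%E; exact: law.
Qed.

Lemma iid_pair_integral (f : Xi * Xi -> R) i j : i != j -> L1 (F \x F)%E f ->
  \int[P]_w f (xi i w, xi j w) = \int[F]_x \int[F]_y f (x, y).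
Proof.
move=> ij If; have mf := L1_measurable If; have [_ law] := xi_iid.
rewrite (independent_integral (pair_independent ij) mf); last exact: iid_pair_L1.
rewrite (@eq_measure_Rintegral _ _ _ _ F); last by move=> A; exact: law.
by apply: eq_Rintegral => x _; apply: eq_measure_Rintegral => A; exact: law.
Qed.

Lemma exchangeable_L1 m (s s' : 'I_m -> nat) (f : m.-tuple Xi -> R) :
  injective s -> injective s' -> measurable_fun setT f ->
  L1 P (fun w => f (sample xi s w)) -> L1 P (fun w => f (sample xi s' w)).
Proof.
move=> sI s'I mf If; apply: (@distribution_L1 _ _ _ _ _ _ (sample xi s')).
apply: (@eq_measure_L1 _ _ _ (distribution P (sample xi s))); last exact: L1_distribution.
by move=> A; exact: (exchangeable xi_iid).
Qed.

Lemma exchangeable_integral m (s s' : 'I_m -> nat) (f : m.-tuple Xi -> R) :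
  injective s -> injective s' -> measurable_fun setT f ->
  L1 P (fun w => f (sample xi s w)) ->
  \int[P]_w f (sample xi s w) = \int[P]_w f (sample xi s' w).
Proof.
move=> sI s'I mf If; have If' := exchangeable_L1 sI s'I mf If.
rewrite -(Rintegral_distribution mf If) -(Rintegral_distribution mf If').
by apply: eq_measure_Rintegral => A; exact: (exchangeable xi_iid).
Qed.

End iid_integrals.

(** * The projection of a Lipschitz kernel *)

Section more_integrals.
Context d (T : measurableType d) (R : realType) (Q : probability T R).

Lemma L1_le_ae (f g : T -> R) : measurable_fun setT f ->
  {ae Q, forall x, `|f x| <= g x} -> L1 Q g -> L1 Q f.
Proof.
move=> mf fg Ig; apply/integrableP; split; first exact/measurable_EFinP.
have Ig' := L1_norm Ig.
have /integrable_lty := Ig'; move=> /(_ measurableT); apply: le_lt_trans.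
apply: ae_ge0_le_integral; [exact: measurableT|by move=> x _; rewrite lee_fin| |
  by move=> x _; rewrite lee_fin|exact: measurable_int Ig'|].
  by apply/measurable_EFinP; exact: measurableT_comp.
by apply: filterS fg => x fgx _; rewrite lee_fin (le_trans fgx)// ler_norm.
Qed.

(** On the set where [v < u] the difference [u - v] is positive and has nonpositive integral, so
    that set is null. This turns information on a conditional expectation, given by integrals over
    events, into a bound at almost every point. *)
Lemma ae_le_of_indic (u v : T -> R) : L1 Q u -> L1 Q v ->
  (forall A, measurable A -> \int[Q]_x (\1_A x * u x) <= \int[Q]_x (\1_A x * v x)) ->
  {ae Q, forall x, u x <= v x}.
Proof.
move=> Iu Iv H; have mu' := L1_measurable Iu; have mv := L1_measurable Iv.
pose A := [set x | v x < u x].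
have mA : measurable A.
  by have := measurable_fun_ltr mv mu' measurableT (I : measurable [set true]); rewrite setTI.
have indL (w : T -> R) : L1 Q w -> L1 Q (fun x => \1_A x * w x).
  move=> Iw; have mw := L1_measurable Iw; apply: L1_le (L1_norm Iw).
    by apply: measurable_funM => //; exact: measurable_indic.
  move=> x; rewrite normrM indicE; case: (_ \in _).
    by rewrite normr1 mul1r.
  by rewrite normr0 mul0r.
have Iw := L1B (indL _ Iu) (indL _ Iv).
have w0 x : 0 <= \1_A x * u x - \1_A x * v x.
  rewrite -mulrBr indicE; case: (boolP (_ \in _)) => [|_]; last by rewrite mul0r.
  by rewrite inE mul1r subr_ge0 => /ltW.
have mw : measurable_fun setT (fun x => (\1_A x * u x - \1_A x * v x)%:E).
  exact: measurable_int Iw.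
have : (\int[Q]_x `|(\1_A x * u x - \1_A x * v x)%:E| = 0)%E.
  apply/eqP; rewrite eq_le integral_ge0 ?andbT//.
  under eq_integral do rewrite gee0_abs ?lee_fin//.
  rewrite -EFin_Rintegral// lee_fin RintegralB//; [|exact: indL..].
  by rewrite subr_le0 H.
move=> /(ae_eq_integral_abs Q measurableT mw).
apply: filterS => x /(_ I)/= -[]; rewrite leNgt -mulrBr => /eqP E.
apply/negP => vu; move: E; rewrite indicE mem_set//= mul1r subr_eq0 gt_eqF//.
Qed.

Lemma jensen_powR (Y : T -> R) (r : R) : 1 < r -> measurable_fun setT Y ->
  (forall x, 0 <= Y x) -> L1 Q (fun x => Y x `^ r) ->
  (\int[Q]_x Y x) `^ r <= \int[Q]_x (Y x `^ r).
Proof.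
move=> r1 mY Y0 Ir; have r0 : 0 < r by exact: lt_trans r1.
have IY : L1 Q Y.
  apply: L1_le (L1D (L1_cst Q 1) Ir) => // x.
  rewrite ger0_norm//; have [Y1|Y1] := leP (Y x) 1.
    by rewrite -[leLHS]addr0 lerD// powR_ge0.
  rewrite -[leLHS]add0r lerD// -[leLHS]powRr1// ler_powR//; exact: ltW.
set m := \int[Q]_x Y x; have m0 : 0 <= m by exact: Rintegral_ge0.
have [->|mn0] := eqVneq m 0.
  by rewrite powR0 ?gt_eqF//; apply: Rintegral_ge0 => x _; exact: powR_ge0.
pose q := r / (r - 1); have rm0 : 0 < r - 1 by rewrite subr_gt0.
have q0 : 0 < q by rewrite divr_gt0.
have rq : r^-1 + q^-1 = 1 by rewrite /q; field; rewrite !gt_eqF.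
have I1 := L1Z (m `^ (r - 1)) IY.
have I2 := L1D (L1Z r^-1 Ir) (L1_cst Q (q^-1 * m `^ r)).
have mr : m `^ (r - 1) * m = m `^ r.
  rewrite -{2}[m]powRr1// -powRD ?subrK//; last by rewrite mn0 implybT.
have : \int[Q]_x (m `^ (r - 1) * Y x) <= \int[Q]_x (r^-1 * Y x `^ r + q^-1 * m `^ r).
  apply: le_RintegralT => // x.
  have := @conjugate_powR R (Y x) (m `^ (r - 1)) r q (Y0 x) (powR_ge0 _ _) r0 q0 rq.
  rewrite mulrC -powRrM (_ : (r - 1) * q = r); last by rewrite /q; field; rewrite gt_eqF.
  by rewrite [_ / r]mulrC [_ / q]mulrC.
rewrite RintegralZl// RintegralD ?RintegralZl ?Rintegral_pcst//; last 2 first.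
- exact: L1Z.
- exact: L1_cst.
rewrite -/m mr -lerBlDr -{1}[m `^ r]mul1r -mulrBl -rq addrK ler_pM2l ?invr_gt0//.
exact: L1_cst.
Qed.

Lemma L1_sqr_sum (I : eqType) (s : seq I) (f : I -> T -> R) :
  (forall i, measurable_fun setT (f i)) ->
  (forall i, L1 Q (fun x => f i x ^+ 2)) ->
  L1 Q (fun x => (\sum_(i <- s) f i x) ^+ 2).
Proof.
move=> mf If; elim: s => [|i s IH].
  by apply: L1_eq (L1_cst Q 0) => x; rewrite big_nil expr0n.
apply: (@L1_eq _ _ _ _ (fun x => (f i x + \sum_(j <- s) f j x) ^+ 2)).
  by move=> x; rewrite big_cons.
by apply: L1_sqrD => //; exact: measurable_sum.
Qed.

End more_integrals.

Section projection.
Context (R : realType) dXi (Xi : measurableType dXi) (F : probability Xi R)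
  dO (Omega : measurableType dO) (P : probability Omega R)
  (xi : nat -> {RV P >-> Xi}) (xi_iid : iid_from F xi).
Variables (k' : nat) (H : k'.+1.-tuple Xi -> R).
Variables (M : Xi -> R) (D : Xi * Xi -> R) (g : Xi -> R).
Local Notation k := k'.+1.
Hypothesis mH : measurable_fun setT H.
Hypothesis mM : measurable_fun setT M.
Hypothesis M2 : L1 F (fun z => M z ^+ 2).
Hypothesis HM : forall z, `|H z| <= k%:R^-1 * \sum_(j < k) M (tnth z j).
Hypothesis mD : measurable_fun setT D.
Hypothesis D0 : forall p, 0 <= D p.
Hypothesis D2 : L1 (F \x F)%E (fun p => D p ^+ 2).
Hypothesis HD : forall (b : pred 'I_k) z z',
  (forall j, ~~ b j -> tnth z j = tnth z' j) ->
  `|H z - H z'| <= k%:R^-1 * \sum_(j < k | b j) D (tnth z j, tnth z' j).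
Hypothesis g_cond : cond_expectation_given (xi 0%N)
  (fun w => H (sample xi (@nat_of_ord k) w)) g.

Let k_gt0 : 0 < k%:R :> R. Proof. by rewrite ltr0n. Qed.

Lemma measurable_sample_comp m (s : 'I_m -> nat) (f : m.-tuple Xi -> R) :
  measurable_fun setT f -> measurable_fun setT (fun w => f (sample xi s w)).
Proof. by move=> mf; apply: (measurableT_comp mf); exact: measurable_sample. Qed.

Lemma L1_sqr_value (s : 'I_k -> nat) : L1 P (fun w => H (sample xi s w) ^+ 2).
Proof.
have I1 : L1 P (fun w => (\sum_(j <- index_enum 'I_k) M (xi (s j) w)) ^+ 2).
  apply: (@L1_sqr_sum _ _ _ _ _ (index_enum 'I_k) (fun j w => M (xi (s j) w))).
    by move=> j; exact: measurableT_comp.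
  move=> j; apply/(@iid_L1 _ _ _ _ _ _ _ _ xi_iid (fun z => M z ^+ 2) (s j)) => //.
  exact: measurable_funX.
apply: L1_le (L1Z (k%:R^-1 ^+ 2) I1).
  by apply: measurable_funX; exact: measurable_sample_comp.
move=> w; have := HM (sample xi s w).
under eq_bigr do rewrite tnth_mktuple.
move=> B; rewrite -exprMn normrX ler_pXn2r ?nnegrE//.
exact: le_trans (normr_ge0 _) B.
Qed.

Lemma L1_value (s : 'I_k -> nat) : L1 P (fun w => H (sample xi s w)).
Proof. by apply: L1_sqr; [exact: measurable_sample_comp|exact: L1_sqr_value]. Qed.

Definition mean_value : R := \int[P]_w H (sample xi (@nat_of_ord k) w).
Local Notation W := mean_value.

Lemma mean_valueE (s : 'I_k -> nat) : injective s -> \int[P]_w H (sample xi s w) = W.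
Proof.
move=> sI; apply: (exchangeable_integral xi_iid) => //; first exact: val_inj.
exact: L1_value.
Qed.

Let mg : measurable_fun setT g. Proof. by case: g_cond. Qed.

Lemma L1_g : L1 F g.
Proof. by apply/(iid_L1 xi_iid 0%N mg); case: g_cond. Qed.

Lemma L1_ind (X : {RV P >-> Xi}) (A : set Xi) (f : Omega -> R) : measurable A ->
  L1 P f -> L1 P (fun w => \1_A (X w) * f w).
Proof.
move=> mA If; apply: L1_le (L1_norm If).
  apply: measurable_funM; last exact: L1_measurable If.
  by apply: (@measurableT_comp _ _ _ _ _ _ (\1_A : Xi -> R)).
by move=> w; rewrite normrM ler_piMl// indicE; case: (_ \in _); rewrite ?normr1 ?normr0.
Qed.

Lemma cond_integral (A : set Xi) : measurable A ->
  \int[P]_w (\1_A (xi 0%N w) * g (xi 0%N w)) =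
  \int[P]_w (\1_A (xi 0%N w) * H (sample xi (@nat_of_ord k) w)).
Proof.
move=> mA; have [_ _ /(_ A mA)] := g_cond.
have E (f : Omega -> R) : (\int[P]_(w in xi 0%N @^-1` A) (f w)%:E =
   \int[P]_w (\1_A (xi 0%N w) * f w)%:E)%E.
  rewrite integral_mkcond; apply: eq_integral => w _; rewrite patchE indicE.
  case: ifPn => [/set_mem Aw|]; first by rewrite mem_set// mul1r.
  by rewrite notin_setE => nA; rewrite memNset// mul0r.
by rewrite !E => EQ; rewrite /Rintegral EQ.
Qed.

Lemma mean_g : \int[F]_z g z = W.
Proof.
rewrite -(iid_integral xi_iid 0%N L1_g).
have := cond_integral measurableT.
under eq_Rintegral do rewrite indicT mul1r.
by move=> ->; under eq_Rintegral do rewrite indicT mul1r.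
Qed.

Definition centered_g (z : Xi) : R := g z - W.
Local Notation G := centered_g.

Lemma measurable_G : measurable_fun setT G.
Proof. exact: measurable_funB. Qed.

Lemma L1_G : L1 F G.
Proof. by apply: L1B; [exact: L1_g|exact: L1_cst]. Qed.

Lemma mean_G : \int[F]_z G z = 0.
Proof.
by rewrite RintegralB ?mean_g ?Rintegral_pcst ?subrr//; [exact: L1_g|exact: L1_cst].
Qed.

Lemma L1_D : L1 (F \x F)%E D.
Proof. exact: L1_sqr. Qed.

(** Index [k] is the first one outside the standard sample, so this sample avoids datum 0 and is
    independent of it. *)
Let fresh (j : 'I_k) : nat := if j == ord0 then k else j.

Let fresh_inj : injective fresh.
Proof.
move=> i j; rewrite /fresh; case: eqP => [->|_]; case: eqP => [->|_] //.
- by move=> jk; have := ltn_ord j; rewrite -jk ltnn.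
- by move=> ik; have := ltn_ord i; rewrite ik ltnn.
- exact: val_inj.
Qed.

Let fresh_neq0 j : 0%N != fresh j.
Proof.
rewrite /fresh; have [//|jn0] := eqVneq j ord0.
by apply: contra jn0 => /eqP j0; apply/eqP/val_inj.
Qed.

(* Replacing the first observation by an independent copy changes H by at most D/k,
   and the copy makes the conditional mean of H equal to W. *)
Lemma G_le_mean_D (e : R) : `|e| <= 1 ->
  {ae F, forall z, e * (k%:R * G z) <= \int[F]_y D (z, y)}.
Proof.
move=> e1; apply: ae_le_of_indic.
- by apply: L1Z; apply: L1Z; exact: L1_G.
- exact: L1_fubini1 L1_D.
move=> A mA.
have mI : measurable_fun setT (\1_A : Xi -> R) by [].
have IH := L1_value (@nat_of_ord k); have IHf := L1_value fresh.
have I1 := L1_ind (xi 0%N) mA IH.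
have [I2 E2] := independent_mul (one_sample_independent xi_iid fresh_neq0) mI mH
  ((iid_L1 xi_iid 0%N mI).1 (integrable_indic _ mA)) IHf.
have Ig := (iid_L1 xi_iid 0%N mg).1 L1_g.
have IAG : L1 F (fun z => \1_A z * (e * (k%:R * G z))).
  apply: L1_le (L1_norm (L1Z e (L1Z k%:R L1_G))).
    apply: measurable_funM => //; apply: measurable_funM => //.
    by apply: measurable_funM => //; exact: measurable_G.
  by move=> z; rewrite normrM ler_piMl// indicE; case: (_ \in _); rewrite ?normr1 ?normr0.
have mAD : measurable_fun setT (fun p : Xi * Xi => \1_A p.1 * D p).
  by apply: measurable_funM => //; exact: (@measurableT_comp _ _ _ _ _ _ (\1_A : Xi -> R)).
have IAD : L1 (F \x F)%E (fun p : Xi * Xi => \1_A p.1 * D p).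
  apply: L1_le (L1_D) => // p.
  by rewrite normrM (ger0_norm (D0 p)) ler_piMl// indicE; case: (_ \in _); rewrite ?normr1 ?normr0.
have IADk := iid_pair_L1 xi_iid (isT : 0%N != k) IAD.
rewrite -(iid_integral xi_iid 0%N IAG).
have -> : \int[P]_w (\1_A (xi 0%N w) * (e * (k%:R * G (xi 0%N w)))) =
    \int[P]_w (e * k%:R * (\1_A (xi 0%N w) * H (sample xi (@nat_of_ord k) w)
      - \1_A (xi 0%N w) * H (sample xi fresh w))).
  rewrite RintegralZl//; last exact: L1B.
  rewrite RintegralB// E2 mean_valueE// -cond_integral//.
  rewrite -RintegralZr//; last by apply: (iid_L1 xi_iid 0%N mI).1; exact: integrable_indic.
  rewrite -RintegralB//; last 2 first.
  - exact: L1_ind.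
  - under [X in L1 P X]eq_fun do rewrite mulrC; apply: L1Z.
    by apply: (iid_L1 xi_iid 0%N mI).1; exact: integrable_indic.
  rewrite -RintegralZl//; last first.
    apply: L1B; first exact: L1_ind.
    under [X in L1 P X]eq_fun do rewrite mulrC; apply: L1Z.
    by apply: (iid_L1 xi_iid 0%N mI).1; exact: integrable_indic.
  by apply: eq_Rintegral => w _; rewrite /centered_g; ring.
have -> : \int[F]_x (\1_A x * \int[F]_y D (x, y)) =
    \int[P]_w (\1_A (xi 0%N w) * D (xi 0%N w, xi k w)).
  rewrite (iid_pair_integral xi_iid (isT : 0%N != k) IAD)/=.
  apply: eq_Rintegral => x _; rewrite indicE; case: (_ \in _).
    by rewrite mul1r; under [RHS]eq_Rintegral do rewrite mul1r.
  by rewrite mul0r; under [RHS]eq_Rintegral do rewrite mul0r; rewrite Rintegral_pcst.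
apply: le_RintegralT => //; first by apply: L1Z; exact: L1B.
move=> w; rewrite -mulrBr mulrCA.
have A0 : 0 <= \1_A (xi 0%N w) :> R by rewrite indicE.
rewrite ler_wpM2l// -mulrA.
have := @HD (pred1 ord0) (sample xi (@nat_of_ord k) w) (sample xi fresh w).
have sub j : ~~ pred1 ord0 j ->
    tnth (sample xi (@nat_of_ord k) w) j = tnth (sample xi fresh w) j.
  by rewrite /= !tnth_mktuple /fresh => /negbTE ->.
move=> /(_ sub); rewrite big_pred1_eq !tnth_mktuple ler_pdivlMl// => B.
apply: le_trans (ler_norm _) _; rewrite !normrM (ger0_norm (ltW k_gt0)).
apply: le_trans B; rewrite ler_piMl// mulr_ge0// ltW//.
Qed.

Lemma norm_G_le_mean_D : {ae F, forall z, `|k%:R * G z| <= \int[F]_y D (z, y)}.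
Proof.
have H1 : `|1 : R| <= 1 by rewrite normr1.
have H2 : `|-1 : R| <= 1 by rewrite normrN normr1.
apply: filterS2 (G_le_mean_D H1) (G_le_mean_D H2) => z.
by rewrite mul1r mulN1r => A B; rewrite ler_norml A andbT lerNl.
Qed.

(** Used with r = 2 for the second moment of the projection and with r = 2 + delta for the Lyapunov
    ratio. Jensen applies to [D (z, y)] as a function of y, for almost every z. *)
Lemma moment_G (r : R) : 1 < r -> L1 (F \x F)%E (fun p => D p `^ r) ->
  L1 F (fun z => `|k%:R * G z| `^ r) /\
  \int[F]_z (`|k%:R * G z| `^ r) <= \int[F]_x \int[F]_y (D (x, y) `^ r).
Proof.
move=> r1 Dr; have r0 : 0 <= r by rewrite (le_trans _ (ltW r1)).
have Ir := L1_fubini1 Dr.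
have mGr : measurable_fun setT (fun z => `|k%:R * G z| `^ r).
  apply: (@measurableT_comp _ _ _ _ _ _ (fun x : R => x `^ r)) => //.
  apply: measurableT_comp => //; apply: measurable_funM => //.
  exact: measurable_G.
have ae : {ae F, forall z, `|k%:R * G z| `^ r <= \int[F]_y (D (z, y) `^ r)}.
  apply: filterS2 norm_G_le_mean_D (ae_integrable1 Dr) => z Gz Iz.
  rewrite (@le_trans _ _ ((\int[F]_y D (z, y)) `^ r))//.
    by apply: ge0_ler_powR => //; rewrite ?nnegrE//; exact: Rintegral_ge0.
  apply: jensen_powR => //.
  exact: measurableT_comp.
have IG : L1 F (fun z => `|k%:R * G z| `^ r).
  apply: (L1_le_ae mGr) Ir.
  by apply: filterS ae => z; rewrite (ger0_norm (powR_ge0 _ _)).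
by split => //; exact: le_Rintegral_ae.
Qed.

End projection.

(** * Degenerate kernels *)

Section degenerate.
Context (R : realType) dXi (Xi : measurableType dXi) (F : probability Xi R)
  dO (Omega : measurableType dO) (P : probability Omega R)
  (xi : nat -> {RV P >-> Xi}) (xi_iid : iid_from F xi).
Variables (k' : nat).
Local Notation k := k'.+1.
Variables (K : k.-tuple Xi -> R) (Delta : Xi * Xi -> R) (C : R).
Hypothesis mK : measurable_fun setT K.
Hypothesis symK : forall (sigma : {perm 'I_k}) z, K [tuple tnth z (sigma i) | i < k] = K z.
Hypothesis K2 : forall s : 'I_k -> nat, L1 P (fun w => K (sample xi s w) ^+ 2).
Hypothesis degK : forall A, measurable A ->
  \int[P]_w (\1_A (xi 0%N w) * K (sample xi (@nat_of_ord k) w)) = 0.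

Let mKs (s : 'I_k -> nat) : measurable_fun setT (fun w => K (sample xi s w)).
Proof. by apply: (measurableT_comp mK); exact: measurable_sample. Qed.

Let L1K s : L1 P (fun w => K (sample xi s w)).
Proof. exact: L1_sqr. Qed.

Let L1KK s t : L1 P (fun w => K (sample xi s w) * K (sample xi t w)).
Proof. exact: L1_sqr_mul. Qed.

Section orthogonality.
Variables (s t : 'I_k -> nat).
Hypothesis s_inj : injective s.
Hypothesis s_t : forall j b, j != ord0 -> s j != t b.

(** The indices are split into two disjoint blocks: [tl] holds those of [s] beyond the first, while
    [ts] holds [s ord0] followed by all of [t]. Independence of the blocks tolerates repetitions
    inside [ts], so [s ord0] may occur in [t]. *)
Let tl (j : 'I_k') : nat := s (lift ord0 j).
Let ts (i : 'I_k.+1) : nat := oapp t (s ord0) (unlift ord0 i).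

Let tl_ts i j : ts i != tl j.
Proof.
rewrite /ts /tl; case: unliftP => [b _|_] /=; first by rewrite eq_sym s_t.
by apply/eqP => /s_inj/eqP; rewrite (negbTE (neq_lift _ _)).
Qed.

Let tl_s0 j : s ord0 != tl j.
Proof. by apply/eqP => /s_inj/eqP; rewrite (negbTE (neq_lift _ _)). Qed.

Let sE w : sample xi s w = [tuple of xi (s ord0) w :: sample xi tl w].
Proof.
apply: eq_from_tnth => i; rewrite tnth_mktuple.
by case: (unliftP ord0 i) => [j ->|->]; rewrite ?tnthS ?tnth0// tnth_mktuple.
Qed.

Let tE w : sample xi t w = [tuple of behead (sample xi ts w)].
Proof.
apply: eq_from_tnth => i; rewrite tnth_mktuple tnth_behead tnth_mktuple /ts.
rewrite (_ : inord i.+1 = lift ord0 i) ?liftK//.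
by apply: val_inj; rewrite /= inordK// ltnS ltn_ord.
Qed.

Let s0E w : xi (s ord0) w = tnth (sample xi ts w) ord0.
Proof. by rewrite tnth_mktuple /ts unlift_none. Qed.

Let f1 (p : Xi * k'.-tuple Xi) : R := K [tuple of p.1 :: p.2].

Let mf1 : measurable_fun setT f1.
Proof. by apply: (measurableT_comp mK); exact: measurable_cons. Qed.

(** The conditional mean of [K] given its first argument, in the version that Fubini provides.
    Degeneracy makes it vanish almost everywhere. *)
Let r (z : Xi) : R := \int[distribution P (sample xi tl)]_u f1 (z, u).

Let ind1 : independent_pair P (xi (s ord0)) (sample xi tl).
Proof. exact: (one_sample_independent xi_iid). Qed.

Let If1 : L1 P (fun w => f1 (xi (s ord0) w, sample xi tl w)).
Proof. by apply: L1_eq (L1K s) => w; rewrite sE. Qed.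

Let Lr : L1 F r.
Proof.
have [_ law] := xi_iid.
have If := (independent_L1 ind1 mf1).1 If1.
by apply: eq_measure_L1 (L1_fubini1 If) => A mA; exact: law.
Qed.

Let r_indic A : measurable A -> \int[F]_z (\1_A z * r z) = 0.
Proof.
move=> mA; pose f2 (p : Xi * k'.-tuple Xi) := \1_A p.1 * f1 p.
have mI : measurable_fun setT (\1_A : Xi -> R) by [].
have ind_le1 (x : Xi) : `|\1_A x : R| <= 1.
  by rewrite indicE; case: (_ \in _); rewrite ?normr1 ?normr0.
have mf2 : measurable_fun setT f2.
  by apply: measurable_funM => //; exact: (@measurableT_comp _ _ _ _ _ _ (\1_A : Xi -> R)).
have If2 : L1 P (fun w => f2 (xi (s ord0) w, sample xi tl w)).
  apply: L1_le (L1_norm If1).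
    by apply: (measurableT_comp mf2); exact: measurable_fun_pair.
  by move=> w; rewrite normrM ler_piMl.
have E := independent_integral ind1 mf2 If2.
transitivity (\int[P]_w f2 (xi (s ord0) w, sample xi tl w)).
  rewrite E; have [_ law] := xi_iid.
  rewrite -(@eq_measure_Rintegral _ _ _ (distribution P (xi (s ord0)))); last first.
    by move=> B mB; exact: law.
  apply: eq_Rintegral => z _; rewrite /f2/= indicE; case: (_ \in _).
    by rewrite mul1r; under [RHS]eq_Rintegral do rewrite mul1r.
  by rewrite mul0r; under [RHS]eq_Rintegral do rewrite mul0r; rewrite Rintegral_pcst.
pose f3 (z : k.-tuple Xi) := \1_A (tnth z ord0) * K z.
have mf3 : measurable_fun setT f3.
  apply: measurable_funM => //; apply: (@measurableT_comp _ _ _ _ _ _ (\1_A : Xi -> R)) => //.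
  exact: measurable_tnth.
have f23 w : f2 (xi (s ord0) w, sample xi tl w) = f3 (sample xi s w).
  by rewrite /f2 /f3 /f1 /= -sE tnth_mktuple.
under eq_Rintegral do rewrite f23.
rewrite (@exchangeable_integral _ _ _ _ _ _ _ _ xi_iid _ s (@nat_of_ord k))//; last 2 first.
- exact: val_inj.
- by apply: L1_eq If2 => w; rewrite f23.
by rewrite -[RHS](degK mA); apply: eq_Rintegral => w _; rewrite /f3 tnth_mktuple.
Qed.

Let r_ae0 : {ae F, forall z, r z = 0}.
Proof.
have L0 : L1 F (fun=> 0 : R) by exact: L1_cst.
have z0 A : measurable A -> \int[F]_z (\1_A z * (0 : R)) = 0.
  by move=> mA; under eq_Rintegral do rewrite mulr0; rewrite Rintegral_pcst.
apply: filterS2 (ae_le_of_indic Lr L0 _) (ae_le_of_indic L0 Lr _).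
- by move=> z r0 r1; apply/eqP; rewrite eq_le r0 r1.
- by move=> A mA; rewrite r_indic// z0.
- by move=> A mA; rewrite r_indic// z0.
Qed.

Let nu := distribution P (sample xi ts).

Let r_nu_ae0 : {ae nu, forall y, r (tnth y ord0) = 0}.
Proof.
have [_ law] := xi_iid; have mr := L1_measurable Lr.
pose N := [set z | r z != 0].
have mN : measurable N.
  have := mr measurableT _ (measurableC (@measurable_set1 R 0)); rewrite setTI.
  by congr measurable; apply/seteqP; split => z /=; [move=> H; exact/eqP|move=> /eqP].
have FN : F N = 0%E.
  have [N' [mN' N'0 sub]] := r_ae0.
  by apply: subset_measure0 N'0 => // z /= /eqP; exact: sub.
exists ((fun y => tnth y ord0) @^-1` N); split.
- by rewrite -[X in measurable X]setTI; exact: measurable_tnth.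
- rewrite -FN -(law (s ord0))//= /nu /distribution /pushforward.
  by congr (P _); apply/seteqP; split => w /=; rewrite -s0E.
- by move=> y /= /eqP.
Qed.

(** With the block [ts] held fixed, the second factor is constant, and integrating the first over
    [tl] gives [r] at the datum [s ord0], almost surely 0. *)
Lemma orthogonal0 : \int[P]_w (K (sample xi s w) * K (sample xi t w)) = 0.
Proof.
pose f (p : k.+1.-tuple Xi * k'.-tuple Xi) : R :=
  f1 (tnth p.1 ord0, p.2) * K [tuple of behead p.1].
have mf : measurable_fun setT f.
  apply: measurable_funM.
    apply: (measurableT_comp mf1); apply: measurable_fun_pair => //.
    by apply: (measurableT_comp (@measurable_tnth _ _ _ ord0)).
  apply: (measurableT_comp mK).
  by apply: (measurableT_comp (@measurable_behead _ _ _)).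
have fE w : K (sample xi s w) * K (sample xi t w) = f (sample xi ts w, sample xi tl w).
  by rewrite /f/= /f1/= -s0E -sE -tE.
have ind : independent_pair P (sample xi ts) (sample xi tl).
  exact: (sample_independent xi_iid).
under eq_Rintegral do rewrite fE.
have If : L1 P (fun w => f (sample xi ts w, sample xi tl w)).
  by apply: L1_eq (L1KK s t) => w; rewrite fE.
rewrite (independent_integral ind mf If).
have If' := (independent_L1 ind mf).1 If.
transitivity (\int[nu]_y (0 : R)); last by rewrite Rintegral_pcst.
congr fine; apply: ae_eq_integral => //.
  exact: measurable_int (L1_fubini1 If').
apply: filterS2 (ae_integrable1 If') r_nu_ae0 => y Iy ry _.
(* Only the product is known to be integrable on the section. Dividing by the constant factor
   recovers integrability of the other one, except when the constant is 0 and the integral vanishes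
   trivially. *)
have [K0|K0] := eqVneq (K [tuple of behead y]) 0.
  by under eq_Rintegral do rewrite /f K0 mulr0; rewrite Rintegral_pcst.
rewrite /f /= RintegralZr//; first by rewrite -/(r _) ry mul0r.
apply: L1_eq (L1Z (K [tuple of behead y])^-1 Iy) => u.
by rewrite /f /= mulrCA mulVf// mulr1.
Qed.

End orthogonality.

(** Symmetry of [K] moves to position 0 the only position of [s] whose index may occur in [t]. *)
Lemma orthogonal (s t : 'I_k -> nat) (a : 'I_k) : injective s ->
  (forall j b, j != a -> s j != t b) ->
  \int[P]_w (K (sample xi s w) * K (sample xi t w)) = 0.
Proof.
move=> sI st; pose s' j := s (tperm ord0 a j).
rewrite -(@orthogonal0 s' t).
- apply: eq_Rintegral => w _; congr (_ * _).
  rewrite -(symK (tperm ord0 a)); congr K; apply: eq_from_tnth => i.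
  by rewrite !tnth_mktuple.
- by move=> i j /sI/perm_inj.
- move=> j b j0; apply: st.
  by apply: contra j0 => /eqP E; rewrite -(tpermK ord0 a j) E tpermR.
Qed.

End degenerate.

(** * Shared indices and covariances of a degenerate kernel *)

Lemma sqr_sum_le (R : realFieldType) (I : Type) (s : seq I) (b : pred I) (f : I -> R) :
  (\sum_(j <- s | b j) f j) ^+ 2 <= (count b s)%:R * \sum_(j <- s | b j) f j ^+ 2.
Proof.
elim: s => [|i s IH]; first by rewrite !big_nil expr0n mulr0.
rewrite !big_cons /=; case: ifPn => bi; last by rewrite add0n.
set S := \sum_(j <- s | b j) f j in IH *; set S2 := \sum_(j <- s | b j) _ in IH *.
have : 2 * (f i * S) <= (count b s)%:R * f i ^+ 2 + S2.
  rewrite /S /S2 !mulr_sumr -sum1_count natr_sum mulr_suml.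
  rewrite -big_split/=; apply: ler_sum => j _; rewrite mul1r.
  by have := sqr_ge0 (f i - f j); lra.
rewrite add1n -natr1; set m := (count b s)%:R in IH *; lra.
Qed.

(** For injective tuples with c common indices this is c (c - 1), hence 0 as soon as c <= 1. Written
    as a sum of indicators of matched pairs of positions, it can be averaged over random tuples term
    by term. *)
Definition shared_pairs k (s t : 'I_k -> nat) : nat :=
  \sum_(p : ('I_k * 'I_k) * ('I_k * 'I_k) | (p.1.1 != p.1.2) && (p.2.1 != p.2.2))
    ((s p.1.1 == t p.2.1) && (s p.1.2 == t p.2.2)).

Lemma shared_pairsC k (s t : 'I_k -> nat) : shared_pairs s t = shared_pairs t s.
Proof.
pose sw (p : ('I_k * 'I_k) * ('I_k * 'I_k)) := (p.2, p.1).
have swK : involutive sw by case.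
rewrite /shared_pairs (reindex_inj (inv_inj swK)) /=.
by apply: eq_big => [[[a a'] [b b']]|[[a a'] [b b']] _] /=; [rewrite andbC|congr (nat_of_bool (_ && _)); rewrite eq_sym].
Qed.

Definition overlap k (s t : 'I_k -> nat) : {set 'I_k} := [set a | [exists b, s a == t b]].

Definition changed k (s s' : 'I_k -> nat) : pred 'I_k := fun j => s j != s' j.

Lemma overlap_pairs k (s t : 'I_k -> nat) : injective s ->
  (#|overlap s t| * #|overlap s t|.-1 <= shared_pairs s t)%N.
Proof.
move=> sI; set S := overlap s t.
have -> : (#|S| * #|S|.-1 = \sum_(q : 'I_k * 'I_k | [&& q.1 \in S, q.2 \in S & q.1 != q.2]) 1)%N.
  rewrite -(pair_big_dep (mem S) (fun a a' => (a' \in S) && (a != a')) (fun _ _ => 1%N))/=.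
  rewrite -sum_nat_const; apply: eq_bigr => a aS.
  rewrite sum1_card (cardsD1 a S) aS /=; apply: eq_card => a'.
  by rewrite in_setD1 [RHS]andbC eq_sym.
rewrite /shared_pairs.
rewrite -(pair_big_dep (fun q : 'I_k * 'I_k => q.1 != q.2) (fun _ q' => q'.1 != q'.2)
   (fun q q' => nat_of_bool ((s q.1 == t q'.1) && (s q.2 == t q'.2))))/=.
rewrite [leqRHS](bigID (fun q : 'I_k * 'I_k => (q.1 \in S) && (q.2 \in S)))/=.
apply: leq_trans (leq_addr _ _).
rewrite (eq_bigl (fun q : 'I_k * 'I_k => (q.1 != q.2) && ((q.1 \in S) && (q.2 \in S)))); last first.
  by move=> q; rewrite andbA andbC.
apply: leq_sum => -[a a'] /= /andP[aa' /andP[]].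
rewrite !inE => /existsP[b sb] /existsP[b' sb'].
rewrite (bigD1 (b, b'))/=; first by rewrite sb sb'.
apply: contra aa' => /eqP bb'; apply/eqP/sI.
by rewrite (eqP sb) (eqP sb') bb'.
Qed.

Section covariance.
Context (R : realType) dXi (Xi : measurableType dXi) (F : probability Xi R)
  dO (Omega : measurableType dO) (P : probability Omega R)
  (xi : nat -> {RV P >-> Xi}) (xi_iid : iid_from F xi).
Variables (k' : nat).
Local Notation k := k'.+1.
Variables (K : k.-tuple Xi -> R) (Delta : Xi * Xi -> R) (C : R).
Hypothesis mK : measurable_fun setT K.
Hypothesis symK : forall (sigma : {perm 'I_k}) z, K [tuple tnth z (sigma i) | i < k] = K z.
Hypothesis K2 : forall s : 'I_k -> nat, L1 P (fun w => K (sample xi s w) ^+ 2).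
Hypothesis degK : forall A, measurable A ->
  \int[P]_w (\1_A (xi 0%N w) * K (sample xi (@nat_of_ord k) w)) = 0.
Hypothesis mDelta : measurable_fun setT Delta.
Hypothesis L1_Delta : forall i j, i != j -> L1 P (fun w => Delta (xi i w, xi j w) ^+ 2).
Hypothesis Delta2 : forall i j, i != j -> \int[P]_w (Delta (xi i w, xi j w) ^+ 2) <= C.
Hypothesis lipK : forall (b : pred 'I_k) z z',
  (forall j, ~~ b j -> tnth z j = tnth z' j) ->
  `|K z - K z'| <= k%:R^-1 * \sum_(j < k | b j) Delta (tnth z j, tnth z' j).

Let mKs (s : 'I_k -> nat) : measurable_fun setT (fun w => K (sample xi s w)).
Proof. by apply: (measurableT_comp mK); exact: measurable_sample. Qed.

Let L1K s : L1 P (fun w => K (sample xi s w)).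
Proof. exact: L1_sqr. Qed.

Let L1KK s t : L1 P (fun w => K (sample xi s w) * K (sample xi t w)).
Proof. exact: L1_sqr_mul. Qed.

Let mD i j : measurable_fun setT (fun w => Delta (xi i w, xi j w)).
Proof. by apply: (measurableT_comp mDelta); exact: measurable_fun_pair. Qed.

Let C0 : 0 <= C.
Proof. by apply: le_trans (Delta2 (isT : 0%N != 1%N)); apply: Rintegral_ge0 => w _; exact: sqr_ge0. Qed.

Let dK s s' w : `|K (sample xi s w) - K (sample xi s' w)| <=
  k%:R^-1 * \sum_(j < k | changed s s' j) Delta (xi (s j) w, xi (s' j) w).
Proof.
have := @lipK (changed s s') (sample xi s w) (sample xi s' w).
have H j : ~~ changed s s' j -> tnth (sample xi s w) j = tnth (sample xi s' w) j.
  by rewrite !tnth_mktuple => /negPn/eqP ->.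
by move=> /(_ H); under eq_bigr do rewrite !tnth_mktuple.
Qed.

Lemma sqr_change s s' :
  \int[P]_w ((K (sample xi s w) - K (sample xi s' w)) ^+ 2)
  <= k%:R^-1 ^+ 2 * (#|changed s s'|%:R ^+ 2 * C).
Proof.
set c := #|changed s s'|.
have IS : L1 P (fun w => \sum_(j < k | changed s s' j) Delta (xi (s j) w, xi (s' j) w) ^+ 2).
  by apply: L1_sum => j _ sj; exact: L1_Delta.
apply: (@le_trans _ _ (\int[P]_w (k%:R^-1 ^+ 2 * c%:R *
   \sum_(j < k | changed s s' j) Delta (xi (s j) w, xi (s' j) w) ^+ 2))).
  apply: le_RintegralT.
  - apply: (@L1_eq _ _ _ _ (fun w => (K (sample xi s w) + (-1) * K (sample xi s' w)) ^+ 2)).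
      by move=> w; rewrite mulN1r.
    apply: L1_sqrD => //; first exact: measurable_funM.
    by apply: L1_eq (K2 s') => w; rewrite exprMn sqrrN expr1n mul1r.
  - exact: L1Z.
  - move=> w; rewrite -real_normK ?num_real//.
    apply: (@le_trans _ _ ((k%:R^-1 * \sum_(j < k | changed s s' j)
        Delta (xi (s j) w, xi (s' j) w)) ^+ 2)).
      have B := dK s s' w.
      by rewrite ler_pXn2r ?nnegrE//; exact: le_trans (normr_ge0 _) B.
    rewrite exprMn -mulrA ler_wpM2l ?sqr_ge0//.
    apply: le_trans (sqr_sum_le _ _ _) _.
    by rewrite /c cardE size_filter.
rewrite RintegralZl// -mulrA ler_wpM2l ?sqr_ge0// expr2 -mulrA ler_wpM2l ?ler0n//.
rewrite Rintegral_sum; last by move=> j _ sj; exact: L1_Delta.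
apply: (@le_trans _ _ (\sum_(j < k | changed s s' j) C)).
  by apply: ler_sum => j sj; exact: Delta2.
by rewrite sumr_const mulr_natl.
Qed.

(** [Delta <= 1 + Delta^2] turns the second-moment bound [C] into the first-moment bound [1 + C]. *)
Lemma abs_change s s' :
  \int[P]_w `|K (sample xi s w) - K (sample xi s' w)|
  <= k%:R^-1 * (#|changed s s'|%:R * (1 + C)).
Proof.
have ID j : changed s s' j -> L1 P (fun w => Delta (xi (s j) w, xi (s' j) w)).
  by move=> sj; apply: L1_sqr => //; exact: L1_Delta.
apply: (@le_trans _ _ (\int[P]_w (k%:R^-1 *
   \sum_(j < k | changed s s' j) Delta (xi (s j) w, xi (s' j) w)))).
  apply: le_RintegralT.
  - by apply: L1_norm; exact: L1B.
  - by apply: L1Z; apply: L1_sum => j _; exact: ID.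
  - exact: dK.
rewrite RintegralZl//; last by apply: L1_sum => j _; exact: ID.
rewrite ler_wpM2l ?invr_ge0// Rintegral_sum; last by move=> j _; exact: ID.
apply: (@le_trans _ _ (\sum_(j < k | changed s s' j) (1 + C))); last first.
  by rewrite sumr_const mulr_natl.
apply: ler_sum => j sj; rewrite -(Rintegral_pcst P 1).
apply: le_trans (lerD (lexx _) (Delta2 sj)).
rewrite -RintegralD//; [|exact: L1_cst|exact: L1_Delta].
apply: le_RintegralT; [exact: ID|by apply: L1D; [exact: L1_cst|exact: L1_Delta]|].
by move=> w; set x := Delta _; have := sqr_ge0 (x - 1); have := sqr_ge0 x; lra.
Qed.

(** Relabelling the data by an injection preserves their joint law. All samples are read off one
    tuple of data long enough to contain every index involved, and exchangeability is applied to
    that tuple; being an involution, [sigma] brings [sigma \o t] back to [t]. *)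
Lemma swap_indices (s t : 'I_k -> nat) (sigma : nat -> nat) : involutive sigma ->
  \int[P]_w (K (sample xi s w) * (K (sample xi t w) - K (sample xi (sigma \o t) w))) =
  \int[P]_w (K (sample xi (sigma \o s) w) *
             (K (sample xi (sigma \o t) w) - K (sample xi t w))).
Proof.
move=> sK; pose N := (\max_(j < k) maxn (s j) (maxn (t j) (sigma (t j))))%N.
have sN j : (s j < N.+1)%N.
  by rewrite ltnS; apply: leq_trans (leq_bigmax j); rewrite leq_maxl.
have tN j : (t j < N.+1)%N.
  by rewrite ltnS; apply: leq_trans (leq_bigmax j); rewrite !leq_max leqnn orbT.
have stN j : (sigma (t j) < N.+1)%N.
  by rewrite ltnS; apply: leq_trans (leq_bigmax j); rewrite !leq_max leqnn !orbT.
pose sub (e : 'I_k -> nat) (z : N.+1.-tuple Xi) : k.-tuple Xi :=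
  [tuple tnth z (inord (e j)) | j < k].
have msub e : measurable_fun setT (sub e).
  apply/measurable_fun_tnthP => j.
  rewrite (_ : _ \o _ = fun z : N.+1.-tuple Xi => tnth z (inord (e j))).
    exact: measurable_tnth.
  by apply/funext => z /=; rewrite tnth_mktuple.
have subE (e : 'I_k -> nat) (v : nat -> nat) w : (forall j, (e j < N.+1)%N) ->
    sub e (sample xi (fun i : 'I_N.+1 => v i) w) = sample xi (v \o e) w.
  by move=> eN; apply: eq_from_tnth => j; rewrite !tnth_mktuple /= inordK.
pose Psi z := K (sub s z) * (K (sub t z) - K (sub (sigma \o t) z)).
have mPsi : measurable_fun setT Psi.
  by apply: measurable_funM; [|apply: measurable_funB]; exact: (measurableT_comp mK).
transitivity (\int[P]_w Psi (sample xi (fun i : 'I_N.+1 => idfun (i : nat)) w)).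
  by apply: eq_Rintegral => w _; rewrite /Psi !subE.
rewrite (@exchangeable_integral _ _ _ _ _ _ _ _ xi_iid _ _ (fun i : 'I_N.+1 => sigma i))//.
- apply: eq_Rintegral => w _; rewrite /Psi !subE//.
  by congr (_ * (_ - K (sample xi _ w))); apply/funext => j /=; rewrite sK.
- exact: val_inj.
- by move=> i j /(inv_inj sK)/val_inj.
- apply: (@L1_eq _ _ _ _ (fun w => K (sample xi s w) * K (sample xi t w)
      - K (sample xi s w) * K (sample xi (sigma \o t) w))).
    by move=> w; rewrite /Psi !subE// mulrBr.
  exact: L1B.
Qed.

(* Let sigma exchange the shared indices with unused ones.  Then s and sigma t are
   disjoint, so E K(s) K(t) = E K(s) (K(t) - K(sigma t)), and applying sigma to all
   indices turns twice this into E (K(s) - K(sigma s)) (K(t) - K(sigma t)), a product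
   of two small factors. *)
Lemma covariance_bound (s t : 'I_k -> nat) : injective s -> injective t ->
  \int[P]_w (K (sample xi s w) * K (sample xi t w))
  <= k%:R^-1 ^+ 2 * C * (shared_pairs s t)%:R.
Proof.
move=> sI tI; set cs := #|overlap s t|; set Pi := shared_pairs s t.
have rhs0 : 0 <= k%:R^-1 ^+ 2 * C * Pi%:R by rewrite !mulr_ge0 ?sqr_ge0.
have [cs1|cs2] := leqP cs 1.
  (* With at most one common index the covariance vanishes: [a] is the position of that index in
     [s], or any position if there is none. *)
  suff [a Ha] : exists a, forall j b, j != a -> s j != t b.
    by rewrite (@orthogonal _ _ _ _ _ _ _ _ xi_iid _ _ mK symK K2 degK s t a).
  have [/eqP|cs0] := eqVneq cs 0%N.
    rewrite cards_eq0 => /eqP S0; exists ord0 => j b _.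
    have : j \notin overlap s t by rewrite S0 inE.
    by rewrite inE => /existsPn.
  have /cards1P[a Sa] : cs == 1%N by rewrite eqn_leq cs1 lt0n.
  exists a => j b ja; have : j \notin overlap s t by rewrite Sa inE.
  by rewrite inE => /existsPn.
pose N := (\max_(j < k) maxn (s j) (t j)).+1.
have sN j : (s j < N)%N by rewrite ltnS; apply: leq_trans (leq_bigmax j); rewrite leq_maxl.
have tN j : (t j < N)%N by rewrite ltnS; apply: leq_trans (leq_bigmax j); rewrite leq_maxr.
pose S (i : nat) := [exists a, s a == i] && [exists b, t b == i].
have SN i : S i -> (i < N)%N by move=> /andP[/existsP[a /eqP <-] _].
pose sigma i := if S i then (i + N)%N else if (N <= i)%N && S (i - N)%N then (i - N)%N else i.
have sigmaS i : S i -> sigma i = (i + N)%N by rewrite /sigma => ->.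
have sigmaSV i : S i -> sigma (i + N)%N = i.
  move=> Si; rewrite /sigma leq_addl addnK Si /=; case: ifPn => // /SN.
  by rewrite ltnNge leq_addl.
have sigmaK : involutive sigma.
  move=> i; rewrite {2}/sigma; case: ifPn => [|Si]; first exact: sigmaSV.
  case: ifPn => [/andP[Ni SiN]|Ni]; first by rewrite sigmaS// subnK.
  by rewrite /sigma (negbTE Si) (negbTE Ni).
have sigmaN i : (i < N)%N -> ~~ S i -> sigma i = i.
  by move=> iN Si; rewrite /sigma (negbTE Si) leqNgt iN.
have changed_s : #|changed s (sigma \o s)| = cs.
  apply: eq_card => a; rewrite inE unfold_in /changed /=; apply/idP/idP.
    apply: contraR => nS; rewrite sigmaN//; apply: contra nS => /andP[_ /existsP[b /eqP tb]].
    by apply/existsP; exists b; rewrite tb.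
  move=> /existsP[b sb]; rewrite sigmaS; last first.
    by apply/andP; split; apply/existsP; [exists a|exists b; rewrite eq_sym].
  by rewrite neq_ltn -[X in (X < _)%N]addn0 ltn_add2l.
have changed_t : #|changed t (sigma \o t)| = #|overlap t s|.
  apply: eq_card => b; rewrite inE unfold_in /changed /=; apply/idP/idP.
    apply: contraR => nS; rewrite sigmaN//; apply: contra nS => /andP[/existsP[a /eqP sa] _].
    by apply/existsP; exists a; rewrite sa.
  move=> /existsP[a ta]; rewrite sigmaS; last first.
    by apply/andP; split; apply/existsP; [exists a; rewrite eq_sym|exists b].
  by rewrite neq_ltn -[X in (X < _)%N]addn0 ltn_add2l.
have E0 : \int[P]_w (K (sample xi s w) * K (sample xi (sigma \o t) w)) = 0.
  apply: (@orthogonal _ _ _ _ _ _ _ _ xi_iid _ _ mK symK K2 degK s _ ord0) => // j b _.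
  rewrite (_ : (sigma \o t) b = sigma (t b))//.
  have [Sb|Sb] := boolP (S (t b)).
    by rewrite sigmaS// neq_ltn (leq_trans (sN j))// leq_addl.
  rewrite sigmaN//; apply: contra Sb => /eqP sj; apply/andP; split; apply/existsP.
    by exists j; rewrite sj.
  by exists b.
have Isub a b c : L1 P (fun w => K (sample xi a w) * (K (sample xi b w) - K (sample xi c w))).
  by apply: L1_eq (L1B (L1KK a b) (L1KK a c)) => w; rewrite mulrBr.
have E1 : \int[P]_w (K (sample xi s w) * K (sample xi t w)) =
    \int[P]_w (K (sample xi s w) * (K (sample xi t w) - K (sample xi (sigma \o t) w))).
  under [RHS]eq_Rintegral do rewrite mulrBr.
  by rewrite RintegralB// E0 subr0.
have E2 := swap_indices s t sigmaK.
have Isq a b : L1 P (fun w => (K (sample xi a w) - K (sample xi b w)) ^+ 2).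
  apply: (@L1_eq _ _ _ _ (fun w => (K (sample xi a w) + (-1) * K (sample xi b w)) ^+ 2)).
    by move=> w; rewrite mulN1r.
  apply: L1_sqrD => //; first exact: measurable_funM.
  by apply: L1_eq (K2 b) => w; rewrite exprMn sqrrN expr1n mul1r.
have E3 : 2 * \int[P]_w (K (sample xi s w) * K (sample xi t w)) <=
   2^-1 * (\int[P]_w ((K (sample xi s w) - K (sample xi (sigma \o s) w)) ^+ 2) +
           \int[P]_w ((K (sample xi t w) - K (sample xi (sigma \o t) w)) ^+ 2)).
  rewrite mulr_natl mulr2n {1}E1 {1}E1 {1}E2 -RintegralD//.
  rewrite -RintegralD// -RintegralZl//; last exact: L1D.
  apply: le_RintegralT; [exact: L1D|by apply: L1Z; exact: L1D|move=> w].
  set a := K _; set b := K _; set c := K _; set e := K _.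
  by have := sqr_ge0 ((a - e) - (b - c)); have := sqr_ge0 ((a - e) + (b - c)); lra.
have B1 := sqr_change s (sigma \o s); have B2 := sqr_change t (sigma \o t).
rewrite changed_s in B1; rewrite changed_t in B2.
(* From two common indices on, [c^2 <= 2 c (c - 1)]. This trades the squared number of changed
   positions for the number of shared pairs. *)
have cs_le : cs%:R ^+ 2 <= 2 * Pi%:R :> R.
  rewrite -natrX -natrM ler_nat; apply: (@leq_trans (2 * (cs * cs.-1))%N).
    by rewrite -mulnn; case: (cs) cs2 => [|[|c]]//= _; rewrite mulnCA leq_mul2l; lia.
  by rewrite leq_mul2l overlap_pairs.
have ct_le : #|overlap t s|%:R ^+ 2 <= 2 * Pi%:R :> R.
  have := overlap_pairs s tI; rewrite shared_pairsC -/Pi; set ct := #|_| => ctP.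
  rewrite -natrX -natrM ler_nat.
  have P2 : (2 <= Pi)%N.
    apply: leq_trans (overlap_pairs t sI); rewrite -/cs.
    by case: (cs) cs2 => [|[|c]]//= _; rewrite mulnS; lia.
  have [ct1|ct2] := leqP ct 1.
    by apply: (@leq_trans 1%N); [rewrite -(exp1n 2) leq_exp2r|lia].
  apply: (@leq_trans (2 * (ct * ct.-1))%N).
    by rewrite -mulnn; case: (ct) ct2 => [|[|c]]//= _; rewrite mulnCA leq_mul2l; lia.
  by rewrite leq_mul2l ctP.
have k20 : 0 <= k%:R^-1 ^+ 2 * C by rewrite mulr_ge0 ?sqr_ge0.
have fac (x : R) : x <= 2 * Pi%:R ->
    k%:R^-1 ^+ 2 * (x * C) <= 2 * (k%:R^-1 ^+ 2 * C * Pi%:R).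
  by move=> xPi; rewrite mulrCA mulrC [leRHS]mulrCA ler_wpM2l.
have := le_trans B1 (fac _ cs_le); have := le_trans B2 (fac _ ct_le); move: E3.
set x := \int[P]_w _; set y := \int[P]_w _; set z := \int[P]_w _.
set rhs := _ * _ * Pi%:R => *; lra.
Qed.

End covariance.

(** * Averages over index tuples with repetitions *)

Section index_average.
Context (R : realType) (k n : nat).
Hypothesis n_gt0 : (0 < n)%N.

(** The expectation when the k indices are drawn independently and uniformly. Finite functions,
    rather than tuples, let products over positions factor through [bigA_distr_bigA]. *)
Definition index_avg (phi : {ffun 'I_k -> 'I_n} -> R) : R :=
  (n%:R ^+ k)^-1 * \sum_(I : {ffun 'I_k -> 'I_n}) phi I.

Let nR_gt0 : 0 < n%:R :> R. Proof. by rewrite ltr0n. Qed.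

Lemma index_avg_cst (c : R) : index_avg (fun=> c) = c.
Proof.
rewrite /index_avg sumr_const card_ffun !card_ord -[c *+ _]mulr_natl natrX mulrA mulVf ?mul1r//.
by rewrite expf_neq0// gt_eqF.
Qed.

Lemma ler_index_avg phi psi : (forall I, phi I <= psi I) -> index_avg phi <= index_avg psi.
Proof.
move=> le; rewrite /index_avg ler_wpM2l ?invr_ge0 ?exprn_ge0//; exact: ler_sum.
Qed.

Lemma index_avg_sum (J : Type) (s : seq J) (p : pred J) (phi : J -> {ffun 'I_k -> 'I_n} -> R) :
  index_avg (fun I => \sum_(j <- s | p j) phi j I) = \sum_(j <- s | p j) index_avg (phi j).
Proof. by rewrite /index_avg exchange_big mulr_sumr. Qed.

Lemma index_avgZ (c : R) phi : index_avg (fun I => c * phi I) = c * index_avg phi.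
Proof. by rewrite /index_avg -mulr_sumr mulrCA. Qed.

Lemma index_avg_prod (F : 'I_k -> 'I_n -> R) :
  index_avg (fun I => \prod_(i < k) F i (I i)) = \prod_(i < k) (n%:R^-1 * \sum_x F i x).
Proof.
rewrite /index_avg mulr_sumr.
transitivity (\sum_(I : {ffun 'I_k -> 'I_n}) \prod_(i < k) (n%:R^-1 * F i (I i))).
  by apply: eq_bigr => I _; rewrite big_split/= prodr_const card_ord exprVn.
rewrite -(bigA_distr_bigA (fun i x => n%:R^-1 * F i x)).
by apply: eq_bigr => i _; rewrite mulr_sumr.
Qed.

Lemma index_avg1 (a : 'I_k) (phi : 'I_n -> R) :
  index_avg (fun I => phi (I a)) = n%:R^-1 * \sum_x phi x.
Proof.
have := index_avg_prod (fun i x => if i == a then phi x else 1).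
rewrite (bigD1 a)//= eqxx [X in _ * X]big1 ?mulr1; last first.
  move=> i ia; rewrite (negbTE ia) sumr_const card_ord mulVf// gt_eqF//.
move=> <-; congr (_ * _); apply: eq_bigr => I _.
by rewrite (bigD1 a)//= eqxx big1 ?mulr1// => i /negbTE ->.
Qed.

Lemma index_avg2 (a b : 'I_k) (phi psi : 'I_n -> R) : a != b ->
  index_avg (fun I => phi (I a) * psi (I b)) =
  (n%:R^-1 * \sum_x phi x) * (n%:R^-1 * \sum_x psi x).
Proof.
move=> ab; have ba : b != a by rewrite eq_sym.
have := index_avg_prod (fun i x => if i == a then phi x else if i == b then psi x else 1).
rewrite (bigD1 a)//= (bigD1 b)//= !eqxx (negbTE ba) [X in _ * (_ * X)]big1 ?mulr1; last first.
  move=> i /andP[/negbTE -> /negbTE ->]; rewrite sumr_const card_ord mulVf// gt_eqF//.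
move=> <-; congr (_ * _); apply: eq_bigr => I _.
rewrite (bigD1 a)//= (bigD1 b)//= !eqxx (negbTE ba) [X in _ * (_ * X)]big1 ?mulr1//.
by move=> i /andP[/negbTE -> /negbTE ->].
Qed.

Let sum_delta (y : 'I_n) : \sum_x (x == y)%:R = 1 :> R.
Proof. by rewrite (bigD1 y)//= eqxx big1 ?addr0// => x /negbTE ->. Qed.

Lemma index_avg_collision (a b : 'I_k) : a != b ->
  index_avg (fun I => (I a == I b)%:R) = n%:R^-1.
Proof.
move=> ab; transitivity (index_avg (fun I => \sum_x ((I a == x)%:R * (I b == x)%:R))).
  congr (_ * _); apply: eq_bigr => I _; rewrite (bigD1 (I b))//= eqxx mulr1.
  by rewrite big1 ?addr0// => x xb; rewrite (eq_sym (I b)) (negbTE xb) mulr0.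
rewrite index_avg_sum; under eq_bigr => x _.
  rewrite (@index_avg2 a b (fun y => (y == x)%:R) (fun y => (y == x)%:R))// !sum_delta mulr1.
  over.
rewrite sumr_const card_ord -[_ *+ n]mulr_natl; field; by rewrite gt_eqF.
Qed.

Lemma index_avg_match (a b : 'I_k) (y z : 'I_n) : a != b ->
  index_avg (fun I => ((I a == y) && (I b == z))%:R) = n%:R^-1 ^+ 2.
Proof.
move=> ab.
have := @index_avg2 a b (fun x => (x == y)%:R) (fun x => (x == z)%:R) ab.
rewrite !sum_delta !mulr1 -expr2 => <-; congr (_ * _); apply: eq_bigr => I _.
by rewrite -natrM mulnb.
Qed.

End index_average.

Section distinct_indices.
Variables (k n : nat).
Implicit Types I J : {ffun 'I_k -> 'I_n}.

(** Only an earlier occurrence counts, so the first occurrence of each index is kept and just the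
    later ones are moved. *)
Definition repeated I (j : 'I_k) : bool := [exists i : 'I_k, (i < j)%N && (I i == I j)].

(* The fresh index depends injectively on the pair (I, j), so that the indices of
   two different tuples only meet where the tuples themselves agree. *)
Definition distinct_indices I (j : 'I_k) : nat :=
  if repeated I j then (n + (enum_rank I * k + j))%N else I j.

Lemma distinct_indices_eq I J a b : distinct_indices I a = distinct_indices J b ->
  I a = J b /\ (repeated I a -> I = J /\ a = b).
Proof.
rewrite /distinct_indices; case: ifPn => ra; case: ifPn => rb.
- move=> /addnI E.
  have k0 : (0 < k)%N by case: (k) a {ra E} => [[]//|].
  have rE : (enum_rank I : nat) = enum_rank J.
    by have := congr1 (divn^~ k) E; rewrite !divnMDl// !divn_small// !addn0.
  have aE : a = b.
    by apply: val_inj; move: E; rewrite rE => /addnI.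
  have IJ : I = J by apply/enum_rank_inj/val_inj.
  by rewrite IJ aE.
- by move=> E; have := ltn_ord (J b); rewrite -E ltnNge leq_addr.
- by move=> E; have := ltn_ord (I a); rewrite E ltnNge leq_addr.
- by move=> /val_inj.
Qed.

Lemma distinct_indices_inj I : injective (distinct_indices I).
Proof.
move=> a b E; have [Iab ra] := distinct_indices_eq E.
have [_ rb] := distinct_indices_eq (esym E).
case: (ltngtP a b) => ab; last exact: val_inj.
- have /rb[_ //] : repeated I b by apply/existsP; exists a; rewrite ab Iab eqxx.
- have /ra[_ //] : repeated I a by apply/existsP; exists b; rewrite ab Iab eqxx.
Qed.

Lemma changed_distinct_indices I :
  (#|changed (fun j => I j : nat) (distinct_indices I)| <= \sum_j \sum_(i | i != j) (I i == I j))%N.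
Proof.
rewrite -sum1_card [leqRHS](bigID (mem (changed (fun j => I j : nat) (distinct_indices I))))/=.
apply: leq_trans (leq_addr _ _); apply: leq_sum => j.
rewrite unfold_in /changed /distinct_indices; case: ifPn; last by rewrite eqxx.
move=> /existsP[i /andP[ij Iij]] _; rewrite (bigD1 i) ?Iij//.
by apply: contraTneq ij => ->; rewrite ltnn.
Qed.

Lemma shared_pairs_distinct I J :
  (shared_pairs (distinct_indices I) (distinct_indices J) <=
   \sum_(p : ('I_k * 'I_k) * ('I_k * 'I_k) | (p.1.1 != p.1.2) && (p.2.1 != p.2.2))
    ((I p.1.1 == J p.2.1) && (I p.1.2 == J p.2.2)))%N.
Proof.
apply: leq_sum => p _; case: andP => // -[/eqP E1 /eqP E2].
have [-> _] := distinct_indices_eq E1; have [-> _] := distinct_indices_eq E2.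
by rewrite !eqxx.
Qed.

End distinct_indices.

(** * Averages of a degenerate kernel over all index tuples *)

Section degenerate_average.
Context (R : realType) dXi (Xi : measurableType dXi) (F : probability Xi R)
  dO (Omega : measurableType dO) (P : probability Omega R)
  (xi : nat -> {RV P >-> Xi}) (xi_iid : iid_from F xi).
Variables (k' : nat).
Local Notation k := k'.+1.
Variables (K : k.-tuple Xi -> R) (Delta : Xi * Xi -> R) (C : R).
Hypothesis mK : measurable_fun setT K.
Hypothesis symK : forall (sigma : {perm 'I_k}) z, K [tuple tnth z (sigma i) | i < k] = K z.
Hypothesis K2 : forall s : 'I_k -> nat, L1 P (fun w => K (sample xi s w) ^+ 2).
Hypothesis degK : forall A, measurable A ->
  \int[P]_w (\1_A (xi 0%N w) * K (sample xi (@nat_of_ord k) w)) = 0.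
Hypothesis mDelta : measurable_fun setT Delta.
Hypothesis L1_Delta : forall i j, i != j -> L1 P (fun w => Delta (xi i w, xi j w) ^+ 2).
Hypothesis Delta2 : forall i j, i != j -> \int[P]_w (Delta (xi i w, xi j w) ^+ 2) <= C.
Hypothesis lipK : forall (b : pred 'I_k) z z',
  (forall j, ~~ b j -> tnth z j = tnth z' j) ->
  `|K z - K z'| <= k%:R^-1 * \sum_(j < k | b j) Delta (tnth z j, tnth z' j).
Variable n : nat.
Hypothesis n_gt0 : (0 < n)%N.

Let nR_gt0 : 0 < n%:R :> R. Proof. by rewrite ltr0n. Qed.
Let kR_gt0 : 0 < k%:R :> R. Proof. by rewrite ltr0n. Qed.

Let mKs (s : 'I_k -> nat) : measurable_fun setT (fun w => K (sample xi s w)).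
Proof. by apply: (measurableT_comp mK); exact: measurable_sample. Qed.

Let L1K s : L1 P (fun w => K (sample xi s w)).
Proof. exact: L1_sqr. Qed.

Let L1KK s t : L1 P (fun w => K (sample xi s w) * K (sample xi t w)).
Proof. exact: L1_sqr_mul. Qed.

Let C0 : 0 <= C.
Proof. by apply: le_trans (Delta2 (isT : 0%N != 1%N)); apply: Rintegral_ge0 => w _; exact: sqr_ge0. Qed.

Let L1_avg (f : {ffun 'I_k -> 'I_n} -> Omega -> R) : (forall I, L1 P (f I)) ->
  L1 P (fun w => index_avg (f ^~ w)).
Proof. by move=> If; apply: L1Z; apply: L1_sum => I _ _; exact: If. Qed.

Let integral_avg (f : {ffun 'I_k -> 'I_n} -> Omega -> R) : (forall I, L1 P (f I)) ->
  \int[P]_w index_avg (f ^~ w) = index_avg (fun I => \int[P]_w f I w).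
Proof.
move=> If; rewrite /index_avg RintegralZl//; last by apply: L1_sum => I _ _; exact: If.
by rewrite Rintegral_sum// => I _ _; exact: If.
Qed.

(** A given ordered pair of positions collides with frequency 1/n, so fewer than k^2/n positions
    change on average, each at a cost (1 + C)/k. *)
Let fresh_replacement :
  \int[P]_w `|index_avg (fun I : {ffun 'I_k -> 'I_n} =>
     K (sample xi (fun j => I j : nat) w) - K (sample xi (distinct_indices I) w))|
  <= (1 + C) * (k%:R / n%:R).
Proof.
have IL (I : {ffun 'I_k -> 'I_n}) : L1 P (fun w => K (sample xi (fun j => I j : nat) w) - K (sample xi (distinct_indices I) w)).
  exact: L1B.
apply: (@le_trans _ _ (\int[P]_w index_avg (fun I : {ffun 'I_k -> 'I_n} =>
     `|K (sample xi (fun j => I j : nat) w) - K (sample xi (distinct_indices I) w)|))).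
  apply: le_RintegralT; [by apply: L1_norm; exact: L1_avg|by apply: L1_avg => I; exact: L1_norm|].
  move=> w; rewrite /index_avg normrM ger0_norm ?invr_ge0 ?exprn_ge0//.
  by rewrite ler_wpM2l ?invr_ge0 ?exprn_ge0// ler_norm_sum.
rewrite integral_avg; last by move=> I; exact: L1_norm.
apply: (@le_trans _ _ (index_avg (fun I : {ffun 'I_k -> 'I_n} =>
    k%:R^-1 * (1 + C) * \sum_j \sum_(i | i != j) (I i == I j)%:R))).
  apply: ler_index_avg => // I; apply: le_trans.
    exact: (abs_change mK K2 mDelta L1_Delta Delta2 lipK).
  rewrite -mulrA ler_wpM2l ?invr_ge0// mulrC ler_wpM2l ?addr_ge0//.
  apply: (@le_trans _ _ (\sum_j \sum_(i | i != j) (I i == I j))%N%:R).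
    by rewrite ler_nat; exact: changed_distinct_indices.
  by rewrite natr_sum; apply: ler_sum => j _; rewrite natr_sum.
rewrite index_avgZ index_avg_sum.
apply: (@le_trans _ _ (k%:R^-1 * (1 + C) * \sum_(j < k) \sum_(i < k) n%:R^-1)).
  rewrite ler_wpM2l ?mulr_ge0 ?invr_ge0 ?addr_ge0//.
  apply: ler_sum => j _; rewrite index_avg_sum.
  rewrite [leRHS](bigID (fun i => i != j))/= -[leLHS]addr0 lerD//.
    by apply: ler_sum => i ij; rewrite index_avg_collision.
  by apply: sumr_ge0 => i _; rewrite invr_ge0.
rewrite !sumr_const !card_ord -[_ *+ k *+ k]mulr_natl -[_ *+ k]mulr_natl.
by rewrite le_eqVlt; apply/orP; left; apply/eqP; field; rewrite !gt_eqF.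
Qed.

(** For fixed [I], a given pair of positions of [J] matches a given pair of positions of [I] with
    frequency n^-2. At most k^4 such choices, times the covariance factor C k^-2, give C (k/n)^2. *)
Let distinct_second_moment :
  \int[P]_w (index_avg (fun I : {ffun 'I_k -> 'I_n} => K (sample xi (distinct_indices I) w)) ^+ 2)
  <= C * (k%:R / n%:R) ^+ 2.
Proof.
pose f (I J : {ffun 'I_k -> 'I_n}) w :=
  K (sample xi (distinct_indices I) w) * K (sample xi (distinct_indices J) w).
have If I J : L1 P (f I J) by exact: L1KK.
rewrite (_ : \int[P]_w _ = \int[P]_w index_avg (fun I => index_avg (fun J => f I J w))); last first.
  apply: eq_Rintegral => w _; rewrite expr2 /index_avg -mulrA; congr (_ * _).
  rewrite mulrCA mulr_suml mulr_sumr; apply: eq_bigr => I _.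
  by rewrite -mulr_sumr mulrCA.
rewrite (integral_avg (f := fun I w => index_avg (fun J => f I J w))); last first.
  by move=> I; exact: L1_avg.
pose Q := \sum_(p : ('I_k * 'I_k) * ('I_k * 'I_k) | (p.1.1 != p.1.2) && (p.2.1 != p.2.2))
  n%:R^-1 ^+ 2 : R.
have Q_le : Q <= (k ^ 4)%:R * n%:R^-1 ^+ 2.
  apply: (@le_trans _ _ (\sum_(p : ('I_k * 'I_k) * ('I_k * 'I_k)) n%:R^-1 ^+ 2)).
    rewrite [leRHS](bigID (fun p => (p.1.1 != p.1.2) && (p.2.1 != p.2.2)))/=.
    by rewrite -[leLHS]addr0 lerD// sumr_ge0// => p _; rewrite exprn_ge0.
  by rewrite sumr_const !card_prod !card_ord mulr_natl !mulnn -expnM.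
apply: (@le_trans _ _ (k%:R^-1 ^+ 2 * C * Q)).
  apply: (@le_trans _ _ (index_avg (fun I => index_avg (fun J =>
     k%:R^-1 ^+ 2 * C * \sum_(p : ('I_k * 'I_k) * ('I_k * 'I_k) |
       (p.1.1 != p.1.2) && (p.2.1 != p.2.2))
       ((J p.2.1 == I p.1.1) && (J p.2.2 == I p.1.2))%:R)))).
    apply: ler_index_avg => // I; rewrite (integral_avg (If I)); apply: ler_index_avg => // J.
    rewrite /f; have CB := covariance_bound xi_iid mK symK K2 degK L1_Delta Delta2 lipK
        (@distinct_indices_inj _ _ I) (@distinct_indices_inj _ _ J).
    apply: (le_trans CB).
    rewrite ler_wpM2l ?mulr_ge0 ?exprn_ge0 ?invr_ge0//.
    have SP := shared_pairs_distinct I J; rewrite -(ler_nat R) in SP.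
    apply: (le_trans SP).
    rewrite natr_sum; apply: ler_sum => p _.
    by rewrite eq_sym (eq_sym (I p.1.2)).
  under eq_fun => I do rewrite index_avgZ.
  rewrite -[leRHS](index_avg_cst k n_gt0); apply: ler_index_avg => // I.
  rewrite ler_wpM2l ?mulr_ge0 ?exprn_ge0 ?invr_ge0// index_avg_sum.
  by apply: ler_sum => p /andP[_ pp]; rewrite index_avg_match.
apply: (@le_trans _ _ (k%:R^-1 ^+ 2 * C * ((k ^ 4)%:R * n%:R^-1 ^+ 2))).
  by rewrite ler_wpM2l ?mulr_ge0 ?exprn_ge0 ?invr_ge0.
rewrite natrX le_eqVlt; apply/orP; left; apply/eqP.
by field; rewrite !gt_eqF.
Qed.

Lemma degenerate_average_bound :
  \int[P]_w `|index_avg (fun I : {ffun 'I_k -> 'I_n} => K (sample xi (fun j => I j : nat) w))|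
  <= 2 * (1 + C) * (k%:R / n%:R).
Proof.
set t := k%:R / n%:R; have t0 : 0 < t by rewrite divr_gt0.
pose A w := index_avg (fun I : {ffun 'I_k -> 'I_n} => K (sample xi (fun j => I j : nat) w)).
pose B w := index_avg (fun I : {ffun 'I_k -> 'I_n} => K (sample xi (distinct_indices I) w)).
have IA : L1 P A by apply: L1_avg => I; exact: L1K.
have IB : L1 P B by apply: L1_avg => I; exact: L1K.
have mB := L1_measurable IB.
have IB2 : L1 P (fun w => B w ^+ 2).
  apply: (@L1_eq _ _ _ _ (fun w => (n%:R ^+ k)^-1 ^+ 2 *
    (\sum_(I <- index_enum {ffun 'I_k -> 'I_n}) K (sample xi (distinct_indices I) w)) ^+ 2)).
    by move=> w; rewrite -exprMn.
  by apply: L1Z; apply: L1_sqr_sum.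
have ABE w : A w - B w = index_avg (fun I : {ffun 'I_k -> 'I_n} =>
     K (sample xi (fun j => I j : nat) w) - K (sample xi (distinct_indices I) w)).
  by rewrite /A /B /index_avg -mulrBr -sumrB.
have E1 : \int[P]_w `|A w - B w| <= (1 + C) * t.
  by under eq_Rintegral do rewrite ABE; exact: fresh_replacement.
(* [|B| <= (t + B^2 / t) / 2], with t of the order of the root mean square of [B], plays the role of
   the Cauchy-Schwarz inequality. *)
have IAM : L1 P (fun w => 2^-1 * (t + t^-1 * B w ^+ 2)).
  by apply: L1Z; apply: L1D; [exact: L1_cst|exact: L1Z].
apply: (@le_trans _ _ (\int[P]_w (`|A w - B w| + 2^-1 * (t + t^-1 * B w ^+ 2)))).
  apply: le_RintegralT; first exact: L1_norm.
    by apply: L1D => //; apply: L1_norm; exact: L1B.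
  move=> w; rewrite -/(A w) -[X in `|X|](subrK (B w)).
  apply: le_trans (ler_normD _ _) _; rewrite lerD2l.
  have : 0 <= t^-1 * (`|B w| - t) ^+ 2 by rewrite mulr_ge0 ?sqr_ge0// invr_ge0 ltW.
  rewrite sqrrB real_normK ?num_real//.
  have -> : t^-1 * (B w ^+ 2 - `|B w| * t *+ 2 + t ^+ 2) = t^-1 * B w ^+ 2 - 2 * `|B w| + t.
    by field; rewrite gt_eqF.
  by lra.
rewrite RintegralD//; last by apply: L1_norm; exact: L1B.
rewrite RintegralZl//; last by apply: L1D; [exact: L1_cst|exact: L1Z].
rewrite RintegralD//; [|exact: L1_cst|exact: L1Z].
rewrite Rintegral_pcst RintegralZl//.
have E2 : t^-1 * \int[P]_w (B w ^+ 2) <= C * t.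
  apply: le_trans (ler_wpM2l _ distinct_second_moment) _; first by rewrite invr_ge0 ltW.
  by rewrite -/t le_eqVlt; apply/orP; left; apply/eqP; field; rewrite gt_eqF.
have Ct : 0 <= C * t by rewrite mulr_ge0// ltW.
have := t0; move: E1 E2 Ct; rewrite mulrDl mul1r.
set x := \int[P]_w _; set y := t^-1 * _; set c := C * t => *.
have -> : 2 * (1 + C) * t = 2 * t + 2 * c by rewrite /c; ring.
lra.
Qed.

End degenerate_average.

(** * The remainder of the Hajek projection *)

Section hajek.
Context (R : realType) dXi (Xi : measurableType dXi) (F : probability Xi R)
  dO (Omega : measurableType dO) (P : probability Omega R)
  (xi : nat -> {RV P >-> Xi}) (xi_iid : iid_from F xi).
Variables (k' : nat) (H : k'.+1.-tuple Xi -> R).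
Variables (M : Xi -> R) (D : Xi * Xi -> R) (g : Xi -> R).
Local Notation k := k'.+1.
Hypothesis mH : measurable_fun setT H.
Hypothesis symH : forall (sigma : {perm 'I_k}) z, H [tuple tnth z (sigma i) | i < k] = H z.
Hypothesis mM : measurable_fun setT M.
Hypothesis M2 : L1 F (fun z => M z ^+ 2).
Hypothesis HM : forall z, `|H z| <= k%:R^-1 * \sum_(j < k) M (tnth z j).
Hypothesis mD : measurable_fun setT D.
Hypothesis D0 : forall p, 0 <= D p.
Hypothesis D2 : L1 (F \x F)%E (fun p => D p ^+ 2).
Hypothesis HD : forall (b : pred 'I_k) z z',
  (forall j, ~~ b j -> tnth z j = tnth z' j) ->
  `|H z - H z'| <= k%:R^-1 * \sum_(j < k | b j) D (tnth z j, tnth z' j).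
Hypothesis g_cond : cond_expectation_given (xi 0%N)
  (fun w => H (sample xi (@nat_of_ord k) w)) g.

Local Notation W := (mean_value xi H).
Local Notation G := (centered_g xi H g).

Let kR_gt0 : 0 < k%:R :> R. Proof. by rewrite ltr0n. Qed.

Let mG : measurable_fun setT G.
Proof. exact: measurable_G g_cond. Qed.

Let IG : L1 F G.
Proof. exact: (L1_G xi_iid g_cond). Qed.

Let meanG : \int[F]_z G z = 0.
Proof. exact: (mean_G xi_iid g_cond). Qed.

Lemma second_moment_G : L1 F (fun z => (k%:R * G z) ^+ 2) /\
  \int[F]_z ((k%:R * G z) ^+ 2) <= \int[F]_x \int[F]_y (D (x, y) ^+ 2).
Proof.
have sq (x : R) : `|x| `^ 2 = x ^+ 2 by rewrite powR_mulrn// real_normK// num_real.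
have sqD p : D p `^ 2 = D p ^+ 2 by rewrite powR_mulrn.
have D2' : L1 (F \x F)%E (fun p => D p `^ 2) by apply: L1_eq D2 => p.
have [I1 I2] := moment_G xi_iid mH mM M2 HM mD D0 D2 HD g_cond (ltr1n _ 2) D2'.
split; first by apply: L1_eq I1 => z; rewrite sq.
move: I2; under eq_Rintegral do rewrite sq.
by under [leRHS]eq_Rintegral do under eq_Rintegral do rewrite sqD.
Qed.

Lemma L1_sqr_G : L1 F (fun z => G z ^+ 2).
Proof.
have [I1 _] := second_moment_G; apply: L1_eq (L1Z (k%:R^-1 ^+ 2) I1) => z.
by rewrite -exprMn mulKf// gt_eqF.
Qed.

Definition residual (z : k.-tuple Xi) : R := H z - W - \sum_(j < k) G (tnth z j).

(** Changing one argument moves [H] by at most D/k and the projection by a difference of two values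
    of [G]. The factor k puts the latter on the same scale 1/k. *)
Definition exchange_cost (p : Xi * Xi) : R := D p + `|k%:R * G p.1| + `|k%:R * G p.2|.

Let mres : measurable_fun setT residual.
Proof.
apply: measurable_funB; first exact: measurable_funB.
by apply: measurable_sum => j; apply: (measurableT_comp mG); exact: measurable_tnth.
Qed.

Let symres (sigma : {perm 'I_k}) z : residual [tuple tnth z (sigma i) | i < k] = residual z.
Proof.
rewrite /residual symH; congr (_ - _).
rewrite [RHS](reindex_perm sigma); apply: eq_bigr => j _.
by rewrite tnth_mktuple.
Qed.

Let res2 (s : 'I_k -> nat) : L1 P (fun w => residual (sample xi s w) ^+ 2).
Proof.
apply: (@L1_eq _ _ _ _ (fun w => (H (sample xi s w) +
   (- W + (-1) * \sum_(j <- index_enum 'I_k) G (xi (s j) w))) ^+ 2)).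
  move=> w; rewrite /residual mulN1r addrA; congr ((_ - _) ^+ 2).
  by apply: eq_bigr => j _; rewrite tnth_mktuple.
have mGs j : measurable_fun setT (fun w => G (xi (s j) w)) by exact: measurableT_comp.
apply: L1_sqrD.
- by apply: (measurableT_comp mH); exact: measurable_sample.
- apply: measurable_funD => //; apply: measurable_funM => //.
  exact: measurable_sum.
- exact: (L1_sqr_value xi_iid mH mM M2 HM).
apply: L1_sqrD => //.
- by apply: measurable_funM => //; exact: measurable_sum.
- exact: L1_cst.
apply: (@L1_eq _ _ _ _ (fun w => (\sum_(j <- index_enum 'I_k) G (xi (s j) w)) ^+ 2)).
  by move=> w; rewrite exprMn sqrrN expr1n mul1r.
apply: (@L1_sqr_sum _ _ _ _ _ (index_enum 'I_k) (fun j w => G (xi (s j) w))) => // j.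
by apply/(@iid_L1 _ _ _ _ _ _ _ _ xi_iid (fun z => G z ^+ 2) (s j)) ; [exact: measurable_funX|exact: L1_sqr_G].
Qed.

(** Given the first observation, the terms [G] of the other observations have mean 0, and its own
    term cancels the conditional mean of [H - W] by the choice of [g]. *)
Let res_deg A : measurable A ->
  \int[P]_w (\1_A (xi 0%N w) * residual (sample xi (@nat_of_ord k) w)) = 0.
Proof.
move=> mA; have mI : measurable_fun setT (\1_A : Xi -> R) by [].
have IA := (iid_L1 xi_iid 0%N mI).1 (integrable_indic _ mA).
have IHn := L1_value xi_iid mH mM M2 HM (@nat_of_ord k).
have IGi i : L1 P (fun w => G (xi i w)) by apply/(iid_L1 xi_iid i mG).
have mg : measurable_fun setT g by case: g_cond.
have Ig : L1 P (fun w => g (xi 0%N w)) by apply/(iid_L1 xi_iid 0%N mg); exact: (L1_g xi_iid g_cond).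
have I1 := L1_ind (xi 0%N) mA IHn.
have I2 := L1_ind (xi 0%N) mA Ig.
have cross (j : nat) : j != 0%N -> L1 P (fun w => \1_A (xi 0%N w) * G (xi j w)) /\
    \int[P]_w (\1_A (xi 0%N w) * G (xi j w)) = 0.
  move=> j0; have i0j : independent_pair P (xi 0%N) (xi j).
    by apply: (pair_independent xi_iid); rewrite eq_sym.
  have [I E] := independent_mul i0j mI mG IA (IGi j); split => //.
  by rewrite E (iid_integral xi_iid j IG) meanG mulr0.
have IS : L1 P (fun w => \sum_(j < k | j != ord0) \1_A (xi 0%N w) * G (xi j w)).
  by apply: L1_sum => j _ j0; have [] := cross j j0.
transitivity (\int[P]_w (\1_A (xi 0%N w) * H (sample xi (@nat_of_ord k) w)
   - \1_A (xi 0%N w) * g (xi 0%N w) - \sum_(j < k | j != ord0) \1_A (xi 0%N w) * G (xi j w))).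
  apply: eq_Rintegral => w _; rewrite /residual -mulr_sumr.
  rewrite (bigD1 ord0)//= tnth_mktuple /centered_g.
  rewrite (eq_bigr (fun j : 'I_k => g (xi j w) - W)); last by move=> j _; rewrite tnth_mktuple.
  by ring.
rewrite RintegralB//; last exact: L1B.
rewrite RintegralB// (cond_integral g_cond mA) subrr sub0r.
rewrite Rintegral_sum; last by move=> j _ j0; have [] := cross j j0.
by rewrite big1 ?oppr0// => j j0; have [] := cross j j0.
Qed.

Let mcost : measurable_fun setT exchange_cost.
Proof.
apply: measurable_funD; [apply: measurable_funD => //|];
  by apply: measurableT_comp => //; apply: measurable_funM => //; exact: measurableT_comp.
Qed.

(** The constant 9 is 3 times 3: [(a + b + c)^2 <= 3 (a^2 + b^2 + c^2)], and each of the three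
    second moments is at most that of [D]. *)
Let cost2 i j : i != j ->
  L1 P (fun w => exchange_cost (xi i w, xi j w) ^+ 2) /\
  \int[P]_w (exchange_cost (xi i w, xi j w) ^+ 2)
  <= 9 * \int[F]_x \int[F]_y (D (x, y) ^+ 2).
Proof.
move=> ij; have [I1 E1] := second_moment_G.
have ID := iid_pair_L1 xi_iid ij D2.
have ED := iid_pair_integral xi_iid ij D2.
have mkG : measurable_fun setT (fun z => (k%:R * G z) ^+ 2).
  by apply: measurable_funX; exact: measurable_funM.
have Ii l : L1 P (fun w => (k%:R * G (xi l w)) ^+ 2).
  by apply/(iid_L1 xi_iid l mkG).
have Ei l : \int[P]_w ((k%:R * G (xi l w)) ^+ 2) = \int[F]_z ((k%:R * G z) ^+ 2).
  exact: (iid_integral xi_iid l I1).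
have IB : L1 P (fun w => 3 * (D (xi i w, xi j w) ^+ 2 + (k%:R * G (xi i w)) ^+ 2
    + (k%:R * G (xi j w)) ^+ 2)).
  by apply: L1Z; apply: L1D => //; exact: L1D.
have B w : exchange_cost (xi i w, xi j w) ^+ 2 <=
    3 * (D (xi i w, xi j w) ^+ 2 + (k%:R * G (xi i w)) ^+ 2 + (k%:R * G (xi j w)) ^+ 2).
  rewrite /exchange_cost /= -[(k%:R * G (xi i w)) ^+ 2]real_normK ?num_real//.
  rewrite -[(k%:R * G (xi j w)) ^+ 2]real_normK ?num_real//.
  set a := D _; set b := `|_|; set c := `|_|.
  have := sqr_ge0 (a - b); have := sqr_ge0 (a - c); have := sqr_ge0 (b - c); lra.
have IC : L1 P (fun w => exchange_cost (xi i w, xi j w) ^+ 2).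
  apply: L1_le IB.
    by apply: measurable_funX; apply: (measurableT_comp mcost); exact: measurable_fun_pair.
  by move=> w; rewrite ger0_norm ?sqr_ge0.
split => //; apply: le_trans (le_RintegralT IC IB B) _.
rewrite RintegralZl//; last by apply: L1D => //; exact: L1D.
rewrite RintegralD//; last exact: L1D.
rewrite RintegralD// !Ei ED.
move: E1; set x := \int[F]_z _; set y := \int[F]_x _; lra.
Qed.

Let lipres (b : pred 'I_k) z z' : (forall j, ~~ b j -> tnth z j = tnth z' j) ->
  `|residual z - residual z'| <=
  k%:R^-1 * \sum_(j < k | b j) exchange_cost (tnth z j, tnth z' j).
Proof.
move=> zz'; rewrite (_ : residual z - residual z' = (H z - H z') -
   \sum_(j < k | b j) (G (tnth z j) - G (tnth z' j))); last first.
  have -> : \sum_(j < k | b j) (G (tnth z j) - G (tnth z' j)) =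
      \sum_(j < k) (G (tnth z j) - G (tnth z' j)).
    rewrite [RHS](bigID b)/= [X in _ + X]big1 ?addr0// => j nb.
    by rewrite zz'// subrr.
  by rewrite sumrB /residual; ring.
apply: le_trans (ler_normB _ _) _.
apply: le_trans (lerD (HD zz') (ler_norm_sum _ _ _)) _.
rewrite -[X in _ + X](mulKf (lt0r_neq0 kR_gt0)) -mulrDr ler_wpM2l ?invr_ge0//.
rewrite mulr_sumr -big_split/=; apply: ler_sum => j _.
rewrite /exchange_cost /= -[leRHS]addrA lerD2l !normrM ger0_norm// -mulrDr.
by rewrite ler_wpM2l// ler_normB.
Qed.

Variable n : nat.
Hypothesis n_gt0 : (0 < n)%N.

(** Each position of a uniform tuple is uniform on the data, so averaging the sum of [G] over the k
    positions yields k/n times the sum over the data. The average of the residual kernel is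
    therefore the remainder of the projection. *)
Lemma hajek_bound :
  \int[P]_w `|index_avg (fun I : {ffun 'I_k -> 'I_n} => H (sample xi (fun j => I j : nat) w))
     - W - k%:R / n%:R * \sum_(i < n) G (xi i w)|
  <= 2 * (1 + 9 * \int[F]_x \int[F]_y (D (x, y) ^+ 2)) * (k%:R / n%:R).
Proof.
have := @degenerate_average_bound _ _ _ _ _ _ _ _ xi_iid _ _ _ _ mres symres res2 res_deg
  mcost (fun i j ij => (cost2 ij).1) (fun i j ij => (cost2 ij).2) lipres n n_gt0.
apply: le_trans; rewrite le_eqVlt; apply/orP; left; apply/eqP.
apply: eq_Rintegral => w _; congr `|_|.
have nR : n%:R != 0 :> R by rewrite pnatr_eq0 -lt0n.
transitivity (index_avg (fun I : {ffun 'I_k -> 'I_n} => H (sample xi (fun j => I j : nat) w))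
  - index_avg (fun _ : {ffun 'I_k -> 'I_n} => W)
  - index_avg (fun I : {ffun 'I_k -> 'I_n} => \sum_(j < k) G (xi (I j) w))).
  rewrite index_avg_cst// index_avg_sum; congr (_ - _).
  under [RHS]eq_bigr => j _ do rewrite (index_avg1 n_gt0 j (fun x => G (xi x w))).
  by rewrite sumr_const card_ord -[RHS]mulr_natl mulrA.
rewrite /index_avg -!mulrBr -!sumrB; congr (_ * _); apply: eq_bigr => I _.
by rewrite /residual; congr (_ - _); apply: eq_bigr => j _; rewrite tnth_mktuple.
Qed.

End hajek.

(** * Sums of i.i.d. variables *)

Section iid_sums.
Context (R : realType) dXi (Xi : measurableType dXi) (F : probability Xi R)
  dO (Omega : measurableType dO) (P : probability Omega R)
  (xi : nat -> {RV P >-> Xi}) (xi_iid : iid_from F xi).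
Variable Y : Xi -> R.
Hypothesis mY : measurable_fun setT Y.
Hypothesis Y2 : L1 F (fun z => Y z ^+ 2).
Hypothesis EY : \int[F]_z Y z = 0.

Definition iid_sum (m : nat) (w : Omega) : R := \sum_(i < m) Y (xi i w).

Lemma measurable_iid_sum m : measurable_fun setT (iid_sum m).
Proof. by apply: measurable_sum => i; exact: measurableT_comp. Qed.

Let mYi i : measurable_fun setT (fun w => Y (xi i w)).
Proof. exact: measurableT_comp. Qed.

Let IY2 i : L1 P (fun w => Y (xi i w) ^+ 2).
Proof. by apply/(iid_L1 xi_iid (f := fun z => Y z ^+ 2)) => //; exact: measurable_funX. Qed.

Let IYF : L1 F Y. Proof. exact: L1_sqr. Qed.

Let IY i : L1 P (fun w => Y (xi i w)).
Proof. exact: L1_sqr. Qed.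

Lemma L1_iid_sum m : L1 P (iid_sum m).
Proof. by apply: L1_sum => i _ _; exact: IY. Qed.

Lemma L1_iid_sum_sqr m : L1 P (fun w => iid_sum m w ^+ 2).
Proof. exact: (@L1_sqr_sum _ _ _ _ _ (index_enum 'I_m) (fun i w => Y (xi i w))). Qed.

Lemma mean_iid_sum m : \int[P]_w iid_sum m w = 0.
Proof.
rewrite Rintegral_sum; last by move=> i _ _; exact: IY.
by rewrite big1// => i _; rewrite (iid_integral xi_iid _ IYF).
Qed.

Lemma variance_iid_sum m : \int[P]_w (iid_sum m w ^+ 2) = m%:R * \int[F]_z (Y z ^+ 2).
Proof.
have I2 (i j : 'I_m) : L1 P (fun w => Y (xi i w) * Y (xi j w)) by exact: L1_sqr_mul.
transitivity (\int[P]_w \sum_(i < m) \sum_(j < m) Y (xi i w) * Y (xi j w)).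
  apply: eq_Rintegral => w _; rewrite expr2 /iid_sum mulr_suml.
  by apply: eq_bigr => i _; rewrite mulr_sumr.
rewrite Rintegral_sum; last by move=> i _ _; apply: L1_sum => j _ _; exact: I2.
rewrite (eq_bigr (fun=> \int[F]_z (Y z ^+ 2))).
  by rewrite sumr_const card_ord mulr_natl.
move=> i _; rewrite Rintegral_sum; last by move=> j _ _; exact: I2.
rewrite (bigD1 i)//= big1 ?addr0; last first.
  move=> j ji; have ij : independent_pair P (xi i) (xi j).
    by apply: (pair_independent xi_iid); rewrite eq_sym.
  have [_ ->] := independent_mul ij mY mY (IY i) (IY j).
  by rewrite (iid_integral xi_iid _ IYF) EY mul0r.
by rewrite -(iid_integral xi_iid i Y2); apply: eq_Rintegral => w _; rewrite expr2.
Qed.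

(** The form in which independence enters the replacement argument: the newest datum is integrated
    out against its law, the earlier ones being fixed. *)
Lemma iid_sum_step (f : R -> R) (C : R) : measurable_fun setT f ->
  (forall x, `|f x| <= C) -> forall m x a,
  \int[P]_w f (x + a * iid_sum m.+1 w) =
  \int[P]_w \int[F]_z f (x + a * iid_sum m w + a * Y z).
Proof.
move=> mf fC m x a; have [_ law] := xi_iid.
pose s : m.-tuple Xi -> R := fun z => \sum_(i < m) Y (tnth z i).
have ms : measurable_fun setT s.
  by apply: measurable_sum => i; apply: (measurableT_comp mY); exact: measurable_tnth.
pose h (p : m.-tuple Xi * Xi) := f (x + a * s p.1 + a * Y p.2).
have mh : measurable_fun setT h.
  apply: (measurableT_comp mf); apply: measurable_funD.
    apply: measurable_funD => //; apply: measurable_funM => //.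
    exact: (measurableT_comp ms).
  by apply: measurable_funM => //; exact: (measurableT_comp mY).
have sE w : s (sample xi (@nat_of_ord m) w) = iid_sum m w.
  by apply: eq_bigr => i _; rewrite tnth_mktuple.
have ind : independent_pair P (sample xi (@nat_of_ord m)) (xi m).
  move=> A B mA mB; rewrite setIC muleC.
  apply: (one_sample_independent xi_iid) => // j.
  by rewrite neq_ltn ltn_ord orbT.
have Ih : L1 P (fun w => h (sample xi (@nat_of_ord m) w, xi m w)).
  apply: (@L1_bounded _ _ _ _ C); last by move=> w; exact: fC.
  by apply: (measurableT_comp mh); exact: measurable_fun_pair.
transitivity (\int[P]_w h (sample xi (@nat_of_ord m) w, xi m w)).
  apply: eq_Rintegral => w _; rewrite /h /= sE /iid_sum big_ord_recr/=.
  by rewrite mulrDr addrA.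
rewrite (independent_integral ind mh Ih).
have Ih' := L1_fubini1 ((independent_L1 ind mh).1 Ih).
rewrite Rintegral_distribution; last 2 first.
- exact: L1_measurable Ih'.
- exact: distribution_L1 Ih'.
apply: eq_Rintegral => w _; rewrite (@eq_measure_Rintegral _ _ _ _ F).
  by apply: eq_Rintegral => z _; rewrite /h /= sE.
by move=> A mA; exact: law.
Qed.

Lemma iid_lindeberg (n : nat) C f f1 f2 (eta q : R) : taylor_class C f f1 f2 ->
  \int[F]_z (Y z ^+ 2) = 1 ->
  (0 < n)%N -> 0 < eta -> 0 <= q -> L1 F (fun z => `|Y z| `^ (2 + q)) ->
  `|\int[P]_w f ((Num.sqrt n%:R)^-1 * iid_sum n w) - \int[normal_prob (0 : R) 1]_y f y| <=
  C * (2 * eta + eta `^ (- q) * (n%:R * (Num.sqrt n%:R)^-1 `^ (2 + q)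
                      * \int[F]_z (`|Y z| `^ (2 + q)))
       + eta `^ (- 2) * n%:R^-1 * \int[normal_prob (0 : R) 1]_y (y ^+ 4)).
Proof.
move=> tf EY2; apply: lindeberg_bound tf => //.
- exact: measurable_iid_sum.
- by move=> w; rewrite /iid_sum big_ord0.
- exact: iid_sum_step.
Qed.

End iid_sums.

(** * Sample average approximation *)

Section inf_image.
Context (R : realType) (T : Type) (T0 : [set: T] !=set0).
Implicit Types u v : T -> R.

Lemma norm_inf_image u B : (forall x, `|u x| <= B) -> `|inf [set u x | x in setT]| <= B.
Proof.
move=> uB; have [x0 _] := T0; rewrite ler_norml; apply/andP; split.
  apply: lb_le_inf; first by exists (u x0), x0.
  by move=> _ [x _ <-]; have := uB x; rewrite ler_norml => /andP[].
apply: le_trans (_ : u x0 <= B); last exact: le_trans (ler_norm _) (uB x0).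
apply: ge_inf; last by exists x0.
by exists (- B) => _ [x _ <-]; have := uB x; rewrite ler_norml => /andP[].
Qed.

Lemma le_inf_image u v B e : (forall x, `|u x| <= B) -> (forall x, u x <= v x + e) ->
  inf [set u x | x in setT] <= inf [set v x | x in setT] + e.
Proof.
move=> uB uv; have [x0 _] := T0; rewrite -lerBlDr; apply: lb_le_inf.
  by exists (v x0), x0.
move=> _ [x _ <-]; rewrite lerBlDr; apply: le_trans (uv x); apply: ge_inf; last by exists x.
by exists (- B) => _ [y _ <-]; have := uB y; rewrite ler_norml => /andP[].
Qed.

End inf_image.

Section saa_bounds.
Context (R : realType) (T Xi : Type) (T0 : [set: T] !=set0) (h : T -> Xi -> R).

Lemma norm_saa_value k (z : k.-tuple Xi) (B : 'I_k -> R) :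
  (forall x j, `|h x (tnth z j)| <= B j) ->
  `|saa_value h z| <= k%:R^-1 * \sum_(j < k) B j.
Proof.
move=> hB; apply: norm_inf_image => // x.
rewrite normrM ger0_norm ?invr_ge0// ler_wpM2l ?invr_ge0//.
by apply: le_trans (ler_norm_sum _ _ _) _; exact: ler_sum.
Qed.

(** An infimum is 1-Lipschitz for the uniform norm of the objective. The bounds [B] and [B'] make
    both sets of values bounded below; without such a bound [inf] would be a default value. *)
Lemma saa_value_lipschitz k (z z' : k.-tuple Xi) (B B' D : 'I_k -> R) (b : pred 'I_k) :
  (forall x j, `|h x (tnth z j)| <= B j) ->
  (forall x j, `|h x (tnth z' j)| <= B' j) ->
  (forall x j, `|h x (tnth z j) - h x (tnth z' j)| <= D j) ->
  (forall j, ~~ b j -> tnth z j = tnth z' j) ->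
  `|saa_value h z - saa_value h z'| <= k%:R^-1 * \sum_(j < k | b j) D j.
Proof.
move=> zB zB' zD zz'; set e := _ * \sum_(_ < _ | _) _.
have hk (y : k.-tuple Xi) A x : (forall x j, `|h x (tnth y j)| <= A j) ->
    `|k%:R^-1 * \sum_(i < k) h x (tnth y i)| <= k%:R^-1 * \sum_(j < k) A j.
  move=> yB; rewrite normrM ger0_norm ?invr_ge0// ler_wpM2l ?invr_ge0//.
  by apply: le_trans (ler_norm_sum _ _ _) _; exact: ler_sum.
have he x : `|k%:R^-1 * \sum_(i < k) h x (tnth z i)
             - k%:R^-1 * \sum_(i < k) h x (tnth z' i)| <= e.
  rewrite -mulrBr -sumrB normrM ger0_norm ?invr_ge0// ler_wpM2l ?invr_ge0//.
  rewrite [in leLHS](bigID b)/= [X in `|_ + X|]big1 ?addr0; last first.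
    by move=> j nbj; rewrite zz'// subrr.
  by apply: le_trans (ler_norm_sum _ _ _) _; exact: ler_sum.
have := @le_inf_image R T T0 _ _ _ e (fun x => hk z B x zB) (fun x => _ : _ <= _ + e).
have := @le_inf_image R T T0 _ _ _ e (fun x => hk z' B' x zB') (fun x => _ : _ <= _ + e).
rewrite ler_norml lerBlDl lerNl opprB lerBlDl => H1 H2.
apply/andP; split.
  by apply: H1 => x; have := he x; rewrite ler_norml lerNl opprB lerBlDl => /andP[].
by rewrite [leRHS]addrC addrC; apply: H2 => x; have := he x; rewrite ler_norml lerBlDl addrC => /andP[].
Qed.

End saa_bounds.

(** * Envelopes of the cost *)

Section saa_envelopes.
Context (R : realType) dXi (Xi : measurableType dXi) (F : probability Xi R)
  (T : Type) (T0 : [set: T] !=set0) (h : T -> Xi -> R).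
Variable p : R.
Hypothesis p_ge2 : 2 <= p.
Hypothesis sup_meas : measurable_fun [set: Xi] (sup_abs_sqr h).
Hypothesis supdiff_meas : measurable_fun [set: Xi * Xi] (sup_absdiff_pow h p).
Hypothesis sup_moment : (\int[F]_z sup_abs_sqr h z < +oo)%E.
Hypothesis supdiff_moment : (\int[F \x F]_zz sup_absdiff_pow h p zz < +oo)%E.

Definition bounded_cost : set Xi := [set z | (sup_abs_sqr h z < +oo)%E].

Lemma measurable_bounded_cost : measurable bounded_cost.
Proof.
rewrite -[bounded_cost]setTI.
exact: emeasurable_fun_infty_o.
Qed.

Lemma sup_abs_sqr_ge0 z : (0 <= sup_abs_sqr h z)%E.
Proof.
have [x _] := T0; apply: le_trans (_ : (`|h x z| ^+ 2)%:E <= _)%E.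
  by rewrite lee_fin sqr_ge0.
by apply: ereal_sup_ubound; exists x.
Qed.

Lemma sup_absdiff_pow_ge0 q zz : (0 <= sup_absdiff_pow h q zz)%E.
Proof.
have [x _] := T0; apply: le_trans (_ : (`|h x zz.1 - h x zz.2| `^ q)%:E <= _)%E.
  by rewrite lee_fin powR_ge0.
by apply: ereal_sup_ubound; exists x.
Qed.

Lemma sup_abs_sqr_integrable : F.-integrable setT (sup_abs_sqr h).
Proof.
apply/integrableP; split => //; under eq_integral do rewrite gee0_abs ?sup_abs_sqr_ge0//.
exact: sup_moment.
Qed.

Lemma sup_absdiff_pow_integrable : (F \x F)%E.-integrable setT (sup_absdiff_pow h p).
Proof.
apply/integrableP; split => //.
under eq_integral do rewrite gee0_abs ?sup_absdiff_pow_ge0//.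
exact: supdiff_moment.
Qed.

Lemma bounded_cost_ae : {ae F, forall z, bounded_cost z}.
Proof.
have := integrable_ae measurableT sup_abs_sqr_integrable.
by apply: filterS => z /(_ I); rewrite /bounded_cost /= ltey_eq => ->.
Qed.

Lemma bounded_cost_null : F (~` bounded_cost) = 0%E.
Proof.
have /negligibleP := bounded_cost_ae; apply.
exact/measurableC/measurable_bounded_cost.
Qed.

Lemma bounded_cost_nonempty : bounded_cost !=set0.
Proof.
apply/set0P/eqP => B0; have := bounded_cost_null; rewrite B0 setC0 probability_setT.
by move/eqP; rewrite onee_eq0.
Qed.

(* The cost is made bounded at every point of Xi, so that the Lipschitz estimate on
   the SAA value holds everywhere and not only almost everywhere. *)
Definition regularize (z : Xi) : Xi :=
  if z \in bounded_cost then z else sval (cid bounded_cost_nonempty).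

Lemma regularize_bounded z : bounded_cost (regularize z).
Proof.
by rewrite /regularize; case: ifPn => [/set_mem//|_]; case: cid.
Qed.

Lemma regularize_id z : bounded_cost z -> regularize z = z.
Proof. by move=> Bz; rewrite /regularize mem_set. Qed.

Lemma measurable_regularize : measurable_fun setT regularize.
Proof.
have mB := measurable_bounded_cost.
apply: (@measurable_fun_ifT _ _ _ _ id (fun=> sval (cid bounded_cost_nonempty))
  (fun z => z \in bounded_cost)) => //.
apply: (@measurable_fun_bool _ _ _ _ true).
rewrite setTI (_ : _ @^-1` _ = bounded_cost)//.
by apply/seteqP; split => z /=; [exact: set_mem|exact: mem_set].
Qed.

Definition envelope (z : Xi) : R := Num.sqrt (fine (sup_abs_sqr h (regularize z))).

(** The supremum of differences is recovered as a p-th root, because it is the supremum of the p-th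
    powers whose measurability is assumed. *)
Definition diff_envelope (zz : Xi * Xi) : R :=
  fine (sup_absdiff_pow h p (regularize zz.1, regularize zz.2)) `^ p^-1.

Lemma measurable_envelope : measurable_fun setT envelope.
Proof.
apply: measurableT_comp.
  by apply: continuous_measurable_fun; exact: sqrt_continuous.
apply: (measurableT_comp (fine_measurable measurableT)).
by apply: measurableT_comp => //; exact: measurable_regularize.
Qed.

Lemma measurable_diff_envelope : measurable_fun setT diff_envelope.
Proof.
apply: (measurableT_comp (measurable_powR _)).
apply: (measurableT_comp (fine_measurable measurableT)).
apply: (measurableT_comp supdiff_meas); apply: measurable_fun_pair.
  by apply: measurableT_comp => //; exact: measurable_regularize.
by apply: measurableT_comp => //; exact: measurable_regularize.
Qed.

Lemma diff_envelope_ge0 zz : 0 <= diff_envelope zz.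
Proof. exact: powR_ge0. Qed.

Lemma sqr_envelopeE z : ((envelope z ^+ 2)%:E = sup_abs_sqr h (regularize z))%E.
Proof.
have fin : sup_abs_sqr h (regularize z) \is a fin_num.
  by rewrite ge0_fin_numE ?sup_abs_sqr_ge0//; exact: regularize_bounded.
by rewrite sqr_sqrtr ?fineK// fine_ge0// sup_abs_sqr_ge0.
Qed.

Lemma norm_le_envelope x z : `|h x (regularize z)| <= envelope z.
Proof.
rewrite -[leLHS]ger0_norm// -sqrtr_sqr ler_sqrt; last by rewrite fine_ge0// sup_abs_sqr_ge0.
rewrite -lee_fin fineK; last first.
  by rewrite ge0_fin_numE ?sup_abs_sqr_ge0//; exact: regularize_bounded.
by apply: ereal_sup_ubound; exists x.
Qed.

Let p_gt0 : 0 < p. Proof. by apply: lt_le_trans p_ge2. Qed.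

Lemma sup_absdiff_pow_fin z z' :
  sup_absdiff_pow h p (regularize z, regularize z') \is a fin_num.
Proof.
rewrite ge0_fin_numE ?sup_absdiff_pow_ge0//.
apply: (@le_lt_trans _ _ ((envelope z + envelope z') `^ p)%:E); last exact: ltry.
apply: ge_ereal_sup => _ [x _ <-]; rewrite lee_fin /=.
have B : `|h x (regularize z) - h x (regularize z')| <= envelope z + envelope z'.
  by apply: le_trans (ler_normB _ _) _; apply: lerD; exact: norm_le_envelope.
by apply: ge0_ler_powR => //; rewrite ?nnegrE ?(ltW p_gt0)//; exact: le_trans B.
Qed.

Lemma diff_envelope_powE zz :
  ((diff_envelope zz `^ p)%:E =
    sup_absdiff_pow h p (regularize zz.1, regularize zz.2))%E.
Proof.
rewrite /diff_envelope -powRrM mulVf ?gt_eqF// powRr1 ?fineK ?sup_absdiff_pow_fin//.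
by rewrite fine_ge0// sup_absdiff_pow_ge0.
Qed.

Lemma absdiff_le_envelope x z z' :
  `|h x (regularize z) - h x (regularize z')| <= diff_envelope (z, z').
Proof.
rewrite -(@ler_pXn2r _ 1)//; last exact: diff_envelope_ge0.
have [//|lt] := leP (_ ^+ 1) _; rewrite !expr1 in lt.
have := gt0_ltr_powR p_gt0 (diff_envelope_ge0 _ : _ \in Num.nneg) (normr_ge0 _ : _ \in Num.nneg) lt.
rewrite ltNge => /negP[]; rewrite -lee_fin diff_envelope_powE.
by apply: ereal_sup_ubound; exists x.
Qed.

Lemma L1_sqr_envelope : L1 F (fun z => envelope z ^+ 2).
Proof.
apply: (integrable_ae_eq sup_abs_sqr_integrable).
  by apply/measurable_EFinP; apply: measurable_funX; exact: measurable_envelope.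
by apply: filterS bounded_cost_ae => z Bz /=; rewrite sqr_envelopeE regularize_id.
Qed.

Lemma L1_diff_envelope_pow : L1 (F \x F)%E (fun zz => diff_envelope zz `^ p).
Proof.
apply: (integrable_ae_eq sup_absdiff_pow_integrable).
  apply/measurable_EFinP; apply: (measurableT_comp (measurable_powR _)).
  exact: measurable_diff_envelope.
have mB := measurableC measurable_bounded_cost.
(* Regularization alters a pair only if one of its coordinates lies in the null set of unbounded
   cost, hence two negligible strips. *)
have N1 : (F \x F)%E.-negligible (~` bounded_cost `*` [set: Xi]).
  apply/negligibleP; first exact: measurableX.
  by apply: etrans (product_measure1E _ _ mB measurableT) _; rewrite [X in (X * _)%E]bounded_cost_null mul0e.
have N2 : (F \x F)%E.-negligible ([set: Xi] `*` ~` bounded_cost).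
  apply/negligibleP; first exact: measurableX.
  by apply: etrans (product_measure1E _ _ measurableT mB) _; rewrite [X in (_ * X)%E]bounded_cost_null mule0.
apply: negligibleS (negligibleU N1 N2) => -[z z'] /= nE.
apply: contrapT => /not_orP[/not_andP[/contrapT Bz|//] /not_andP[//|/contrapT Bz']].
by apply: nE; rewrite diff_envelope_powE/= !regularize_id.
Qed.

Lemma L1_diff_envelope_sqr : L1 (F \x F)%E (fun zz => diff_envelope zz ^+ 2).
Proof.
apply: L1_le (L1D (L1_cst _ 1) L1_diff_envelope_pow).
  by apply: measurable_funX; exact: measurable_diff_envelope.
move=> zz; rewrite ger0_norm ?sqr_ge0//; have D0 := diff_envelope_ge0 zz.
have [D1|D1] := leP (diff_envelope zz) 1.
  by apply: (@le_trans _ _ 1); [exact: exprn_ile1|rewrite lerDl powR_ge0].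
apply: (@le_trans _ _ (diff_envelope zz `^ p)); last by rewrite lerDr.
by rewrite -powR_mulrn// ler_powR// ltW.
Qed.

End saa_envelopes.

(** * The SAA value on regularized data *)

Section saa_regularized.
Context (R : realType) dXi (Xi : measurableType dXi) (F : probability Xi R)
  (T : Type) (T0 : [set: T] !=set0) (h : T -> Xi -> R).
Context dO (Omega : measurableType dO) (P : probability Omega R)
  (xi : nat -> {RV P >-> Xi}) (xi_iid : iid_from F xi).
Hypothesis H_meas : forall k : nat, (0 < k)%N ->
  measurable_fun [set: k.-tuple Xi] (@saa_value R T Xi h k).
Variable p : R.
Hypothesis p_ge2 : 2 <= p.
Hypothesis sup_meas : measurable_fun [set: Xi] (sup_abs_sqr h).
Hypothesis supdiff_meas : measurable_fun [set: Xi * Xi] (sup_absdiff_pow h p).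
Hypothesis sup_moment : (\int[F]_z sup_abs_sqr h z < +oo)%E.
Hypothesis supdiff_moment : (\int[F \x F]_zz sup_absdiff_pow h p zz < +oo)%E.
Local Notation rho := (regularize T0 sup_meas sup_moment).
Local Notation M := (envelope T0 sup_meas sup_moment).
Local Notation D := (diff_envelope T0 p sup_meas sup_moment).

Definition regular_value k (z : k.-tuple Xi) : R :=
  saa_value h [tuple rho (tnth z j) | j < k].

Lemma measurable_regular_value k : (0 < k)%N ->
  measurable_fun setT (@regular_value k).
Proof.
move=> k0; apply: (measurableT_comp (H_meas k0)).
apply/measurable_fun_tnthP => j.
rewrite (_ : _ \o _ = (fun z : k.-tuple Xi => rho (tnth z j))); last first.
  by apply/funext => z; rewrite /= tnth_mktuple.
apply: (measurableT_comp (measurable_regularize T0 sup_meas sup_moment)).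
exact: measurable_tnth.
Qed.

Lemma regular_value_perm k (sigma : {perm 'I_k}) (z : k.-tuple Xi) :
  regular_value [tuple tnth z (sigma i) | i < k] = regular_value z.
Proof.
rewrite /regular_value /saa_value; congr inf.
apply: eq_imagel => x _; congr (_ * _); rewrite [RHS](reindex_perm sigma).
by apply: eq_bigr => i _; rewrite !tnth_mktuple.
Qed.

Lemma norm_regular_value k (z : k.-tuple Xi) :
  `|regular_value z| <= k%:R^-1 * \sum_(j < k) M (tnth z j).
Proof.
apply: norm_saa_value => // x j; rewrite tnth_mktuple.
exact: norm_le_envelope.
Qed.

Lemma regular_value_lipschitz k (b : pred 'I_k) (z z' : k.-tuple Xi) :
  (forall j, ~~ b j -> tnth z j = tnth z' j) ->
  `|regular_value z - regular_value z'| <=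
    k%:R^-1 * \sum_(j < k | b j) D (tnth z j, tnth z' j).
Proof.
move=> zz'; apply: (@saa_value_lipschitz _ _ _ T0 _ _ _ _
  (fun j => M (tnth z j)) (fun j => M (tnth z' j))) => [x j|x j|x j|j nbj];
  rewrite !tnth_mktuple.
- exact: norm_le_envelope.
- exact: norm_le_envelope.
- exact: absdiff_le_envelope.
- by rewrite zz'.
Qed.

Lemma data_bounded_ae : {ae P, forall w, forall i, bounded_cost h (xi i w)}.
Proof.
have [_ law] := xi_iid; apply: ae_foralln => i.
have mB := measurableC (measurable_bounded_cost sup_meas).
apply/negligibleP.
  by have := measurable_funPT (xi i) measurableT _ mB; rewrite setTI.
exact: etrans (law i (~` bounded_cost h) mB) (bounded_cost_null T0 sup_meas sup_moment).
Qed.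

Lemma saa_sample_regular k w : (forall i, bounded_cost h (xi i w)) ->
  saa_sample h xi k w = regular_value (sample xi (@nat_of_ord k) w).
Proof.
move=> Bw; congr saa_value; apply: eq_from_tnth => i.
by rewrite !tnth_mktuple regularize_id.
Qed.

Lemma vstat_regular n k w : (forall i, bounded_cost h (xi i w)) ->
  vstat h xi n k w = index_avg (fun I : {ffun 'I_k -> 'I_n} =>
    regular_value (sample xi (fun j => I j : nat) w)).
Proof.
move=> Bw; congr (_ * _).
rewrite (reindex (fun I : {ffun 'I_k -> 'I_n} => [tuple I j | j < k]))/=.
  apply: eq_bigr => I _; congr saa_value; apply: eq_from_tnth => j.
  by rewrite !tnth_mktuple regularize_id.
exists (fun t => [ffun j => tnth t j]) => [I _|t _].
  by apply/ffunP => j; rewrite ffunE tnth_mktuple.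
by apply: eq_from_tnth => j; rewrite tnth_mktuple ffunE.
Qed.

Lemma measurable_saa_sample k : (0 < k)%N -> measurable_fun setT (saa_sample h xi k).
Proof.
move=> k0; apply: (@measurableT_comp _ _ _ _ _ _ _ _ (sample xi (@nat_of_ord k)) (H_meas k0)).
exact: measurable_sample.
Qed.

Lemma measurable_vstat n k : (0 < k)%N -> measurable_fun setT (vstat h xi n k).
Proof.
move=> k0; apply: measurable_funM => //; apply: measurable_sum => t.
apply: (@measurableT_comp _ _ _ _ _ _ _ _ (sample xi (fun j => tnth t j : nat)) (H_meas k0)).
exact: measurable_sample.
Qed.

Variables (k' : nat) (g : Xi -> R).
Local Notation k := k'.+1.
Hypothesis g_cond : cond_expectation_given (xi 0%N) (saa_sample h xi k) g.

Let saa_ae : {ae P, forall w, saa_sample h xi k w =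
  regular_value (sample xi (@nat_of_ord k) w)}.
Proof. by apply: filterS data_bounded_ae => w; exact: saa_sample_regular. Qed.

Let mH := measurable_regular_value (ltn0Sn k').
Let mM := measurable_envelope T0 sup_meas sup_moment.
Let M2 := L1_sqr_envelope T0 sup_meas sup_moment.
Let HM := @norm_regular_value k.
Let mD := measurable_diff_envelope T0 sup_meas supdiff_meas sup_moment.
Let D0 := diff_envelope_ge0 T0 p sup_meas sup_moment.
Let D2 := L1_diff_envelope_sqr T0 p_ge2 sup_meas supdiff_meas sup_moment supdiff_moment.
Let HD := @regular_value_lipschitz k.

(** Almost surely all data are left unchanged by the regularization, so the given version [g] serves
    both kernels. *)
Lemma cond_regular : cond_expectation_given (xi 0%N)
  (fun w => regular_value (sample xi (@nat_of_ord k) w)) g.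
Proof.
have [mg Ig Eg] := g_cond; split => // A mA; rewrite Eg//.
have mXA : measurable (xi 0%N @^-1` A).
  by have := measurable_funPT (xi 0%N) measurableT _ mA; rewrite setTI.
apply: ae_eq_integral => //.
- apply/measurable_EFinP; apply: measurable_funTS; exact: measurable_saa_sample.
- apply/measurable_EFinP; apply: measurable_funTS.
  by apply: (measurableT_comp mH); exact: measurable_sample.
- by apply: filterS saa_ae => w + _ => ->.
Qed.

Local Notation W := (fine 'E_P[saa_sample h xi k]).
Local Notation G := (fun z => g z - W).

Let G_W : centered_g xi (@regular_value k) g = G.
Proof.
apply/funext => z; congr (_ - _); rewrite unlock; congr fine.
apply: ae_eq_integral => //.
- by apply/measurable_EFinP/(measurableT_comp mH); exact: measurable_sample.
- by apply/measurable_EFinP; exact: measurable_saa_sample.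
- by apply: filterS saa_ae => w -> _.
Qed.

Lemma measurable_saa_G : measurable_fun setT G.
Proof. by rewrite -G_W; exact: (measurable_G cond_regular). Qed.

Lemma L1_sqr_saa_G : L1 F (fun z => G z ^+ 2).
Proof.
have := L1_sqr_G xi_iid mH mM M2 HM mD D0 D2 HD cond_regular.
by rewrite G_W.
Qed.

Lemma mean_saa_G : \int[F]_z G z = 0.
Proof. by rewrite -G_W; exact: (mean_G xi_iid cond_regular). Qed.

Lemma variance_saa_G : fine 'V_P[g \o xi 0%N] = \int[F]_z (G z ^+ 2).
Proof.
have EW : ('E_P[g \o xi 0%N] = 'E_P[saa_sample h xi k])%E.
  have [_ _ /(_ setT measurableT)] := g_cond.
  by rewrite preimage_setT unlock.
rewrite -(iid_integral xi_iid 0%N L1_sqr_saa_G) /variance unlock EW unlock.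
by apply: eq_Rintegral => w _; rewrite expr2.
Qed.

Lemma moment_saa_G : L1 F (fun z => `|k%:R * G z| `^ p) /\
  \int[F]_z (`|k%:R * G z| `^ p) <= \int[F]_x \int[F]_y (D (x, y) `^ p).
Proof.
rewrite -G_W; apply: (moment_G xi_iid mH mM M2 HM mD D0 D2 HD cond_regular).
  by apply: lt_le_trans p_ge2; rewrite ltr1n.
exact: L1_diff_envelope_pow.
Qed.

Lemma saa_hajek_bound n : (0 < n)%N ->
  let T w := vstat h xi n k w - W - k%:R / n%:R * \sum_(i < n) G (xi i w) in
  L1 P T /\
  \int[P]_w `|T w| <= 2 * (1 + 9 * \int[F]_x \int[F]_y (D (x, y) ^+ 2)) * (k%:R / n%:R).
Proof.
move=> n0 U.
pose U' w := index_avg (fun I : {ffun 'I_k -> 'I_n} =>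
    regular_value (sample xi (fun j => I j : nat) w))
  - mean_value xi (@regular_value k) - k%:R / n%:R * \sum_(i < n) G (xi i w).
have := hajek_bound xi_iid mH (@regular_value_perm k) mM M2 HM mD D0 D2 HD cond_regular n0.
rewrite G_W -/(U' _) => UB.
have IG i : L1 P (fun w => G (xi i w)).
  apply/(@iid_L1 _ _ _ _ _ _ _ _ xi_iid G i); first exact: measurable_saa_G.
  by apply: L1_sqr; [exact: measurable_saa_G|exact: L1_sqr_saa_G].
have IU' : L1 P U'.
  apply: L1B; last by apply: L1Z; apply: L1_sum => i _ _; exact: IG.
  apply: L1B; last exact: L1_cst.
  apply: L1Z; apply: L1_sum => I _ _.
  exact: (L1_value xi_iid mH mM M2 HM).
have W_W : mean_value xi (@regular_value k) = W.
  by have := congr1 (fun f => f point) G_W; rewrite /centered_g => /addrI/oppr_inj.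
have UE : {ae P, forall w, U' w = U w}.
  by apply: filterS data_bounded_ae => w Bw; rewrite /U' /U (vstat_regular _ _ Bw) W_W.
have mU : measurable_fun setT U.
  apply: measurable_funB.
    by apply: measurable_funB => //; exact: measurable_vstat.
  apply: measurable_funM => //; apply: measurable_sum => i.
  by apply: L1_measurable; exact: IG.
have IU : L1 P U.
  apply: (integrable_ae_eq IU'); first exact/measurable_EFinP.
  by apply: filterS UE => w E; exact: (congr1 EFin E).
split => //; apply: le_trans UB; rewrite le_eqVlt; apply/orP; left; apply/eqP.
congr fine; apply: ae_eq_integral => //.
- exact: measurable_int (L1_norm IU).
- exact: measurable_int (L1_norm IU').
- by apply: filterS UE => w E _; exact: (congr1 (fun t => `|t|%:E) (esym E)).
Qed.

End saa_regularized.

(** * Normalized projections *)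

Section product_coordinates.
Context d1 d2 (T1 : measurableType d1) (T2 : measurableType d2) (R : realType).
Context (P : probability T1 R) (Q : probability T2 R).

Lemma L1_fst (f : T1 -> R) : L1 P f -> L1 (P \x Q)%E (fun w => f w.1).
Proof.
move=> If; have mf := L1_measurable If; apply/integrable12ltyP => /=.
  by apply/measurable_EFinP; exact: measurableT_comp.
under eq_integral do rewrite integral_cst// [X in (_ * X)%E]probability_setT mule1.
exact: integrable_lty (L1_norm If).
Qed.

Lemma Rintegral_fst (f : T1 -> R) : L1 P f ->
  (\int[(P \x Q)%E]_w f w.1)%R = \int[P]_x f x.
Proof.
move=> If; rewrite Rintegral_fubini12; last exact: L1_fst.
by apply: eq_Rintegral => x _ /=; rewrite Rintegral_pcst.
Qed.

Lemma L1_snd (f : T2 -> R) : L1 Q f -> L1 (P \x Q)%E (fun w => f w.2).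
Proof.
move=> If; have mf := L1_measurable If; apply/integrable12ltyP => /=.
  by apply/measurable_EFinP; exact: measurableT_comp.
rewrite integral_cst// [X in (_ * X)%E]probability_setT mule1.
exact: integrable_lty (L1_norm If).
Qed.

Lemma Rintegral_snd (f : T2 -> R) : L1 Q f ->
  (\int[(P \x Q)%E]_w f w.2)%R = \int[Q]_y f y.
Proof.
move=> If; rewrite Rintegral_fubini12; last exact: L1_snd.
by rewrite /= Rintegral_pcst.
Qed.

End product_coordinates.

Lemma markov_L1 d (T : measurableType d) (R : realType) (P : probability T R)
    (u v : T -> R) (e : R) : 0 < e -> measurable_fun setT u -> L1 P v ->
  (forall w, `|u w| <= v w) ->
  (P [set w | (e < `|u w|)%R] <= (e^-1 * \int[P]_w v w)%:E)%E.
Proof.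
move=> e0 mu' Iv uv.
have mA : measurable [set w | e < `|u w|].
  rewrite (_ : [set _ | _] = setT `&` (fun w => `|u w|) @^-1` `]e, +oo[); last first.
    by rewrite setTI; apply/seteqP; split => w /=; rewrite in_itv/= andbT.
  by apply: (measurableT_comp _ mu').
have IA := L1_indic P mA; have Pfin : P [set w | e < `|u w|] \is a fin_num.
  exact: fin_num_measure.
rewrite -(fineK Pfin) lee_fin -Rintegral_indic// ler_pdivlMl//.
rewrite -RintegralZl//; apply: le_RintegralT => //; first exact: L1Z.
move=> w; have v0 : 0 <= v w := le_trans (normr_ge0 _) (uv w).
rewrite indicE; case: (boolP (w \in _)) => [/set_mem /= ew|_]; last by rewrite mulr0.
by rewrite mulr1 (le_trans (ltW ew)).
Qed.

(** [|u| <= e + u^2 / e] for every e > 0, and the last term integrates to 0. *)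
Lemma Rintegral_norm_eq0 d (T : measurableType d) (R : realType) (P : probability T R)
    (u : T -> R) : measurable_fun setT u -> L1 P (fun w => u w ^+ 2) ->
  \int[P]_w (u w ^+ 2) = 0 -> \int[P]_w `|u w| = 0.
Proof.
move=> mu' I2 E2; have Iu := L1_norm (L1_sqr mu' I2).
apply/eqP; rewrite eq_le Rintegral_ge0// andbT.
apply/ler_addgt0Pl => e e0; rewrite addr0.
have Ie := L1_cst P e; have I2' := L1Z e^-1 I2.
apply: le_trans (le_RintegralT Iu (L1D Ie I2') _) _.
  move=> w; rewrite -subr_ge0 -(pmulr_rge0 _ e0).
  rewrite (_ : _ * _ = e ^+ 2 + u w ^+ 2 - e * `|u w|); last by field; rewrite gt_eqF.
  rewrite -(@real_normK _ (u w)) ?num_real//; have := sqr_ge0 (e - `|u w|).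
  have := normr_ge0 (u w); nra.
by rewrite RintegralD// RintegralZl// E2 mulr0 addr0 Rintegral_pcst.
Qed.

Section normalized_sums.
Context (R : realType) dXi (Xi : measurableType dXi) (F : probability Xi R)
  dO (Omega : measurableType dO) (P : probability Omega R)
  (xi : nat -> {RV P >-> Xi}) (xi_iid : iid_from F xi).
Local Notation Q := (normal_prob (0 : R) 1).
Local Notation A := (measurableTypeR R).

(* A degenerate projection is replaced by an auxiliary standard normal
   coordinate, so that the variance is always 1. *)
Definition normalized_sum (n : nat) (v : R) (G : Xi -> R) (w : Omega * A) : R :=
  if (0 < n)%N && (0 < v) then (Num.sqrt n%:R * Num.sqrt v)^-1 * iid_sum xi G n w.1
  else w.2.

Section fixed.
Variables (n : nat) (v : R) (G : Xi -> R).
Hypothesis mG : (0 < n)%N -> measurable_fun setT G.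
Hypothesis G2 : (0 < n)%N -> L1 F (fun z => G z ^+ 2).
Hypothesis EG : (0 < n)%N -> \int[F]_z G z = 0.
Hypothesis EG2 : (0 < n)%N -> \int[F]_z (G z ^+ 2) = v.

Let normalized_sum_cases :
  [/\ (0 < n)%N, 0 < v & normalized_sum n v G =
     (fun w => (Num.sqrt n%:R * Num.sqrt v)^-1 * iid_sum xi G n w.1)] \/
  normalized_sum n v G = snd.
Proof.
rewrite /normalized_sum; case: (0 < n)%N; case: (0 < v) => /=; by [left|right].
Qed.

Lemma measurable_normalized_sum : measurable_fun setT (normalized_sum n v G).
Proof.
have [[n0 v0 ->]|->] := normalized_sum_cases.
  have mS := measurable_iid_sum xi (mG n0) n.
  by apply: measurable_funM => //; exact: measurableT_comp.
exact: measurable_snd.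
Qed.

Lemma L1_sqr_normalized_sum : L1 (P \x Q)%E (fun w => normalized_sum n v G w ^+ 2).
Proof.
have [[n0 v0 ->]|->] := normalized_sum_cases.
  have IS2 := L1_iid_sum_sqr xi_iid (mG n0) (G2 n0) n.
  have I2 := L1_fst Q (L1Z ((Num.sqrt n%:R * Num.sqrt v)^-1 ^+ 2) IS2).
  by apply: L1_eq I2 => w; rewrite exprMn.
exact: (@L1_snd _ _ _ _ _ P Q (fun y : A => y ^+ 2) (gauss_integrable_sqr R)).
Qed.

Lemma mean_normalized_sum : \int[(P \x Q)%E]_w normalized_sum n v G w = 0.
Proof.
have [[n0 v0 ->]|->] := normalized_sum_cases.
  have IS := L1_iid_sum xi_iid (mG n0) (G2 n0) n.
  rewrite (Rintegral_fst Q (L1Z _ IS)) RintegralZl//.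
  by rewrite (mean_iid_sum xi_iid (mG n0) (G2 n0) (EG n0)) mulr0.
by rewrite (Rintegral_snd P (gauss_integrable_id R)) gauss_mean.
Qed.

Lemma variance_normalized_sum : \int[(P \x Q)%E]_w (normalized_sum n v G w ^+ 2) = 1.
Proof.
have [[n0 v0 ->]|->] := normalized_sum_cases; last first.
  by rewrite (@Rintegral_snd _ _ _ _ _ P Q (fun y : A => y ^+ 2) (gauss_integrable_sqr R)) gauss_variance.
have IS := L1_iid_sum_sqr xi_iid (mG n0) (G2 n0) n.
under eq_Rintegral do rewrite exprMn.
rewrite (Rintegral_fst Q (L1Z _ IS)) RintegralZl//.
rewrite (variance_iid_sum xi_iid (mG n0) (G2 n0) (EG n0)) EG2//.
rewrite exprVn exprMn !sqr_sqrtr ?(ltW v0)// mulVf// mulf_neq0 ?(gt_eqF v0)//.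
by rewrite pnatr_eq0 -lt0n.
Qed.

Lemma hajek_remainder_probability (m : nat) (V : Omega -> R) (c e : R) :
  (0 < n)%N -> 0 < e -> measurable_fun setT V ->
  let T w := V w - m%:R / n%:R * iid_sum xi G n w in
  L1 P T -> \int[P]_w `|T w| <= c * (m%:R / n%:R) ->
  ((P \x Q)%E [set w | (e < `|(Num.sqrt n%:R * V w.1
     - m%:R * Num.sqrt v * normalized_sum n v G w)%R|)%R] <=
   (e^-1 * (c * (Num.sqrt n%:R * (m%:R / n%:R))))%:E)%E.
Proof.
move=> n0 e0 mV T IT TB.
have mS := measurable_iid_sum xi (mG n0) n.
have IS := L1_iid_sum xi_iid (mG n0) (G2 n0) n.
have IS2 := L1_iid_sum_sqr xi_iid (mG n0) (G2 n0) n.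
have sn0 : 0 < Num.sqrt n%:R :> R by rewrite sqrtr_gt0 ltr0n.
have v0 : 0 <= v by rewrite -(EG2 n0); apply: Rintegral_ge0 => z _; exact: sqr_ge0.
set b := Num.sqrt n%:R * (m%:R / n%:R).
(* For positive variance the normalized sum reproduces the projection exactly. For zero variance its
   coefficient is 0, and the projection itself remains as an error; [r] accounts for it and has
   integral 0. *)
pose r w := if 0 < v then 0 else b * `|iid_sum xi G n w|.
have Ir : L1 P r.
  by rewrite /r; case: (0 < v); [exact: L1_cst|apply: L1Z; exact: L1_norm].
have Er : \int[P]_w r w = 0.
  rewrite /r; have [_|v1] := ltP 0 v; first by rewrite Rintegral_pcst.
  rewrite RintegralZl//; last exact: L1_norm.
  rewrite Rintegral_norm_eq0 ?mulr0//.
  rewrite (variance_iid_sum xi_iid (mG n0) (G2 n0) (EG n0)) EG2//.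
  by rewrite (_ : v = 0) ?mulr0//; apply/eqP; rewrite eq_le v1 v0.
pose B w := Num.sqrt n%:R * `|T w| + r w.
have IB : L1 P B by apply: L1D => //; apply: L1Z; exact: L1_norm.
have mZ := measurable_normalized_sum.
have mU : measurable_fun setT (fun w : Omega * A => Num.sqrt n%:R * V w.1
     - m%:R * Num.sqrt v * normalized_sum n v G w).
  apply: measurable_funB; apply: measurable_funM => //.
  exact: measurableT_comp.
apply: le_trans (markov_L1 e0 mU (L1_fst Q IB) _) _ => [w|].
  rewrite /B /r /normalized_sum n0/=; have [v1|v1] := ltP 0 v.
    have -> : Num.sqrt n%:R * V w.1 - m%:R * Num.sqrt v *
        ((Num.sqrt n%:R * Num.sqrt v)^-1 * iid_sum xi G n w.1) = Num.sqrt n%:R * T w.1.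
      rewrite /T mulrBr; congr (_ - _).
      rewrite -{3}(@sqr_sqrtr _ n%:R) ?ler0n//.
      have sv0 : 0 < Num.sqrt v by rewrite sqrtr_gt0.
      by field; rewrite !gt_eqF.
    by rewrite addr0 normrM (gtr0_norm sn0).
  have -> : v = 0 by apply/eqP; rewrite eq_le v1 v0.
  rewrite sqrtr0 mulr0 mul0r subr0.
  have -> : Num.sqrt n%:R * V w.1 =
      Num.sqrt n%:R * T w.1 + b * iid_sum xi G n w.1 by rewrite /T /b; ring.
  apply: le_trans (ler_normD _ _) _; rewrite (normrM _ (T w.1)) (normrM b) (gtr0_norm sn0) lerD2l.
  by rewrite (@ger0_norm _ b)// mulr_ge0// ?(ltW sn0)// divr_ge0.
rewrite lee_fin ler_wpM2l ?invr_ge0 ?(ltW e0)//.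
rewrite (Rintegral_fst Q IB) RintegralD//; last by apply: L1Z; exact: L1_norm.
rewrite Er addr0 RintegralZl//; last exact: L1_norm.
by rewrite mulrCA ler_wpM2l// ltW.
Qed.

End fixed.
End normalized_sums.

(** The left side equals [J * a^(-(2 + delta) / 2)], with a the quantity assumed to be at least 1.
    The exponent is thus weakened to -1, which is all that the limit requires. *)
Lemma lyapunov_ratio_le (R : realType) (n m : nat) (v delta c J : R) :
  (0 < n)%N -> (0 < m)%N -> 0 < v -> 0 < delta -> 0 <= J -> J <= c ->
  1 <= m%:R ^+ 2 * v * n%:R `^ (delta / (2 + delta)) ->
  n%:R * (Num.sqrt n%:R)^-1 `^ (2 + delta)
    * ((m%:R * Num.sqrt v)^-1 `^ (2 + delta) * J) <=
  c * (m%:R ^+ 2 * v * n%:R `^ (delta / (2 + delta)))^-1.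
Proof.
move=> n0 m0 v0 d0 J0 Jc; set a := _ * _ * _ => a1.
have nR : 0 < n%:R :> R by rewrite ltr0n.
have mR : 0 < m%:R :> R by rewrite ltr0n.
have s0 : 0 < Num.sqrt v by rewrite sqrtr_gt0.
have p0 : 0 < 2 + delta by rewrite addr_gt0.
have En : n%:R * (Num.sqrt n%:R)^-1 `^ (2 + delta) = (n%:R `^ (delta / 2))^-1 :> R.
  rewrite -powR12_sqrt// -(powRN _ 2^-1) -powRrM -[X in X * _](powRr1 (ltW nR)) -powRD; last first.
    by rewrite (gt_eqF nR) implybT.
  by rewrite -powRN; congr (_ `^ _); field.
have Ea : a `^ ((2 + delta) / 2) = (m%:R * Num.sqrt v) `^ (2 + delta) * n%:R `^ (delta / 2).
  have ms0 : 0 <= m%:R * Num.sqrt v by rewrite mulr_ge0// ltW.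
  have -> : a = (m%:R * Num.sqrt v) `^ 2 * n%:R `^ (delta / (2 + delta)).
    by rewrite powR_mulrn// exprMn sqr_sqrtr// ltW.
  rewrite powRM ?powR_ge0// -!powRrM.
  by congr (_ `^ _ * _ `^ _); field; rewrite ?gt_eqF.
have -> : n%:R * (Num.sqrt n%:R)^-1 `^ (2 + delta) *
    ((m%:R * Num.sqrt v)^-1 `^ (2 + delta) * J) = J * (a `^ ((2 + delta) / 2))^-1.
  have ms0 : 0 < m%:R * Num.sqrt v by rewrite mulr_gt0.
  have -> : (m%:R * Num.sqrt v)^-1 `^ (2 + delta) = ((m%:R * Num.sqrt v) `^ (2 + delta))^-1.
    by rewrite -(powR_inv1 (ltW ms0)) -powRrM mulN1r powRN.
  by rewrite En Ea; field; rewrite !gt_eqF ?powR_gt0.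
have a0 : 0 < a by exact: lt_le_trans a1.
rewrite ler_pM ?invr_ge0 ?powR_ge0// lef_pV2 ?posrE ?powR_gt0//.
rewrite -[leLHS]powRr1 ?(ltW a0)// ler_powR//.
by rewrite ler_pdivlMr// mul1r lerDl ltW.
Qed.

(** The quantity is at most a constant times [n^(gamma - 1/2)]; this is where the restriction on
    gamma enters. *)
Lemma sqrt_rate_cvg0 (R : realType) (k : nat -> nat) (gamma : R) : gamma < 2^-1 ->
  (fun n : nat => (k n)%:R : R) =O_\oo (fun n : nat => n%:R `^ gamma : R) ->
  Num.sqrt n%:R * ((k n)%:R / n%:R) @[n --> \oo] --> (0 : R).
Proof.
move=> g2 /eqO_exP[c c0 kc]; pose b := 2^-1 - gamma.
have b0 : 0 < b by rewrite subr_gt0.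
apply/cvgrPdist_le => e e0; near=> n.
have n1 : (0 < n)%N by near: n; exact: nbhs_infty_gt.
have nR : 0 < n%:R :> R by rewrite ltr0n.
rewrite sub0r normrN ger0_norm ?mulr_ge0 ?divr_ge0 ?sqrtr_ge0//.
have kn : (k n)%:R <= c * n%:R `^ gamma.
  have : `|(k n)%:R| <= c * `|n%:R `^ gamma| by near: n.
  by rewrite ger0_norm// ger0_norm// powR_ge0.
have E : Num.sqrt n%:R * (c * n%:R `^ gamma / n%:R) = c * (n%:R `^ b)^-1.
  have -> : (n%:R `^ b)^-1 = n%:R `^ 2^-1 * n%:R `^ gamma * n%:R `^ (-1) :> R.
    rewrite -!powRD ?(gt_eqF nR) ?implybT// -powRN.
    by congr (_ `^ _); rewrite /b; field.
  by rewrite powR12_sqrt// powR_inv1//; ring.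
apply: (@le_trans _ _ (c * (n%:R `^ b)^-1)).
  by rewrite -E ler_wpM2l ?sqrtr_ge0// ler_wpM2r ?invr_ge0// ltW.
rewrite ler_pdivrMr ?powR_gt0// -ler_pdivrMl//.
have /ge0_ler_powR H : 0 <= b by exact: ltW.
apply: (@le_trans _ _ (((e^-1 * c) `^ b^-1) `^ b)).
  by rewrite -powRrM mulVf ?gt_eqF// powRr1// mulr_ge0 ?invr_ge0// ltW.
apply: H; rewrite ?nnegrE ?powR_ge0//.
by near: n; exact: nbhs_infty_ger.
Unshelve. all: by end_near. Qed.

(** * Central limit theorem for the normalized projections *)

Section projection_clt.
Context (R : realType) dXi (Xi : measurableType dXi) (F : probability Xi R)
  dO (Omega : measurableType dO) (P : probability Omega R)
  (xi : nat -> {RV P >-> Xi}) (xi_iid : iid_from F xi).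
Local Notation Q := (normal_prob (0 : R) 1).
Variables (k : nat -> nat) (G : nat -> Xi -> R) (v : nat -> R) (delta c : R).
Hypothesis delta_gt0 : 0 < delta.
Hypothesis k_gt0 : forall n, (0 < n)%N -> (0 < k n)%N.
Hypothesis mG : forall n, (0 < n)%N -> measurable_fun setT (G n).
Hypothesis G2 : forall n, (0 < n)%N -> L1 F (fun z => G n z ^+ 2).
Hypothesis EG : forall n, (0 < n)%N -> \int[F]_z G n z = 0.
Hypothesis EG2 : forall n, (0 < n)%N -> \int[F]_z (G n z ^+ 2) = v n.
Hypothesis Gp : forall n, (0 < n)%N ->
  L1 F (fun z => `|(k n)%:R * G n z| `^ (2 + delta)) /\
  \int[F]_z (`|(k n)%:R * G n z| `^ (2 + delta)) <= c.

Local Notation Z n := (normalized_sum xi n (v n) (G n)).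
Local Notation ratio n := ((k n)%:R ^+ 2 * v n * n%:R `^ (delta / (2 + delta))).

Lemma normalized_sum_taylor n C f f1 f2 (eta : R) : taylor_class C f f1 f2 ->
  (0 < n)%N -> 0 < eta -> 1 <= ratio n ->
  `|(\int[(P \x Q)%E]_w f (Z n w))%R - \int[Q]_y f y| <=
  C * (2 * eta + eta `^ (- delta) * (c * (ratio n)^-1)
       + eta `^ (- 2) * n%:R^-1 * \int[Q]_y (y ^+ 4)).
Proof.
move=> tf n0 eta0 r1; have [mf _ _ f0 fC _ _ _] := tf.
have C0 : 0 <= C by apply: le_trans (normr_ge0 _) (fC 0).
have k0 := k_gt0 n0; have kR : 0 < (k n)%:R :> R by rewrite ltr0n.
(* A ratio of at least 1 excludes zero variance, so the normalized sum is a genuine sum and not the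
   auxiliary coordinate. *)
have v0 : 0 < v n.
  have vn : 0 <= v n by rewrite -(EG2 n0); apply: Rintegral_ge0 => z _; exact: sqr_ge0.
  rewrite lt_neqAle vn andbT; apply/eqP => v0; move: r1.
  by rewrite -v0 mulr0 mul0r ler10.
have s0 : 0 < Num.sqrt (v n) by rewrite sqrtr_gt0.
pose Y z := (Num.sqrt (v n))^-1 * G n z.
have mY : measurable_fun setT Y by apply: measurable_funM => //; exact: mG.
have IY2 : L1 F (fun z => Y z ^+ 2).
  by apply: L1_eq (L1Z ((Num.sqrt (v n))^-1 ^+ 2) (G2 n0)) => z; rewrite exprMn.
have EY : \int[F]_z Y z = 0.
  by rewrite RintegralZl ?EG ?mulr0//; apply: L1_sqr; [exact: mG|exact: G2].
have EY2 : \int[F]_z (Y z ^+ 2) = 1.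
  under eq_Rintegral do rewrite exprMn.
  rewrite RintegralZl// ?EG2//; last exact: G2.
  by rewrite exprVn sqr_sqrtr ?(ltW v0)// mulVf// gt_eqF.
have YE z : `|Y z| `^ (2 + delta) =
    ((k n)%:R * Num.sqrt (v n))^-1 `^ (2 + delta) * `|(k n)%:R * G n z| `^ (2 + delta).
  rewrite -powRM ?invr_ge0 ?mulr_ge0 ?(ltW kR) ?(ltW s0)//; congr (_ `^ _).
  rewrite /Y !normrM gtr0_norm ?invr_gt0// (gtr0_norm kR); field.
  by rewrite !gt_eqF.
have [Ip Bp] := Gp n0.
have IYp : L1 F (fun z => `|Y z| `^ (2 + delta)).
  by apply: L1_eq (L1Z _ Ip) => z; rewrite YE.
have EYp : \int[F]_z (`|Y z| `^ (2 + delta)) =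
    ((k n)%:R * Num.sqrt (v n))^-1 `^ (2 + delta)
      * \int[F]_z (`|(k n)%:R * G n z| `^ (2 + delta)).
  by under eq_Rintegral do rewrite YE; rewrite RintegralZl.
have -> : (\int[(P \x Q)%E]_w f (Z n w))%R =
    \int[P]_w f ((Num.sqrt n%:R)^-1 * iid_sum xi Y n w).
  rewrite -(@Rintegral_fst _ _ _ _ _ P Q
    (fun w => f ((Num.sqrt n%:R)^-1 * iid_sum xi Y n w))).
    apply: eq_Rintegral => w _; rewrite /normalized_sum n0 v0/=; congr f.
    rewrite invfM -mulrA; congr (_ * _); rewrite /iid_sum mulr_sumr.
    by apply: eq_bigr.
  apply: (@L1_bounded _ _ _ _ C) => //; apply: (measurableT_comp mf).
  by apply: measurable_funM => //; exact: measurable_iid_sum.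
apply: le_trans (iid_lindeberg xi_iid mY IY2 EY tf EY2 n0 eta0 (ltW delta_gt0) IYp) _.
rewrite ler_wpM2l// lerD2r lerD2l ler_wpM2l ?powR_ge0// EYp.
by apply: lyapunov_ratio_le => //; apply: Rintegral_ge0 => z _; exact: powR_ge0.
Qed.

(** The summands change with n, but the bound of [normalized_sum_taylor] is explicit for each n.
    Along a subsequence it vanishes once the ratio and the index tend to infinity, the latter
    because [j <= phi j]. *)
Lemma normalized_sum_clt (phi : nat -> nat) : {homo phi : i j / (i < j)%N} ->
  ratio (phi j) @[j --> \oo] --> +oo ->
  forall x : R, {for x, continuous (fun t : R => Q `]-oo, t]%classic)} ->
  (P \x Q)%E (Z (phi j) @^-1` `]-oo, x]) @[j --> \oo] --> Q `]-oo, x].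
Proof.
move=> phi_mono /cvgryPge ratio_oo x.
have phi_ge j : (j <= phi j)%N.
  by elim: j => // j IH; exact: leq_ltn_trans IH (phi_mono _ _ (ltnSn j)).
apply: cvg_cdf_of_logistic => [j|l t l0].
  apply: measurable_normalized_sum; exact: mG.
have [C [f1 [f2 tf]]] := taylor_logistic t (ltW l0).
have C0 : 0 <= C by have [_ _ _ _ fC _ _ _] := tf; apply: le_trans (normr_ge0 _) (fC 0).
have c0 : 0 <= c.
  by have [_] := Gp (ltn0Sn 0); apply: le_trans; apply: Rintegral_ge0 => z _; exact: powR_ge0.
set m4 := \int[Q]_y (y ^+ 4).
have m40 : 0 <= m4 by apply: Rintegral_ge0 => y _; exact: exprn_even_ge0.
apply/cvgrPdist_le => e e0.
(* Chosen so that the term [2 * C * eta] is at most e/3; [C + 1] avoids a division by 0. [A1] and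
   [A2] are the thresholds beyond which the other two terms are at most e/3. *)
pose eta := e / (6 * (C + 1)).
have eta0 : 0 < eta by rewrite divr_gt0// mulr_gt0// ltr_wpDl.
pose A1 := 3 * (C * eta `^ (- delta) * c) / e.
pose A2 := 3 * (C * eta `^ (- 2) * m4) / e.
have small (K r : R) : 0 < r -> 3 * K / e <= r -> K / r <= e / 3.
  by move=> r0; rewrite !ler_pdivrMr//; lra.
near=> j.
have j0 : (0 < phi j)%N.
  by apply: leq_trans (phi_ge j); near: j; exact: nbhs_infty_gt.
have r1 : 1 <= ratio (phi j) by near: j; exact: ratio_oo.
have r2 : A1 <= ratio (phi j) by near: j; exact: ratio_oo.
have r3 : A2 <= (phi j)%:R.
  apply: (@le_trans _ _ j%:R); last by rewrite ler_nat.
  by near: j; exact: nbhs_infty_ger.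
rewrite distrC; apply: le_trans (normalized_sum_taylor tf j0 eta0 r1) _.
have r0 : 0 < ratio (phi j) by exact: lt_le_trans r1.
have n0 : 0 < (phi j)%:R :> R by rewrite ltr0n.
have B0 : C * (2 * eta) <= e / 3.
  rewrite /eta (_ : C * _ = C / (C + 1) * (e / 3)); last by field; rewrite gt_eqF// ltr_wpDl.
  rewrite ler_piMl ?divr_ge0 ?(ltW e0)// ler_pdivrMr ?ltr_wpDl// mul1r lerDl.
  exact: ler01.
have B1 : C * (eta `^ (- delta) * (c * (ratio (phi j))^-1)) <= e / 3.
  rewrite (_ : C * _ = C * eta `^ (- delta) * c / ratio (phi j)); first exact: small.
  by rewrite !mulrA.
have B2 : C * (eta `^ (- 2) * (phi j)%:R^-1 * m4) <= e / 3.
  rewrite (_ : C * _ = C * eta `^ (- 2) * m4 / (phi j)%:R); first exact: small.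
  by rewrite mulrAC !mulrA.
by rewrite !mulrDr -/m4; lra.
Unshelve. all: by end_near. Qed.

End projection_clt.

Theorem theorem4 (R : realType)
  (* F on Xi, decision space D, cost h *)
  (dXi : measure_display) (Xi : measurableType dXi) (F : probability Xi R)
  (D : Type) (D_nonempty : [set: D] !=set0) (h : D -> Xi -> R)
  (* the probability space of the data *)
  (dO : measure_display) (Omega : measurableType dO) (P : probability Omega R)
  (xi : nat -> {RV P >-> Xi}) (xi_iid : iid_from F xi)
  (* measurability conventions *)
  (h_meas : forall x : D, measurable_fun [set: Xi] (h x))
  (H_meas : forall k : nat, (0 < k)%N ->
     measurable_fun [set: k.-tuple Xi] (@saa_value R D Xi h k))
  (delta : R) (delta_gt0 : 0 < delta)
  (sup_meas : measurable_fun [set: Xi] (sup_abs_sqr h))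
  (supdiff_meas :
     measurable_fun [set: Xi * Xi] (sup_absdiff_pow h (2 + delta)))
  (* moment conditions *)
  (sup_moment : (\int[F]_z sup_abs_sqr h z < +oo)%E)
  (supdiff_moment :
     (\int[F \x F]_zz sup_absdiff_pow h (2 + delta) zz < +oo)%E)
  (* versions of g_k(z) = E[H_k(xi_1, ..., xi_k) | xi_1 = z] *)
  (g : nat -> Xi -> R)
  (g_cond : forall k : nat, (0 < k)%N ->
     cond_expectation_given (xi 0%N) (saa_sample h xi k) (g k))
  (* resample sizes *)
  (k : nat -> nat)
  (k_range : forall n : nat, (0 < n)%N -> (1 <= k n <= n)%N)
  (gamma : R) (gamma_lt : gamma < 2^-1)
  (k_growth : (fun n : nat => (k n)%:R : R) =O_\oo
              (fun n : nat => n%:R `^ gamma : R)) :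
  let W (m : nat) : R := fine 'E_P[saa_sample h xi m] in
  let Vg (m : nat) : R := fine 'V_P[g m \o xi 0%N] in
  exists (dA : measure_display) (A : measurableType dA) (Q : probability A R)
         (Z : nat -> {RV (P \x Q)%E >-> R}),
    [/\ forall n : nat, (0 < n)%N ->
          ('E_(P \x Q)[Z n] = 0)%E /\ ('V_(P \x Q)[Z n] = 1)%E,
        cvg_in_probability0 (P \x Q)%E
          (fun (n : nat) (w : Omega * A) =>
             Num.sqrt n%:R * (vstat h xi n (k n) w.1 - W (k n))
             - (k n)%:R * Num.sqrt (Vg (k n)) * Z n w) &
        forall phi : nat -> nat, {homo phi : i j / (i < j)%N} ->
          ((k (phi j))%:R ^+ 2 * Vg (k (phi j))
             * (phi j)%:R `^ (delta / (2 + delta)) : R)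
            @[j --> \oo] --> +oo ->
          cvg_in_distribution (fun j => Z (phi j)) (normal_prob 0 1)].
Proof.
move=> W Vg.
have p2 : 2 <= 2 + delta by rewrite lerDl ltW.
pose D' := diff_envelope D_nonempty (2 + delta) sup_meas sup_moment.
pose c := 2 * (1 + 9 * \int[F]_x \int[F]_y (D' (x, y) ^+ 2)).
pose cp := \int[F]_x \int[F]_y (D' (x, y) `^ (2 + delta)).
have proj m : (0 < m)%N -> let G z := g m z - W m in
    [/\ measurable_fun setT G, L1 F (fun z => G z ^+ 2), \int[F]_z G z = 0,
      \int[F]_z (G z ^+ 2) = Vg m &
      L1 F (fun z => `|m%:R * G z| `^ (2 + delta)) /\
      \int[F]_z (`|m%:R * G z| `^ (2 + delta)) <= cp].
  case: m => // m _ G.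
  have gm := g_cond m.+1 isT.
  split.
  - exact: (measurable_saa_G D_nonempty xi_iid H_meas sup_meas sup_moment gm).
  - exact: (L1_sqr_saa_G D_nonempty xi_iid H_meas p2 sup_meas supdiff_meas sup_moment supdiff_moment gm).
  - exact: (mean_saa_G D_nonempty xi_iid H_meas sup_meas sup_moment gm).
  - exact/esym/(variance_saa_G D_nonempty xi_iid H_meas p2 sup_meas supdiff_meas sup_moment supdiff_moment gm).
  - exact: (moment_saa_G D_nonempty xi_iid H_meas p2 sup_meas supdiff_meas sup_moment supdiff_moment gm).
have rem m n : (0 < m)%N -> (0 < n)%N ->
    let T w := (vstat h xi n m w - W m)
      - m%:R / n%:R * iid_sum xi (fun z => g m z - W m) n w in
    L1 P T /\ \int[P]_w `|T w| <= c * (m%:R / n%:R).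
  case: m => // m _ n0.
  exact: (saa_hajek_bound D_nonempty xi_iid H_meas p2 sup_meas supdiff_meas sup_moment supdiff_moment (g_cond m.+1 isT) n0).
have k0 n : (0 < n)%N -> (0 < k n)%N by move=> /k_range/andP[].
pose G n z := g (k n) z - W (k n).
pose v n := Vg (k n).
have mG n : (0 < n)%N -> measurable_fun setT (G n) by move=> /k0/proj[].
have G2 n : (0 < n)%N -> L1 F (fun z => G n z ^+ 2) by move=> /k0/proj[].
have EG n : (0 < n)%N -> \int[F]_z G n z = 0 by move=> /k0/proj[].
have EG2 n : (0 < n)%N -> \int[F]_z (G n z ^+ 2) = v n by move=> /k0/proj[].
have Gp n : (0 < n)%N -> L1 F (fun z => `|(k n)%:R * G n z| `^ (2 + delta)) /\
   \int[F]_z (`|(k n)%:R * G n z| `^ (2 + delta)) <= cp by move=> /k0/proj[].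
pose Q : probability (measurableTypeR R) R := normal_prob (0 : R) 1.
pose Zf n := normalized_sum xi n (v n) (G n).
(* A random variable is required for every n. At n = 0, where nothing is known of [G], it is the
   auxiliary coordinate. *)
have mZ n : measurable_fun setT (Zf n) by apply: measurable_normalized_sum; exact: mG.
pose Z n : {RV (P \x Q)%E >-> R} :=
  HB.pack (Zf n) (isMeasurableFun.Build _ _ _ _ (Zf n) (mZ n)).
exists _, (measurableTypeR R), Q, Z; split.
- move=> n n0.
  have Z2 : L1 (P \x Q)%E (fun w => Zf n w ^+ 2).
    exact: (L1_sqr_normalized_sum xi_iid (v n) (mG n) (@G2 n)).
  have Z1 : L1 (P \x Q)%E (Zf n) by exact: L1_sqr.
  have EZ : ('E_(P \x Q)[Z n] = 0)%E.
    rewrite unlock -(EFin_Rintegral Z1); congr EFin.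
    exact: (mean_normalized_sum xi_iid (v n) (mG n) (@G2 n) (@EG n)).
  split => //; rewrite /variance unlock EZ [RHS](_ : _ = (\int[(P \x Q)%E]_w (Zf n w ^+ 2))%:E).
    rewrite (EFin_Rintegral Z2) unlock; apply: eq_integral => w _.
    by rewrite expr2 -[in RHS](subr0 (Zf n w)).
  by congr EFin; apply/esym; exact: (variance_normalized_sum xi_iid (mG n) (@G2 n) (@EG n) (@EG2 n)).
- move=> e e0.
  have rate := sqrt_rate_cvg0 gamma_lt k_growth.
  have up : (e^-1 * (c * (Num.sqrt n%:R * ((k n)%:R / n%:R))))%:E @[n --> \oo] --> (0 : \bar R).
    apply/fine_cvgP; split; first exact: nearW.
    rewrite -[X in _ --> X](mulr0 e^-1) -(mulr0 c).
    by apply: cvgM; [exact: cvg_cst|apply: cvgM => //; exact: cvg_cst].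
  apply: (squeeze_cvge _ (cvg_cst 0%E) up); near=> n.
  have n0 : (0 < n)%N by near: n; exact: nbhs_infty_gt.
  rewrite measure_ge0/=.
  have [IT ET] := rem (k n) n (k0 n n0) n0.
  apply: (hajek_remainder_probability xi_iid (mG n) (@G2 n) (@EG n) (@EG2 n) n0 e0 _ IT ET).
  apply: measurable_funB => //.
  exact: (measurable_vstat xi H_meas _ (k0 n n0)).
- move=> phi phi_mono ratio_oo x cx.
  exact: (normalized_sum_clt xi_iid delta_gt0 k0 mG G2 EG EG2 Gp phi_mono ratio_oo cx).
Unshelve. all: by end_near. Qed.
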